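(* Let $\mathcal T$ be a triangular algebra of size $n=3$ over a field $k$, $X$ a $\mathcal T$-bimodule, and $E_r^{t,s}$ the spectral sequence associated with the filtration by length of trajectories of the relative Hochschild complex of $\mathcal T$ with coefficients in $X$. With the identifications of the level-1 terms given by representing cocycles: (1) The first level-1 differential $$d_1^{0,l}:\ \bigoplus_{i=1}^3HH^l(A_i,{}_iX_i)\longrightarrow \mathrm{Ext}^l_{A_2-A_1}({}_2M_1,{}_2X_1)\oplus \mathrm{Ext}^l_{A_3-A_2}({}_3M_2,{}_3X_2)\oplus\mathrm{Ext}^l_{A_3-A_1}({}_3M_1,{}_3X_1)$$ is given, for $f,g,h$ in the summands for $A_1,A_2,A_3$ respectively, by $$f+g+h\mapsto \ 1_{{}_2M_1}\cup f+(-1)^{l+1}g\cup 1_{{}_2M_1}\ +\ 1_{{}_3M_2}\cup g+(-1)^{l+1}h\cup 1_{{}_3M_2}\ +\ 1_{{}_3M_1}\cup f+(-1)^{l+1}h\cup 1_{{}_3M_1},$$ where $1_N$ is the identity morphism of $N$. (2) The second level-1 differential $$d_1^{1,l}:\ \mathrm{Ext}^l_{A_2-A_1}({}_2M_1,{}_2X_1)\oplus \mathrm{Ext}^l_{A_3-A_2}({}_3M_2,{}_3X_2)\oplus\mathrm{Ext}^l_{A_3-A_1}({}_3M_1,{}_3X_1)\longrightarrow\mathbf{Ext}^l_{A_3-A_1}(\mathcal C,{}_3X_1)$$ is given by $$f+g+h\mapsto 1_{{}_3M_2}\cup f+(-1)^{l+2}g\cup 1_{{}_2M_1}+\delta h,$$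 where, for $h:A_3^{\otimes q}\otimes{}_3M_1\otimes A_1^{\otimes p}\to{}_3X_1$, $\delta h=(-1)^{q+1}h\circ(1_{A_3}^{\otimes q}\otimes\mu\otimes1_{A_1}^{\otimes p}):A_3^{\otimes q}\otimes{}_3M_2\otimes{}_2M_1\otimes A_1^{\otimes p}\to{}_3X_1$.
   Context: Throughout, $k$ is a field and $\otimes=\otimes_k$; bimodules over $k$-algebras have $k$ acting centrally. $\mathrm{Ext}_{B-A}$ is Ext of $B$-$A$-bimodules. Triangular algebra of size $3$: $A_1,A_2,A_3$ are unital associative $k$-algebras, ${}_jM_i$ is a nonzero $A_j$-$A_i$-bimodule for $1\le i<j\le 3$, and $\mu:{}_3M_2\otimes{}_2M_1\to{}_3M_1$ is an $A_3$-$A_1$-bimodule morphism that is $A_2$-balanced. $\mathcal T$ is the algebra of lower triangular $3\times3$ matrices with $(i,i)$ entry in $A_i$ and $(j,i)$ entry in ${}_jM_i$, with matrix multiplication (using $\mu$). $e_i\in\mathcal T$ is the image of $1_{A_i}$, $R=\bigoplus_i k e_i\subset\mathcal T$, and ${}_jX_i=e_jXe_i$. The relative Hochschild complex $\mathcal H$ has $\mathcal H^l=\mathrm{Hom}_{R-R}(\mathcal T^{\otimes_R l},X)$ ($R$-bimodule morphisms; $\mathcal T^{\otimes_R 0}=R$) with the Hochschild coboundary: $x\mapsto(t\mapsto tx-xt)$ in degree $0$ and $(\delta f)(t_1\otimes\dots\otimes t_{l+1})=t_1f(t_2\otimes\dots\otimes t_{l+1})+\sum_{i=1}^l(-1)^if(\dots\otimes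 t_it_{i+1}\otimes\dots)+(-1)^{l+1}f(t_1\otimes\dots\otimes t_l)t_{l+1}$. The quiver of $\mathcal T$ is $e_1\to e_2\to e_3$. To the trivial path at $e_i$ is associated $M_{e_i}=A_i$, to the path $\gamma$ from $e_i$ to $e_j$ ($i<j$) is associated $M_\gamma={}_jM_i$. An $l$-trajectory is a sequence $\tau=(\gamma_l,\dots,\gamma_1)$ of consecutive paths (trivial ones allowed; for $l=0$, a vertex); $M_\tau=M_{\gamma_l}\otimes\dots\otimes M_{\gamma_1}$ ($=ke_i$ for the $0$-trajectory $e_i$), and $|\tau|$ is the number of non-trivial $\gamma_i$. Then $\mathcal T^{\otimes_Rl}=\bigoplus_\tau M_\tau$, and $F^t\mathcal H^l=\mathrm{Hom}_{R-R}(\bigoplus_{|\tau|\ge t}M_\tau,X)$ (maps vanishing on $M_\tau$ with $|\tau|<t$) defines a decreasing filtration of $\mathcal H$. The spectral sequence has $E_0^{t,s}=F^t\mathcal H^{t+s}/F^{t+1}\mathcal H^{t+s}$. Identifications: $E_0^{0,l}=\bigoplus_i\mathrm{Hom}_k(A_i^{\otimes l},{}_iX_i)$, with $d_0$-cohomology $\bigoplus_iHH^l(A_i,{}_iX_i)$; $E_0^{1,l}=\bigoplus_{i<j}\bigoplus_{p+q=l}\mathrm{Hom}_k(A_j^{\otimes q}\otimes{}_jM_i\otimes A_i^{\otimes p},{}_jX_i)$, with $d_0$-cohomology $\bigoplus_{i<j}\mathrm{Ext}^l_{A_j-A_i}({}_jM_i,{}_jX_i)$ (computed by the bar-type free resolution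 of ${}_jM_i$ by the bimodules $A_j^{\otimes q}\otimes{}_jM_i\otimes A_i^{\otimes p}$, $p,q>0$); $E_0^{2,l}=\bigoplus_{p+q+r=l}\mathrm{Hom}_k(A_3^{\otimes r}\otimes{}_3M_2\otimes A_2^{\otimes q}\otimes{}_2M_1\otimes A_1^{\otimes p},{}_3X_1)$, with $d_0$-cohomology the hyper-Ext $\mathbf{Ext}^l_{A_3-A_1}(\mathcal C,{}_3X_1)$, where $\mathcal C$ is the chain complex $\mathcal C_q={}_3M_2\otimes A_2^{\otimes q}\otimes{}_2M_1$ with differential $d_q(y,b_1,\dots,b_q,x)=-(yb_1,b_2,\dots,x)+\sum_{i=1}^{q-1}(-1)^{i+1}(y,\dots,b_ib_{i+1},\dots,x)+(-1)^{q+1}(y,b_1,\dots,b_qx)$. Cup products on cochains: for an identity $1_N$ with $N={}_jM_i$ and a cochain $f$ with values in ${}_iX_m$, $(1_N\cup f)(y,z_1,z_2,\dots)=y\,f(z_1,z_2,\dots)\in{}_jX_m$; for a cochain $g$ with values in ${}_mX_j$, $(g\cup 1_N)(z_1,z_2,\dots,x)=g(z_1,z_2,\dots)\,x\in{}_mX_i$. The products ${}_jM_i\otimes{}_iX_m\to{}_jX_m$ and ${}_mX_j\otimes{}_jM_i\to{}_mX_i$ come from the $\mathcal T$-bimodule structure of $X$. Classes are represented by cocycles and all formulas (including $\delta h$) are extended additively over the components indexed by the exponents $p,q$. *)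

(* Defs.v *)
From HB Require Import structures.
From mathcomp Require Import all_boot all_order all_algebra.
From mathcomp Require Import boolp classical_sets functions.

Set Implicit Arguments.
Unset Strict Implicit.
Unset Printing Implicit Defensive.

Import GRing.Theory.
Local Open Scope ring_scope.

Definition lin_closed (k : pzRingType) (V : lmodType k) (S : V -> Prop) : Prop :=
  S 0 /\ forall c u v, S u -> S v -> S (c *: u + v).

Record submod (k : pzRingType) (V : lmodType k) := Submod {
  submod_set :> V -> Prop;
  submodP : lin_closed submod_set }.

Section Subquot.
Context {k : pzRingType} {V : lmodType k}.

Lemma submod0 (Z : submod V) : Z 0.
Proof. exact: (submodP Z).1. Qed.

Lemma submodL (Z : submod V) c u v : Z u -> Z v -> Z (c *: u + v).
Proof. exact: (submodP Z).2. Qed.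

Lemma submodD (Z : submod V) u v : Z u -> Z v -> Z (u + v).
Proof. by move=> Zu Zv; rewrite -[u]scale1r; apply: submodL. Qed.

Lemma submodZ (Z : submod V) c u : Z u -> Z (c *: u).
Proof.
by move=> Zu; rewrite -[_ *: _]addr0; apply: submodL => //; apply: submod0.
Qed.

Lemma submodN (Z : submod V) u : Z u -> Z (- u).
Proof. by move=> Zu; rewrite -scaleN1r; apply: submodZ. Qed.

Lemma submodB (Z : submod V) u v : Z u -> Z v -> Z (u - v).
Proof. by move=> Zu Zv; apply: submodD => //; apply: submodN. Qed.

Variables Z B : submod V.

Definition coset_in (z : V) : V -> Prop := fun x => Z x /\ B (x - z).

(* The module Z / (Z \cap B), whose elements are cosets. *)
Record subquot := Subquot {
  sq_set : V -> Prop;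
  sq_setP : exists2 z, Z z & sq_set = coset_in z }.

HB.instance Definition _ := gen_eqMixin subquot.
HB.instance Definition _ := gen_choiceMixin subquot.

Lemma cls_subproof (z : V) :
  exists2 z', Z z' & coset_in (if `[< Z z >] then z else 0) = coset_in z'.
Proof.
by case: asboolP => [Zz|_]; [exists z|exists 0 => //; apply: submod0].
Qed.

(* The class of z; the value is meaningful only when Z z holds. *)
Definition cls (z : V) : subquot := Subquot (cls_subproof z).

Definition rep (q : subquot) : V := sval (cid2 (sq_setP q)).

Lemma repP q : Z (rep q).
Proof. by rewrite /rep; case: cid2. Qed.

Lemma subquot_inj (p q : subquot) : sq_set p = sq_set q -> p = q.
Proof.
case: p q => [p Pp] [q Pq] /= epq; subst q.
by rewrite (Prop_irrelevance Pp Pq).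
Qed.

Lemma sq_set_cls z : Z z -> sq_set (cls z) = coset_in z.
Proof. by move=> Zz /=; rewrite asboolT. Qed.

Lemma repK q : cls (rep q) = q.
Proof.
apply: subquot_inj; rewrite sq_set_cls; last exact: repP.
by rewrite /rep; case: cid2.
Qed.

Lemma eq_cls u v : Z u -> Z v -> (cls u = cls v) <-> B (u - v).
Proof.
move=> Zu Zv; split=> [e|Buv].
  have : sq_set (cls u) u.
    by rewrite sq_set_cls //; split=> //; rewrite subrr; apply: submod0.
  by rewrite e sq_set_cls // => -[].
apply: subquot_inj; rewrite !sq_set_cls //; apply/funext => x.
apply/propext; split=> -[Zx Bx]; split=> //.
  by rewrite -[x](subrK u) -addrA; apply: submodD.
by rewrite -[x](subrK v) -addrA; apply: submodD => //;
   rewrite -opprB; apply: submodN.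
Qed.

Lemma rep_cls u : Z u -> B (rep (cls u) - u).
Proof. by move=> Zu; apply/eq_cls; rewrite ?repK //; apply: repP. Qed.

Definition sq_add p q := cls (rep p + rep q).
Definition sq_opp p := cls (- rep p).
Definition sq_scale c p := cls (c *: rep p).

Lemma cls_add u v : Z u -> Z v -> sq_add (cls u) (cls v) = cls (u + v).
Proof.
move=> Zu Zv; apply/eq_cls; [by apply: submodD; apply: repP|exact: submodD|].
by rewrite opprD addrACA; apply: submodD; apply: rep_cls.
Qed.

Lemma cls_opp u : Z u -> sq_opp (cls u) = cls (- u).
Proof.
move=> Zu; apply/eq_cls; [by apply: submodN; apply: repP|exact: submodN|].
by rewrite -opprD; apply: submodN; apply: rep_cls.
Qed.

Lemma cls_scale c u : Z u -> sq_scale c (cls u) = cls (c *: u).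
Proof.
move=> Zu; apply/eq_cls; [by apply: submodZ; apply: repP|exact: submodZ|].
by rewrite -scalerBr; apply: submodZ; apply: rep_cls.
Qed.

Lemma cls_ind (P : subquot -> Prop) : (forall z, Z z -> P (cls z)) ->
  forall q, P q.
Proof. by move=> H q; rewrite -[q]repK; apply: H; apply: repP. Qed.

Local Hint Resolve submod0 submodD submodN submodZ : core.

Fact sq_addA : associative sq_add.
Proof.
elim/cls_ind=> x Zx; elim/cls_ind=> y Zy; elim/cls_ind=> z Zz.
by rewrite !cls_add ?addrA; auto.
Qed.

Fact sq_addC : commutative sq_add.
Proof. by move=> p q; rewrite /sq_add addrC. Qed.

Fact sq_add0 : left_id (cls 0) sq_add.
Proof. by elim/cls_ind=> x Zx; rewrite cls_add ?add0r; auto. Qed.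

Fact sq_addN : left_inverse (cls 0) sq_opp sq_add.
Proof. by elim/cls_ind=> x Zx; rewrite cls_opp // cls_add ?addNr; auto. Qed.

HB.instance Definition _ :=
  GRing.isZmodule.Build subquot sq_addA sq_addC sq_add0 sq_addN.

Fact sq_scaleA a b p : sq_scale a (sq_scale b p) = sq_scale (a * b) p.
Proof. by elim/cls_ind: p => x Zx; rewrite !cls_scale ?scalerA; auto. Qed.

Fact sq_scale1 : left_id 1 sq_scale.
Proof. by elim/cls_ind=> x Zx; rewrite cls_scale ?scale1r. Qed.

Fact sq_scaleDr : right_distributive sq_scale +%R.
Proof.
move=> c; elim/cls_ind=> x Zx; elim/cls_ind=> y Zy.
by rewrite [_ + _]cls_add // !cls_scale ?[RHS]cls_add ?scalerDr; auto.
Qed.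

Fact sq_scaleDl p : {morph sq_scale^~ p : a b / a + b}.
Proof.
elim/cls_ind: p => x Zx a b; rewrite !cls_scale //.
by rewrite [RHS]cls_add ?scalerDl; auto.
Qed.

HB.instance Definition _ := GRing.Zmodule_isLmodule.Build k subquot
  sq_scaleA sq_scale1 sq_scaleDr sq_scaleDl.

End Subquot.

Section Cohomology.
Context {k : pzRingType} {V : lmodType k}.
Variables (d : {linear V -> V}) (C : nat -> submod V).

Definition is_cocycle l (x : V) : Prop := C l x /\ d x = 0.

Fact is_cocycleP l : lin_closed (is_cocycle l).
Proof.
split=> [|c u v [Cu du] [Cv dv]].
  by split; [apply: submod0|rewrite linear0].
by split; [apply: submodL|rewrite linearP du dv scaler0 addr0].
Qed.

Definition cocycles l : submod V := Submod (is_cocycleP l).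

Definition is_coboundary l (x : V) : Prop :=
  if l is l'.+1 then exists2 y, C l' y & x = d y else x = 0.

Fact is_coboundaryP l : lin_closed (is_coboundary l).
Proof.
case: l => [|l]; split=> //=; first by move=> c u v -> ->; rewrite scaler0 addr0.
  by exists 0; rewrite ?linear0 //; apply: submod0.
move=> c u v [x Cx ->] [y Cy ->].
by exists (c *: x + y); [apply: submodL|rewrite linearP].
Qed.

Definition coboundaries l : submod V := Submod (is_coboundaryP l).

Definition cohomology l := @subquot k V (cocycles l) (coboundaries l).

Definition coh_class l (z : V) : cohomology l :=
  cls (cocycles l) (coboundaries l) z.

End Cohomology.

(* F t n is the piece F^t C^n of a decreasing filtration of a complex with
   differential d, and F 0 n = C^n.  The indices are the filtration degree t and
   the total degree n: [ss r t n] is the term usually written E_r^(t,n-t).  For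
   t < r the index t.+1 - r truncates to 0, which agrees with F^t C = C for
   negative t. *)

Section SpectralSequence.
Context {k : pzRingType} {V : lmodType k}.
Variables (d : {linear V -> V}) (F : nat -> nat -> submod V).

Definition is_ssZ r t n (x : V) : Prop := F t n x /\ F (t + r)%N n.+1 (d x).

Fact is_ssZP r t n : lin_closed (is_ssZ r t n).
Proof.
split=> [|c u v [Fu du] [Fv dv]].
  by split; rewrite ?linear0; apply: submod0.
by split; rewrite ?linearP; apply: submodL.
Qed.

(* Z_r^t = {x in F^t C^n | d x in F^(t+r) C^(n+1)} *)
Definition ssZ r t n : submod V := Submod (is_ssZP r t n).

Definition is_ssD r t n (x : V) : Prop :=
  if n is n'.+1 then exists y, [/\ F (t.+1 - r)%N n' y, F t n (d y) & x = d y]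
  else x = 0.

Definition is_ssB r t n (x : V) : Prop :=
  exists y z, [/\ F t.+1 n y, F (t + r)%N n.+1 (d y), is_ssD r t n z & x = y + z].

Fact is_ssBP r t n : lin_closed (is_ssB r t n).
Proof.
have D0 : is_ssD r t n 0.
  case: n => //= n; exists 0; rewrite linear0.
  by split=> //; apply: submod0.
have DL c u v : is_ssD r t n u -> is_ssD r t n v -> is_ssD r t n (c *: u + v).
  case: n {D0} => [|n] /=; first by move=> -> ->; rewrite scaler0 addr0.
  move=> [x [Fx Fdx ->]] [y [Fy Fdy ->]]; exists (c *: x + y).
  by rewrite linearP; split=> //; apply: submodL.
split; first by exists 0, 0; rewrite linear0 addr0; split=> //; apply: submod0.
move=> c u v [y [z [Fy Fdy Dz ->]]] [y' [z' [Fy' Fdy' Dz' ->]]].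
exists (c *: y + y'), (c *: z + z'); rewrite linearP; split.
- exact: submodL.
- exact: submodL.
- exact: DL.
- by rewrite scalerDr addrACA.
Qed.

(* Z_(r-1)^(t+1) + (F^t C^n \cap d (F^(t-r+1) C^(n-1))) *)
Definition ssB r t n : submod V := Submod (is_ssBP r t n).

Definition ss r t n := @subquot k V (ssZ r t n) (ssB r t n).

Definition ss_class r t n (x : V) : ss r t n := cls (ssZ r t n) (ssB r t n) x.

(* d_r, induced by d; when d is a filtered differential, the result does not
   depend on the representative. *)
Definition ss_d r t n (xi : ss r t n) : ss r (t + r) n.+1 :=
  ss_class r (t + r) n.+1 (d (rep xi)).

End SpectralSequence.

Record bimod (k : fieldType) (B A : algType k) := Bimod {
  bimod_sort :> lmodType k;
  lact : B -> bimod_sort -> bimod_sort;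
  ract : bimod_sort -> A -> bimod_sort;
  lact_linearl : forall x, linear (lact^~ x);
  lact_linearr : forall b, linear (lact b);
  ract_linearl : forall a, linear (ract^~ a);
  ract_linearr : forall x, linear (ract x);
  lact1 : forall x, lact 1 x = x;
  lactM : forall b b' x, lact (b * b') x = lact b (lact b' x);
  ract1 : forall x, ract x 1 = x;
  ractM : forall x a a', ract x (a * a') = ract (ract x a) a';
  lractA : forall b x a, ract (lact b x) a = lact b (ract x a) }.

Arguments lact {k B A b} : rename.
Arguments ract {k B A b} : rename.

Notation "b *> x" := (lact b x) (at level 40, left associativity) : ring_scope.
Notation "x <* a" := (ract x a) (at level 40, left associativity) : ring_scope.

Section BimodTheory.
Context {k : fieldType} {B A : algType k} {Y : bimod B A}.
Implicit Types (b : B) (a : A) (x y : Y).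

Lemma lactDr b x y : b *> (x + y) = b *> x + b *> y.
Proof. by rewrite -[x]scale1r lact_linearr !scale1r. Qed.

Lemma lactDl b b' x : (b + b') *> x = b *> x + b' *> x.
Proof. by rewrite -[b]scale1r (lact_linearl x) !scale1r. Qed.

Lemma lact0r b : b *> (0 : Y) = 0.
Proof. by apply: (addrI (b *> (0 : Y))); rewrite -lactDr !addr0. Qed.

Lemma lact0l x : (0 : B) *> x = 0.
Proof. by apply: (addrI ((0 : B) *> x)); rewrite -lactDl !addr0. Qed.

Lemma lactZr b c x : b *> (c *: x) = c *: (b *> x).
Proof. by rewrite -[c *: x]addr0 lact_linearr lact0r addr0. Qed.

Lemma lactZl c b x : (c *: b) *> x = c *: (b *> x).
Proof. by rewrite -[c *: b]addr0 (lact_linearl x) lact0l addr0. Qed.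

Lemma ractDl x y a : (x + y) <* a = x <* a + y <* a.
Proof. by rewrite -[x]scale1r (ract_linearl a) !scale1r. Qed.

Lemma ractDr x a a' : x <* (a + a') = x <* a + x <* a'.
Proof. by rewrite -[a]scale1r ract_linearr !scale1r. Qed.

Lemma ract0l a : (0 : Y) <* a = 0.
Proof. by apply: (addrI ((0 : Y) <* a)); rewrite -ractDl !addr0. Qed.

Lemma ract0r x : x <* (0 : A) = 0.
Proof. by apply: (addrI (x <* (0 : A))); rewrite -ractDr !addr0. Qed.

Lemma ractZl c x a : (c *: x) <* a = c *: (x <* a).
Proof. by rewrite -[c *: x]addr0 (ract_linearl a) ract0l addr0. Qed.

Lemma ractZr c x a : x <* (c *: a) = c *: (x <* a).
Proof. by rewrite -[c *: a]addr0 ract_linearr ract0r addr0. Qed.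

End BimodTheory.

Section LinClosed.
Context {k : pzRingType} {V W : lmodType k}.

Lemma lin_closed_eq (f g : V -> W) :
  linear f -> linear g -> lin_closed (fun x => f x = g x).
Proof.
move=> lf lg; split=> [|c u v e1 e2]; last by rewrite lf lg e1 e2.
have f0 (h : V -> W) : linear h -> h 0 = 0.
  by move=> lh; have := lh (-1) 0 0; rewrite scaler0 addr0 scaleN1r addNr.
by rewrite !f0.
Qed.

Lemma lin_closed_eq0 (f : V -> W) : linear f -> lin_closed (fun x => f x = 0).
Proof.
by move=> lf; apply: lin_closed_eq => // c u v; rewrite scaler0 addr0.
Qed.

Lemma lin_closed_and (P Q : V -> Prop) :
  lin_closed P -> lin_closed Q -> lin_closed (fun x => P x /\ Q x).
Proof. by move=> [P0 PL] [Q0 QL]; split=> // c u v [] ? ? [] ? ?; split; auto. Qed.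

Lemma lin_closed_and3 (P Q R : V -> Prop) :
  lin_closed P -> lin_closed Q -> lin_closed R ->
  lin_closed (fun x => [/\ P x, Q x & R x]).
Proof.
by move=> [P0 PL] [Q0 QL] [R0 RL]; split=> // c u v [] ? ? ? [] ? ? ?; split; auto.
Qed.

Lemma lin_closed_and4 (P Q R S : V -> Prop) :
  lin_closed P -> lin_closed Q -> lin_closed R -> lin_closed S ->
  lin_closed (fun x => [/\ P x, Q x, R x & S x]).
Proof.
move=> [P0 PL] [Q0 QL] [R0 RL] [S0 SL].
by split=> // c u v [] ? ? ? ? [] ? ? ? ?; split; auto.
Qed.

Lemma lin_closed_and5 (P Q R S T : V -> Prop) :
  lin_closed P -> lin_closed Q -> lin_closed R -> lin_closed S ->
  lin_closed T -> lin_closed (fun x => [/\ P x, Q x, R x, S x & T x]).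
Proof.
move=> [P0 PL] [Q0 QL] [R0 RL] [S0 SL] [T0 TL].
by split=> // c u v [] ? ? ? ? ? [] ? ? ? ? ?; split; auto.
Qed.

Lemma lin_closed_all (T : Type) (P : T -> V -> Prop) :
  (forall t, lin_closed (P t)) -> lin_closed (fun x => forall t, P t x).
Proof.
move=> H; split=> [t|c u v Pu Pv t]; first exact: (H t).1.
by apply: (H t).2.
Qed.

Lemma lin_closed_imp (A : Prop) (P : V -> Prop) :
  lin_closed P -> lin_closed (fun x => A -> P x).
Proof. by move=> [P0 PL]; split=> // c u v Pu Pv HA; apply: PL; auto. Qed.

Lemma linear_cst0 : linear (fun _ : V => 0 : W).
Proof. by move=> c u v; rewrite scaler0 addr0. Qed.

Lemma linear_addf (f g : V -> W) :
  linear f -> linear g -> linear (fun x => f x + g x).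
Proof. by move=> lf lg c u v; rewrite lf lg scalerDr addrACA. Qed.

Lemma linear_oppf (f : V -> W) : linear f -> linear (fun x => - f x).
Proof. by move=> lf c u v; rewrite lf opprD scalerN. Qed.

Lemma linear_sumf (I : Type) (r : seq I) (f : I -> V -> W) :
  (forall i, linear (f i)) -> linear (fun x => \sum_(i <- r) f i x).
Proof.
move=> lf c u v; rewrite scaler_sumr -big_split /=.
by apply: eq_bigr => i _; apply: lf.
Qed.

End LinClosed.

Lemma linear_scalef (k : comPzRingType) (V W : lmodType k) b (f : V -> W) :
  linear f -> linear (fun x => b *: f x).
Proof. by move=> lf c u v; rewrite lf scalerDr !scalerA mulrC. Qed.

Lemma linear_lactf (k : fieldType) (B A : algType k) (Y : bimod B A)
  (V : lmodType k) b (f : V -> Y) : linear f -> linear (fun x => b *> f x).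
Proof. by move=> lf c u v; rewrite lf lact_linearr. Qed.

Lemma linear_ractf (k : fieldType) (B A : algType k) (Y : bimod B A)
  (V : lmodType k) a (f : V -> Y) : linear f -> linear (fun x => f x <* a).
Proof. by move=> lf c u v; rewrite lf ract_linearl. Qed.

(* Linear maps out of a tensor product are represented by multilinear maps.  A
   map out of A^(tensor l) is a function on [seq A] vanishing on the lists of
   length other than l; thus a map out of a direct sum of tensor products of
   total degree l is a single function on lists, vanishing on the lists of the
   wrong total length. *)

Definition multilinear (k : pzRingType) (A W : lmodType k) (f : seq A -> W) :=
  forall s1 s2 c u v, f (s1 ++ (c *: u + v) :: s2) =
    c *: f (s1 ++ u :: s2) + f (s1 ++ v :: s2).

Lemma lin_closed_multilinear (k : comPzRingType) (V A W : lmodType k)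
  (L : V -> seq A -> W) :
  (forall s, linear (L^~ s)) -> lin_closed (fun x => multilinear (L x)).
Proof.
move=> lL; do 5!apply: lin_closed_all => ?.
by apply: lin_closed_eq; [|apply: linear_addf; [apply: linear_scalef|]].
Qed.

(* (t_0, ..., t_i, t_(i+1), ...) |-> (t_0, ..., t_i t_(i+1), ...) *)
Definition merge (A : pzRingType) (i : nat) (s : seq A) : seq A :=
  take i s ++ nth 0 s i * nth 0 s i.+1 :: drop i.+2 s.

Section Hochschild.
Context {k : fieldType} {A : algType k} (Y : bimod A A).
Implicit Type f : seq A -> Y.

Definition is_hoch_cochain l f : Prop :=
  multilinear f /\ (forall s, size s <> l -> f s = 0).

Fact is_hoch_cochainP l : lin_closed (is_hoch_cochain l).
Proof.
apply: lin_closed_and; first exact: (lin_closed_multilinear (L := id)).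
by do 2!apply: lin_closed_all => ?; apply: lin_closed_eq0.
Qed.

Definition hoch_cochain l : submod (seq A -> Y) := Submod (is_hoch_cochainP l).

Definition hoch_diff f : seq A -> Y := fun s =>
  if s is t :: s' then
    t *> f s'
    + \sum_(1 <= i < size s) (-1) ^+ i *: f (merge i.-1 s)
    + (-1) ^+ size s *: (f (belast t s') <* last t s')
  else 0.

Fact hoch_diff_linear : linear hoch_diff.
Proof.
move=> c f g; apply/funext; case=> [|t s].
  by rewrite -[RHS]/(c *: 0 + 0) scaler0 addr0.
pose D f := hoch_diff f (t :: s); rewrite -[LHS]/(D _) -[RHS]/(c *: D f + D g).
move: c f g; rewrite -/(linear D); apply: linear_addf.
  apply: linear_addf; first exact: linear_lactf.
  by apply: linear_sumf => i; apply: linear_scalef.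
by apply: linear_scalef; apply: linear_ractf.
Qed.

HB.instance Definition _ := GRing.isLinear.Build k (seq A -> Y) (seq A -> Y) _
  hoch_diff hoch_diff_linear.

Definition HH l := cohomology hoch_diff hoch_cochain l.

Definition HH_cocycle l f : Prop := cocycles hoch_diff hoch_cochain l f.

Definition HH_class l f : HH l := coh_class hoch_diff hoch_cochain l f.

(* R-bimodule maps A \otimes_R ... \otimes_R A -> Y, for a subset R of A.  In
   degree 0, a map R -> Y is represented by the image y of 1. *)
Definition R_bilinear (R : A -> Prop) f : Prop :=
  [/\ forall r, R r -> r *> f [::] = f [::] <* r,
      forall r t s, R r -> f (r * t :: s) = r *> f (t :: s),
      forall r s t, R r -> f (rcons s (t * r)) = f (rcons s t) <* r
    & forall r s1 t t' s2, R r ->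
        f (s1 ++ t * r :: t' :: s2) = f (s1 ++ t :: r * t' :: s2)].

Definition is_rel_cochain (R : A -> Prop) l f : Prop :=
  is_hoch_cochain l f /\ R_bilinear R f.

Fact is_rel_cochainP R l : lin_closed (is_rel_cochain R l).
Proof.
apply: lin_closed_and; first exact: is_hoch_cochainP.
apply: lin_closed_and4.
- do 1!apply: lin_closed_all => ?; apply: lin_closed_imp.
  by apply: lin_closed_eq; [apply: linear_lactf|apply: linear_ractf].
- do 3!apply: lin_closed_all => ?; apply: lin_closed_imp.
  by apply: lin_closed_eq; last apply: linear_lactf.
- do 3!apply: lin_closed_all => ?; apply: lin_closed_imp.
  by apply: lin_closed_eq; last apply: linear_ractf.
- do 5!apply: lin_closed_all => ?; apply: lin_closed_imp.
  exact: lin_closed_eq.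
Qed.

Definition rel_cochain R l : submod (seq A -> Y) := Submod (is_rel_cochainP R l).

End Hochschild.

Section Ext.
Context {k : fieldType} {B A : algType k} (N Y : bimod B A).

Local Notation bar_space := (seq B * N * seq A -> Y)%type.
Implicit Type f : bar_space.

(* The bar-type resolution of N is, in degree l, the direct sum of the free
   bimodules B^(tensor q) \otimes N \otimes A^(tensor p), with p, q > 0 and
   p + q = l + 2, and its differential is the sum of (-1)^i times the product of
   the i-th and (i+1)-st tensor factors (numbered from 0).  [bar_cochain l]
   consists of the B-A-bimodule maps from its degree l part to Y. *)
Definition is_bar_cochain l f : Prop :=
  [/\ [/\ forall n a, multilinear (fun b => f (b, n, a)),
          forall b a, linear (fun n => f (b, n, a))
        & forall b n, multilinear (fun a => f (b, n, a))],
      forall b n a, ~~ [&& 0 < size b, 0 < size a & size b + size a == l.+2]%N ->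
        f (b, n, a) = 0,
      forall b0 b1 b n a, f (b0 * b1 :: b, n, a) = b0 *> f (b1 :: b, n, a)
    & forall b n a a1 a0, f (b, n, rcons a (a1 * a0)) = f (b, n, rcons a a1) <* a0].

Fact is_bar_cochainP l : lin_closed (is_bar_cochain l).
Proof.
apply: lin_closed_and4; first apply: lin_closed_and3.
- do 2!apply: lin_closed_all => ?.
  exact: (lin_closed_multilinear (L := fun f b => f (b, _, _))).
- do 5!apply: lin_closed_all => ?; apply: lin_closed_eq => //.
  by apply: linear_addf => //; apply: linear_scalef.
- do 2!apply: lin_closed_all => ?.
  exact: (lin_closed_multilinear (L := fun f a => f (_, _, a))).
- do 3!apply: lin_closed_all => ?; apply: lin_closed_imp.
  exact: lin_closed_eq0.
- do 5!apply: lin_closed_all => ?; apply: lin_closed_eq => //.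
  exact: linear_lactf.
- do 5!apply: lin_closed_all => ?; apply: lin_closed_eq => //.
  exact: linear_ractf.
Qed.

Definition bar_cochain l : submod bar_space :=
  Submod (is_bar_cochainP l).

Definition bar_diff f : bar_space := fun '(b, n, a) =>
  let q := size b in let p := size a in
  \sum_(0 <= i < q.-1) (-1) ^+ i *: f (merge i b, n, a)
  + (-1) ^+ q.-1 *: f (take q.-1 b, last 0 b *> n, a)
  + (-1) ^+ q *: f (b, n <* head 0 a, behead a)
  + \sum_(0 <= i < p.-1) (-1) ^+ (q.+1 + i) *: f (b, n, merge i a).

Fact bar_diff_linear : linear bar_diff.
Proof.
move=> c f g; apply/funext => -[[b n] a].
pose D f := bar_diff f (b, n, a); rewrite -[LHS]/(D _) -[RHS]/(c *: D f + D g).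
move: c f g; rewrite -/(linear D).
by do !apply: linear_addf; do ?apply: linear_scalef => //;
   apply: linear_sumf => i; apply: linear_scalef.
Qed.

HB.instance Definition _ := GRing.isLinear.Build k bar_space bar_space _
  bar_diff bar_diff_linear.

Definition Ext l := cohomology bar_diff bar_cochain l.

(* Families of k-linear maps B^(tensor q) \otimes N \otimes A^(tensor p) -> Y,
   for p, q >= 0 and p + q = l. *)
Definition is_ext_cochain l f : Prop :=
  [/\ forall n a, multilinear (fun b => f (b, n, a)),
      forall b a, linear (fun n => f (b, n, a)),
      forall b n, multilinear (fun a => f (b, n, a))
    & forall b n a, (size b + size a)%N <> l -> f (b, n, a) = 0].

(* The isomorphism Hom_k(V, Y) = Hom_(B-A)(B \otimes V \otimes A, Y), by which an
   element of [bar_cochain l] is represented by one of [is_ext_cochain l]. *)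
Definition bimod_ext f : bar_space := fun '(b, n, a) =>
  match b, a with
  | b0 :: b', a0 :: a' => b0 *> f (b', n, belast a0 a') <* last a0 a'
  | _, _ => 0
  end.

Definition Ext_cocycle l f : Prop :=
  is_ext_cochain l f /\ bar_diff (bimod_ext f) = 0.

Definition Ext_class l f : Ext l :=
  coh_class bar_diff bar_cochain l (bimod_ext f).

End Ext.

Section HyperExt.
Context {k : fieldType} {B S A : algType k}.
Variables (P : bimod B S) (Q : bimod S A) (Y : bimod B A).

(* The chain complex C of B-A-bimodules is C_q = P \otimes S^(tensor q) \otimes Q;
   [comp_d g] is the composite of g with its differential d_q. *)
Definition comp_d (g : P -> seq S -> Q -> Y) : P -> seq S -> Q -> Y :=
  fun y b x =>
  if b is b1 :: b' then
    let q := size b in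
    - g (y <* b1) b' x
    + \sum_(1 <= i < q) (-1) ^+ i.+1 *: g y (merge i.-1 b) x
    + (-1) ^+ q.+1 *: g y (belast b1 b') (last b1 b' *> x)
  else 0.

Local Notation hyper_space := (seq B * P * seq S * Q * seq A -> Y)%type.
Implicit Type f : hyper_space.

(* The B-A-bimodule maps to Y from the degree l part of the bar-type resolution
   of C, which is the direct sum of the free bimodules
   B^(tensor r) \otimes C_q \otimes A^(tensor p), with r, p > 0 and
   r + q + p = l + 2. *)
Definition is_hyper_cochain l f : Prop :=
  [/\ [/\ forall y b x c, multilinear (fun a => f (a, y, b, x, c)),
          forall a b x c, linear (fun y => f (a, y, b, x, c)),
          forall a y x c, multilinear (fun b => f (a, y, b, x, c)),
          forall a y b c, linear (fun x => f (a, y, b, x, c))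
        & forall a y b x, multilinear (fun c => f (a, y, b, x, c))],
      forall a y b x c,
        ~~ [&& 0 < size a, 0 < size c & size a + size b + size c == l.+2]%N ->
        f (a, y, b, x, c) = 0,
      forall a0 a1 a y b x c,
        f (a0 * a1 :: a, y, b, x, c) = a0 *> f (a1 :: a, y, b, x, c)
    & forall a y b x c c1 c0,
        f (a, y, b, x, rcons c (c1 * c0)) = f (a, y, b, x, rcons c c1) <* c0].

Fact is_hyper_cochainP l : lin_closed (is_hyper_cochain l).
Proof.
apply: lin_closed_and4; first apply: lin_closed_and5.
- do 4!apply: lin_closed_all => ?.
  exact: (lin_closed_multilinear (L := fun f a => f (a, _, _, _, _))).
- do 7!apply: lin_closed_all => ?; apply: lin_closed_eq => //.
  by apply: linear_addf => //; apply: linear_scalef.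
- do 4!apply: lin_closed_all => ?.
  exact: (lin_closed_multilinear (L := fun f b => f (_, _, b, _, _))).
- do 7!apply: lin_closed_all => ?; apply: lin_closed_eq => //.
  by apply: linear_addf => //; apply: linear_scalef.
- do 4!apply: lin_closed_all => ?.
  exact: (lin_closed_multilinear (L := fun f c => f (_, _, _, _, c))).
- do 5!apply: lin_closed_all => ?; apply: lin_closed_imp.
  exact: lin_closed_eq0.
- do 7!apply: lin_closed_all => ?; apply: lin_closed_eq => //.
  exact: linear_lactf.
- do 7!apply: lin_closed_all => ?; apply: lin_closed_eq => //.
  exact: linear_ractf.
Qed.

Definition hyper_cochain l : submod hyper_space :=
  Submod (is_hyper_cochainP l).

(* The transpose of the total differential
   d_B + (-1)^(r-1) d_q + (-1)^(r-1+q) d_A, where d_B and d_A are the alternating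
   sums of the products of consecutive factors, ending with the action of B on
   C_q, respectively starting with the action of A on C_q. *)
Definition hyper_diff f : hyper_space :=
  fun '(a, y, b, x, c) =>
  let r := size a in let q := size b in let p := size c in
  \sum_(0 <= i < r.-1) (-1) ^+ i *: f (merge i a, y, b, x, c)
  + (-1) ^+ r.-1 *: f (take r.-1 a, last 0 a *> y, b, x, c)
  + (-1) ^+ r.-1 *: comp_d (fun y b x => f (a, y, b, x, c)) y b x
  + (-1) ^+ (r.-1 + q) *: (f (a, y, b, x <* head 0 c, behead c)
      + \sum_(0 <= i < p.-1) (-1) ^+ i.+1 *: f (a, y, b, x, merge i c)).

Fact hyper_diff_linear : linear hyper_diff.
Proof.
move=> u f g; apply/funext => -[[[[a y] b] x] c].
pose D f := hyper_diff f (a, y, b, x, c).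
rewrite -[LHS]/(D _) -[RHS]/(u *: D f + D g).
move: u f g; rewrite -/(linear D).
apply: linear_addf; first apply: linear_addf; first apply: linear_addf.
- by apply: linear_sumf => i; apply: linear_scalef.
- exact: linear_scalef.
- apply: linear_scalef; case: b D => [|b0 b] D /=; first exact: linear_cst0.
  apply: linear_addf; first apply: linear_addf.
  + exact: linear_oppf.
  + by apply: linear_sumf => i; apply: linear_scalef.
  + exact: linear_scalef.
- apply: linear_scalef; apply: linear_addf => //.
  by apply: linear_sumf => i; apply: linear_scalef.
Qed.

HB.instance Definition _ := GRing.isLinear.Build k hyper_space hyper_space _
  hyper_diff hyper_diff_linear.

Definition HyperExt l := cohomology hyper_diff hyper_cochain l.

Definition is_hyperext_cochain l f : Prop :=
  [/\ [/\ forall y b x c, multilinear (fun a => f (a, y, b, x, c)),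
          forall a b x c, linear (fun y => f (a, y, b, x, c)),
          forall a y x c, multilinear (fun b => f (a, y, b, x, c)),
          forall a y b c, linear (fun x => f (a, y, b, x, c))
        & forall a y b x, multilinear (fun c => f (a, y, b, x, c))]
    & forall a y b x c, (size a + size b + size c)%N <> l -> f (a, y, b, x, c) = 0].

Definition hyper_bimod_ext f : hyper_space :=
  fun '(a, y, b, x, c) =>
  match a, c with
  | a0 :: a', c0 :: c' => a0 *> f (a', y, b, x, belast c0 c') <* last c0 c'
  | _, _ => 0
  end.

Definition HyperExt_cocycle l f : Prop :=
  is_hyperext_cochain l f /\ hyper_diff (hyper_bimod_ext f) = 0.

Definition HyperExt_class l f : HyperExt l :=
  coh_class hyper_diff hyper_cochain l (hyper_bimod_ext f).

End HyperExt.

Record triangular (k : fieldType) := Triangular {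
  A1 : algType k; A2 : algType k; A3 : algType k;
  M21 : bimod A2 A1; M32 : bimod A3 A2; M31 : bimod A3 A1;
  M21_neq0 : exists m : M21, m != 0;
  M32_neq0 : exists m : M32, m != 0;
  M31_neq0 : exists m : M31, m != 0;
  mu : M32 -> M21 -> M31;
  mu_linearl : forall x, linear (mu^~ x);
  mu_linearr : forall y, linear (mu y);
  mu_lact : forall a y x, mu (a *> y) x = a *> mu y x;
  mu_ract : forall y x a, mu y (x <* a) = mu y x <* a;
  mu_balanced : forall y b x, mu (y <* b) x = mu y (b *> x) }.

Section TriangularAlgebra.
Context {k : fieldType} (D : triangular k).
Local Notation A1 := (A1 D).
Local Notation A2 := (A2 D).
Local Notation A3 := (A3 D).
Local Notation M21 := (M21 D).
Local Notation M32 := (M32 D).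
Local Notation M31 := (M31 D).

(* ((a1, a2, a3), (m21, m32, m31)) is the lower triangular matrix with diagonal
   a1, a2, a3 and with entry mji in row j and column i. *)
Definition tri : Type := ((A1 * A2 * A3) * (M21 * M32 * M31))%type.

HB.instance Definition _ := GRing.Lmodule.on tri.

Definition Tri a1 a2 a3 m21 m32 m31 : tri := ((a1, a2, a3), (m21, m32, m31)).

Definition tri_one : tri := Tri 1 1 1 0 0 0.

Definition tri_mul (s t : tri) : tri :=
  let: ((a1, a2, a3), (m21, m32, m31)) := s in
  let: ((b1, b2, b3), (n21, n32, n31)) := t in
  Tri (a1 * b1) (a2 * b2) (a3 * b3)
      (m21 <* b1 + a2 *> n21)
      (m32 <* b2 + a3 *> n32)
      (m31 <* b1 + mu m32 n21 + a3 *> n31).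

Lemma muDl y y' x : mu (y + y') x = mu y x + mu y' x :> M31.
Proof. by rewrite -[y]scale1r mu_linearl !scale1r. Qed.

Lemma muDr y x x' : mu y (x + x') = mu y x + mu y x' :> M31.
Proof. by rewrite -[x]scale1r mu_linearr !scale1r. Qed.

Lemma mu0l x : mu 0 x = 0 :> M31.
Proof. by apply: (addrI (mu 0 x)); rewrite -muDl !addr0. Qed.

Lemma mu0r y : mu y 0 = 0 :> M31.
Proof. by apply: (addrI (mu y 0)); rewrite -muDr !addr0. Qed.

Lemma muZl c y x : mu (c *: y) x = c *: mu y x :> M31.
Proof. by rewrite -[c *: y]addr0 mu_linearl mu0l addr0. Qed.

Lemma muZr c y x : mu y (c *: x) = c *: mu y x :> M31.
Proof. by rewrite -[c *: x]addr0 mu_linearr mu0r addr0. Qed.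

Fact tri_mulA : associative tri_mul.
Proof.
move=> [[[a1 a2] a3] [[m21 m32] m31]] [[[b1 b2] b3] [[n21 n32] n31]].
move=> [[[c1 c2] c3] [[p21 p32] p31]]; rewrite /tri_mul /Tri /=.
rewrite !mulrA !ractM !lactM !ractDl !lactDr !lractA !addrA.
rewrite !muDl !muDr !mu_lact !mu_ract mu_balanced.
congr (_, (_, _)).
by rewrite -!addrA; do 2!congr (_ + _); rewrite addrCA.
Qed.

Fact tri_mul1l : left_id tri_one tri_mul.
Proof.
move=> [[[b1 b2] b3] [[n21 n32] n31]]; rewrite /tri_mul /Tri /=.
by rewrite !mul1r !lact1 !ract0l mu0l !add0r.
Qed.

Fact tri_mul1r : right_id tri_one tri_mul.
Proof.
move=> [[[b1 b2] b3] [[n21 n32] n31]]; rewrite /tri_mul /Tri /=.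
by rewrite !mulr1 !ract1 !lact0r mu0r !addr0.
Qed.

Fact tri_mulDl : left_distributive tri_mul +%R.
Proof.
move=> [[[a1 a2] a3] [[m21 m32] m31]] [[[b1 b2] b3] [[n21 n32] n31]].
move=> [[[c1 c2] c3] [[p21 p32] p31]]; rewrite /tri_mul /Tri.
rewrite -[LHS]/(Tri ((a1 + b1) * c1) ((a2 + b2) * c2) ((a3 + b3) * c3)
  ((m21 + n21) <* c1 + (a2 + b2) *> p21) ((m32 + n32) <* c2 + (a3 + b3) *> p32)
  ((m31 + n31) <* c1 + mu (m32 + n32) p21 + (a3 + b3) *> p31)).
rewrite muDl !mulrDl !ractDl !lactDl.
congr (_, (_, _, _)).
- by rewrite addrACA.
- by rewrite addrACA.
- by rewrite [RHS]addrACA; congr (_ + _); rewrite addrACA.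
Qed.

Fact tri_mulDr : right_distributive tri_mul +%R.
Proof.
move=> [[[c1 c2] c3] [[p21 p32] p31]].
move=> [[[a1 a2] a3] [[m21 m32] m31]] [[[b1 b2] b3] [[n21 n32] n31]].
rewrite -[LHS]/(Tri (c1 * (a1 + b1)) (c2 * (a2 + b2)) (c3 * (a3 + b3))
  (p21 <* (a1 + b1) + c2 *> (m21 + n21)) (p32 <* (a2 + b2) + c3 *> (m32 + n32))
  (p31 <* (a1 + b1) + mu p32 (m21 + n21) + c3 *> (m31 + n31))).
rewrite muDr !mulrDr !ractDr !lactDr.
congr (_, (_, _, _)).
- by rewrite addrACA.
- by rewrite addrACA.
- by rewrite [RHS]addrACA; congr (_ + _); rewrite addrACA.
Qed.

Fact tri_one_neq0 : tri_one != 0.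
Proof. by apply/eqP => -[] /eqP; rewrite oner_eq0. Qed.

HB.instance Definition _ := GRing.Zmodule_isNzRing.Build tri
  tri_mulA tri_mul1l tri_mul1r tri_mulDl tri_mulDr tri_one_neq0.

Fact tri_scaleAl c (s t : tri) : c *: (s * t) = (c *: s) * t.
Proof.
case: s t => [[[a1 a2] a3] [[m21 m32] m31]] [[[b1 b2] b3] [[n21 n32] n31]].
rewrite -[RHS]/(Tri ((c *: a1) * b1) ((c *: a2) * b2) ((c *: a3) * b3)
  ((c *: m21) <* b1 + (c *: a2) *> n21) ((c *: m32) <* b2 + (c *: a3) *> n32)
  ((c *: m31) <* b1 + mu (c *: m32) n21 + (c *: a3) *> n31)).
by rewrite muZl !ractZl !lactZl -!scalerAl -!scalerDr.
Qed.

HB.instance Definition _ := GRing.Lmodule_isLalgebra.Build k tri tri_scaleAl.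

Fact tri_scaleAr c (s t : tri) : c *: (s * t) = s * (c *: t).
Proof.
case: s t => [[[a1 a2] a3] [[m21 m32] m31]] [[[b1 b2] b3] [[n21 n32] n31]].
rewrite -[RHS]/(Tri (a1 * (c *: b1)) (a2 * (c *: b2)) (a3 * (c *: b3))
  (m21 <* (c *: b1) + a2 *> (c *: n21)) (m32 <* (c *: b2) + a3 *> (c *: n32))
  (m31 <* (c *: b1) + mu m32 (c *: n21) + a3 *> (c *: n31))).
by rewrite muZr !ractZr !lactZr -!scalerAr -!scalerDr.
Qed.

HB.instance Definition _ := GRing.Lalgebra_isAlgebra.Build k tri tri_scaleAr.

End TriangularAlgebra.

Arguments tri_mul {k D}.

(* A multiplicative linear map, not required to preserve 1. *)
Record corner_map (k : fieldType) (A T : algType k) := CornerMap {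
  corner_fun :> A -> T;
  corner_linear : linear corner_fun;
  cornerM : {morph corner_fun : a b / a * b} }.

Section Corner.
Context {k : fieldType} {T B A : algType k}.
Variables (X : bimod T T) (jB : corner_map B T) (jA : corner_map A T).

Definition corner_pred : {pred X} := [pred x | jB 1 *> x <* jA 1 == x].

Fact corner_submod : submod_closed corner_pred.
Proof.
split=> [|c x y]; rewrite !inE; first by rewrite lact0r ract0l.
move=> /eqP ex /eqP ey.
by rewrite lactDr lactZr ractDl ractZl ex ey.
Qed.

HB.instance Definition _ :=
  GRing.isSubmodClosed.Build k X corner_pred corner_submod.

(* The submodule e X e' of X, for e = jB 1 and e' = jA 1. *)
Record corner_sort : Type := CornerElt {
  corner_val :> X;
  _ : corner_val \in corner_pred }.

HB.instance Definition _ := [isSub for corner_val].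
HB.instance Definition _ := [Choice of corner_sort by <:].
HB.instance Definition _ := [SubChoice_isSubLmodule of corner_sort by <:].

Lemma corner_map_idl b : jB 1 * jB b = jB b.
Proof. by rewrite -cornerM mul1r. Qed.

Lemma corner_map_idr b : jB b * jB 1 = jB b.
Proof. by rewrite -cornerM mulr1. Qed.

Lemma cornerE (x : corner_sort) : jB 1 *> corner_val x <* jA 1 = corner_val x.
Proof. by case: x => x /= /eqP. Qed.

End Corner.

Arguments corner_pred {k T B A} X jB jA.
Arguments corner_sort {k T B A} X jB jA.

Section CornerBimod.
Context {k : fieldType} {T B A : algType k}.
Variables (X : bimod T T) (jB : corner_map B T) (jA : corner_map A T).
Local Notation Y := (corner_sort X jB jA).

Fact corner_proj_subproof (x : X) : jB 1 *> x <* jA 1 \in corner_pred X jB jA.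
Proof.
by rewrite inE -!lractA -lactM corner_map_idl -ractM corner_map_idr.
Qed.

(* x |-> e x e' *)
Definition corner_proj (x : X) : Y := CornerElt (corner_proj_subproof x).

Lemma corner_projK (x : Y) : corner_proj x = x.
Proof. by apply: val_inj; exact: cornerE. Qed.

Definition corner_lact (b : B) (x : Y) : Y :=
  corner_proj (jB b *> corner_val x).

Definition corner_ract (x : Y) (a : A) : Y :=
  corner_proj (corner_val x <* jA a).

Lemma corner_idr (x : Y) : corner_val x <* jA 1 = corner_val x.
Proof. by rewrite -[in LHS](cornerE x) -ractM corner_map_idr cornerE. Qed.

Lemma corner_idl (x : Y) : jB 1 *> corner_val x = corner_val x.
Proof. by rewrite -[in LHS](cornerE x) lractA -lactM corner_map_idr -lractA cornerE. Qed.

Lemma corner_lactE b x : corner_val (corner_lact b x) = jB b *> corner_val x.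
Proof. by rewrite /= -lactM corner_map_idl lractA corner_idr. Qed.

Lemma corner_ractE x a : corner_val (corner_ract x a) = corner_val x <* jA a.
Proof. by rewrite /= lractA -ractM corner_map_idr -lractA corner_idl. Qed.

Lemma corner_valL c (x y : Y) :
  corner_val (c *: x + y) = c *: corner_val x + corner_val y.
Proof. exact: (linearP (val : Y -> X)). Qed.

Lemma corner_eq (x y : Y) : corner_val x = corner_val y -> x = y.
Proof. exact: val_inj. Qed.

Fact corner_lact_linearl x : linear (corner_lact^~ x).
Proof.
move=> c b b'; apply: corner_eq; rewrite corner_valL !corner_lactE.
by rewrite corner_linear lactDl lactZl.
Qed.

Fact corner_lact_linearr b : linear (corner_lact b).
Proof.
move=> c x y; apply: corner_eq; rewrite corner_valL !corner_lactE corner_valL.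
exact: lact_linearr.
Qed.

Fact corner_ract_linearl a : linear (corner_ract^~ a).
Proof.
move=> c x y; apply: corner_eq; rewrite corner_valL !corner_ractE corner_valL.
exact: ract_linearl.
Qed.

Fact corner_ract_linearr x : linear (corner_ract x).
Proof.
move=> c a a'; apply: corner_eq; rewrite corner_valL !corner_ractE.
by rewrite corner_linear ractDr ractZr.
Qed.

Fact corner_lact1 x : corner_lact 1 x = x.
Proof. by apply: corner_eq; rewrite corner_lactE corner_idl. Qed.

Fact corner_lactM b b' x :
  corner_lact (b * b') x = corner_lact b (corner_lact b' x).
Proof. by apply: corner_eq; rewrite !corner_lactE cornerM lactM. Qed.

Fact corner_ract1 x : corner_ract x 1 = x.
Proof. by apply: corner_eq; rewrite corner_ractE corner_idr. Qed.

Fact corner_ractM x a a' :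
  corner_ract x (a * a') = corner_ract (corner_ract x a) a'.
Proof. by apply: corner_eq; rewrite !corner_ractE cornerM ractM. Qed.

Fact corner_lractA b x a :
  corner_ract (corner_lact b x) a = corner_lact b (corner_ract x a).
Proof.
by apply: corner_eq; rewrite corner_lactE !corner_ractE corner_lactE lractA.
Qed.

Definition corner : bimod B A := Bimod
  corner_lact_linearl corner_lact_linearr corner_ract_linearl
  corner_ract_linearr corner_lact1 corner_lactM corner_ract1 corner_ractM
  corner_lractA.

End CornerBimod.

Arguments corner_proj {k T B A} X jB jA x.
Arguments corner {k T B A} X jB jA.

Section Trajectories.
Context {k : fieldType} (D : triangular k).
Local Notation T := (tri D).

Definition in_a1 (a : A1 D) : T := Tri a 0 0 0 0 0.
Definition in_a2 (a : A2 D) : T := Tri 0 a 0 0 0 0.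
Definition in_a3 (a : A3 D) : T := Tri 0 0 a 0 0 0.
Definition in21 (m : M21 D) : T := Tri 0 0 0 m 0 0.
Definition in32 (m : M32 D) : T := Tri 0 0 0 0 m 0.
Definition in31 (m : M31 D) : T := Tri 0 0 0 0 0 m.

Fact in_a1_linear : linear in_a1.
Proof.
move=> c a b.
by rewrite -[RHS]/(Tri _ _ _ _ _ _) /= !scaler0 !addr0.
Qed.

Fact in_a2_linear : linear in_a2.
Proof.
move=> c a b.
by rewrite -[RHS]/(Tri _ _ _ _ _ _) /= !scaler0 !addr0.
Qed.

Fact in_a3_linear : linear in_a3.
Proof.
move=> c a b.
by rewrite -[RHS]/(Tri _ _ _ _ _ _) /= !scaler0 !addr0.
Qed.

Fact in_a1M : {morph in_a1 : a b / a * b}.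
Proof.
move=> a b; rewrite -[RHS]/(tri_mul (in_a1 a) (in_a1 b)) /in_a1 /Tri /=.
by rewrite !mulr0 !ract0l !lact0r mu0l !addr0.
Qed.

Fact in_a2M : {morph in_a2 : a b / a * b}.
Proof.
move=> a b; rewrite -[RHS]/(tri_mul (in_a2 a) (in_a2 b)) /in_a2 /Tri /=.
by rewrite !mulr0 !ract0l !lact0r mu0l !addr0.
Qed.

Fact in_a3M : {morph in_a3 : a b / a * b}.
Proof.
move=> a b; rewrite -[RHS]/(tri_mul (in_a3 a) (in_a3 b)) /in_a3 /Tri /=.
by rewrite !mulr0 !ract0l !lact0r mu0l !addr0.
Qed.

Definition in1 : corner_map (A1 D) T := CornerMap in_a1_linear in_a1M.
Definition in2 : corner_map (A2 D) T := CornerMap in_a2_linear in_a2M.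
Definition in3 : corner_map (A3 D) T := CornerMap in_a3_linear in_a3M.

(* The vertices 1, 2, 3 of the quiver are numbered 0, 1, 2. *)
Definition idem (i : 'I_3) : T := [:: in1 1; in2 1; in3 1]`_i.

Definition span_idem (r : T) : Prop :=
  exists c : 'I_3 -> k, r = \sum_i c i *: idem i.

(* There is a path from i to j in the quiver exactly when i <= j, and then only
   one; the associated component of T is M = e_j T e_i.  A trajectory
   (gamma_l, ..., gamma_1) is given by the target v of gamma_l followed by the
   list vs of the sources of gamma_l, ..., gamma_1 (so a 0-trajectory is a vertex
   v), and its steps are the pairs (target, source) of the gamma_i. *)
Definition steps (v : 'I_3) (vs : seq 'I_3) : seq ('I_3 * 'I_3) :=
  pairmap pair v vs.

Definition trajectory (v : 'I_3) (vs : seq 'I_3) : bool :=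
  path (fun j i : 'I_3 => (i <= j)%N) v vs.

Definition weight (v : 'I_3) (vs : seq 'I_3) : nat :=
  count (fun g => g.1 != g.2) (steps v vs).

Definition in_component (v : 'I_3) (vs : seq 'I_3) (s : seq T) : bool :=
  all2 (fun g t => idem g.1 * t * idem g.2 == t) (steps v vs) s.

Variable X : bimod T T.

(* The factor [idem v] matters only in degree 0, where the value of f on the
   component k e_v of R is e_v (f [::]); in positive degree it acts as the
   identity on the value of f. *)
Definition is_filtered t l (f : seq T -> X) : Prop :=
  rel_cochain X span_idem l f /\
  forall v vs s, trajectory v vs -> size vs = l -> (weight v vs < t)%N ->
    in_component v vs s -> idem v *> f s = 0.

Fact is_filteredP t l : lin_closed (is_filtered t l).
Proof.
apply: lin_closed_and; first exact: is_rel_cochainP.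
do 3!apply: lin_closed_all => ?; do 4!apply: lin_closed_imp.
by apply: lin_closed_eq0; apply: linear_lactf.
Qed.

Definition filtration t l : submod (seq T -> X) := Submod (is_filteredP t l).

(* E_r^(t,n-t) *)
Definition E r t n := ss (@hoch_diff k T X) filtration r t n.

Definition E_cocycle r t n f : Prop := ssZ (@hoch_diff k T X) filtration r t n f.

Definition E_class r t n f : E r t n :=
  ss_class (@hoch_diff k T X) filtration r t n f.

Definition d_ss r t n (xi : E r t n) : E r (t + r) n.+1 := ss_d xi.

(* The components of a cochain on the trajectories of weight 0, 1 and 2; a value
   on such a trajectory already lies in the corner, except that in degree 0
   corner_proj is what takes f [::], the image of 1, to the image of an
   idempotent. *)
Definition res0 (A : algType k) (j : corner_map A T) (f : seq T -> X) :
    seq A -> corner X j j :=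
  fun a => corner_proj X j j (f (map j a)).

Definition res1 (B A : algType k) (N : Type) (jB : corner_map B T)
    (jA : corner_map A T) (jN : N -> T) (f : seq T -> X) :
    seq B * N * seq A -> corner X jB jA :=
  fun '(b, n, a) => corner_proj X jB jA (f (map jB b ++ jN n :: map jA a)).

Definition res2 (f : seq T -> X) :
    seq (A3 D) * M32 D * seq (A2 D) * M21 D * seq (A1 D) -> corner X in3 in1 :=
  fun '(a, y, b, x, c) => corner_proj X in3 in1
    (f (map in3 a ++ in32 y :: map in2 b ++ in21 x :: map in1 c)).

(* In the definitions below jN t *> x and x <* jN t already lie in the target
   corner when N is the corresponding component of T, so that corner_proj acts
   there as the identity. *)

Section Cup.
Context {B S A : algType k}.
Context {jB : corner_map B T} {jS : corner_map S T} {jA : corner_map A T}.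
Variables (N : Type) (jN : N -> T).

Definition cupl_HH (f : seq A -> corner X jA jA) :
    seq B * N * seq A -> corner X jB jA :=
  fun '(b, n, a) =>
  if b is [::] then corner_proj X jB jA (jN n *> corner_val (f a)) else 0.

Definition cupr_HH (g : seq B -> corner X jB jB) :
    seq B * N * seq A -> corner X jB jA :=
  fun '(b, n, a) =>
  if a is [::] then corner_proj X jB jA (corner_val (g b) <* jN n) else 0.

Definition cupl_Ext (Q : Type) (f : seq S * Q * seq A -> corner X jS jA) :
    seq B * N * seq S * Q * seq A -> corner X jB jA :=
  fun '(b, n, s, x, a) =>
  if b is [::] then corner_proj X jB jA (jN n *> corner_val (f (s, x, a))) else 0.

Definition cupr_Ext (P : Type) (g : seq B * P * seq S -> corner X jB jS) :
    seq B * P * seq S * N * seq A -> corner X jB jA :=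
  fun '(b, y, s, n, a) =>
  if a is [::] then corner_proj X jB jA (corner_val (g (b, y, s)) <* jN n) else 0.

End Cup.

Definition delta_mu (h : seq (A3 D) * M31 D * seq (A1 D) -> corner X in3 in1) :
    seq (A3 D) * M32 D * seq (A2 D) * M21 D * seq (A1 D) -> corner X in3 in1 :=
  fun '(a, y, b, x, c) =>
  if b is [::] then (-1) ^+ (size a).+1 *: h (a, mu y x, c) else 0.

End Trajectories.

Arguments in1 {k D}.
Arguments in2 {k D}.
Arguments in3 {k D}.
Arguments in21 {k D} m.
Arguments in32 {k D} m.
Arguments in31 {k D} m.

(* Main.v *)
Require Import Defs.
From HB Require Import structures.
From mathcomp Require Import all_boot all_order all_algebra.
From mathcomp Require Import boolp classical_sets functions.

(** A relative cochain is determined by its values on the words of matrices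
whose letters lie in the components met along a trajectory.  For the quiver with
three vertices in a row there are only seven shapes of such words
([normal_word]), so [res0], [res1] and [res2] are the components of a cochain in
weights 0, 1 and 2, and F^t consists of the relative cochains whose components
of weight less than t vanish ([filtration1P], [filtration2P], [filtration3P]).

Everything rests on the components of a Hochschild coboundary.  Replace a
cochain f by its two-sided extension (t, s, u) |-> t f(s) u: the Hochschild
differential becomes the bare alternating sum over the products of consecutive
letters ([two_sided_hoch]).  Cut this sum at a letter n of the bimodule N
([merge_sum_cat]).  The products on either side of n, and those of n with a
neighbour, make up the bar differential of the component of f on N.  The one
discrepancy occurs when n is multiplied by the first or the last letter of the
word: in the two-sided extension n then acts from outside on a value of f on a
word without n, which gives a cup product with a component of lower weight,
while the bar complex has no such term.  With two bimodule letters y and x there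
is one more possibility, their own product mu(y, x), which gives delta.  Up to
signs, and for every cochain f, this reads
  res0 (d f) = d (res0 f)  [res0_hoch]
  res1 (d f) = d (res1 f) + cup products with res0 f  [bimod_ext_res1_hoch]
  res2 (d f) = d (res2 f) + cup products with res1 f + delta  [hyper_bimod_ext_res2_hoch]

On F^t the components of lower weight vanish, and what remains is d_0 on the
component of weight t.  Any prescribed components extend to a relative cochain
which vanishes in the other weights at stake: evaluate them on the matrix
entries of the letters, summed over the possible positions of the bimodule
letters ([split_sum], [cochain_lift0], [cochain_lift1], [cochain_lift2]).
Therefore taking components induces bijections from the first page onto the
Hochschild, Ext and hyper-Ext groups ([identification0], [identification1],
[identification2]). Finally d_1 may be computed on the extension x of given
cocycles by zero: the formulas above show that the next component of d x is the
announced sum of cup products. *)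

Set Implicit Arguments.
Unset Strict Implicit.
Unset Printing Implicit Defensive.

Import GRing.Theory.
Local Open Scope ring_scope.
Local Notation merge := Defs.merge.

(** * Linear and multilinear maps *)

Lemma linear0f (k : pzRingType) (V W : lmodType k) (f : V -> W) :
  linear f -> f 0 = 0.
Proof.
by move=> lf; have := lf (-1) 0 0; rewrite scaler0 addr0 scaleN1r addNr.
Qed.

Lemma linearZf (k : pzRingType) (V W : lmodType k) (f : V -> W) c u :
  linear f -> f (c *: u) = c *: f u.
Proof. by move=> lf; rewrite -[c *: u]addr0 lf (linear0f lf) addr0. Qed.

Lemma linearDf (k : pzRingType) (V W : lmodType k) (f : V -> W) u v :
  linear f -> f (u + v) = f u + f v.
Proof. by move=> lf; rewrite -[u]scale1r lf !scale1r. Qed.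

Section MultilinearTheory.
Context {k : fieldType} {A W : lmodType k}.
Implicit Type f : seq A -> W.

Lemma multilinearZ f s1 s2 c u : multilinear f ->
  f (s1 ++ (c *: u) :: s2) = c *: f (s1 ++ u :: s2).
Proof.
by move=> mf; apply: (linearZf (f := fun u => f (s1 ++ u :: s2)) c u
  (mf s1 s2)).
Qed.

Lemma multilinear_cons f t : multilinear f -> multilinear (fun s => f (t :: s)).
Proof. by move=> mf s1 s2; apply: (mf (t :: s1)). Qed.

End MultilinearTheory.

(** * Alternating sums of products of consecutive letters *)

Section BarDifferential.
Context {k : fieldType} {A : algType k} {W : lmodType k}.
Implicit Type F : seq A -> W.

(** The transpose of the differential of the two-sided bar construction. *)
Definition merge_sum F : seq A -> W := fun s =>
  \sum_(0 <= i < (size s).-1) (-1) ^+ i *: F (merge i s).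

Lemma merge_sum_nil F : merge_sum F [::] = 0.
Proof. by rewrite /merge_sum big_geq. Qed.

Lemma merge_sum1 F t : merge_sum F [:: t] = 0.
Proof. by rewrite /merge_sum big_geq. Qed.

(** Recursion on the word; it replaces index manipulations in all that follows.
*)
Lemma merge_sum_cons F t u s :
  merge_sum F (t :: u :: s) = F (t * u :: s) - merge_sum (fun w => F (t :: w))
    (u :: s).
Proof.
rewrite /merge_sum /= big_nat_recl //= expr0 scale1r {1}/merge /= ?drop0;
  congr (_ + _).
rewrite -sumrN; apply: eq_bigr => i _.
by rewrite exprS mulN1r scaleNr.
Qed.

Lemma eq_merge_sum F G s : (forall t w, F (t :: w) = G (t :: w)) -> merge_sum F
  s = merge_sum G s.
Proof.
move=> e; apply: eq_bigr => i _; congr (_ *: _); rewrite /merge.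
by case: (take i s) => [|t w]; apply: e.
Qed.

Lemma merge_sumL c F G s : merge_sum (fun w => c *: F w + G w) s = c
  *: merge_sum F s + merge_sum G s.
Proof.
rewrite /merge_sum scaler_sumr -big_split; apply: eq_bigr => i _ /=.
by rewrite scalerDr !scalerA mulrC.
Qed.

Lemma merge_sum0 s : merge_sum (fun=> 0) s = 0.
Proof. by apply: big1 => i _; rewrite scaler0. Qed.

Lemma merge_sumB F G s : merge_sum (fun w => F w - G w) s = merge_sum F s
  - merge_sum G s.
Proof.
by rewrite /merge_sum -sumrB; apply: eq_bigr => i _ /=; rewrite scalerBr.
Qed.

Definition head_mul t F : seq A -> W := fun s =>
  if s is u :: s' then F (t * u :: s') else 0.

(** After expanding both sums along the first two letters, the terms multiplying
the first letter into the rest cancel by associativity, and the remaining ones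
form the same double sum on a shorter word. *)
Lemma merge_sum_merge_sum F : merge_sum (merge_sum F) = fun=> 0.
Proof.
apply/funext => s; elim: s F => [|t [|u s] IHs] F;
  rewrite ?merge_sum_nil ?merge_sum1 //.
rewrite merge_sum_cons.
have -> : merge_sum (fun w => merge_sum F (t :: w)) (u :: s) =
    merge_sum (fun w => head_mul t F w - merge_sum (fun w => F (t :: w)) w)
      (u :: s).
  by apply: eq_merge_sum => v w; rewrite merge_sum_cons.
rewrite merge_sumB IHs subr0; case: s {IHs} => [|v s];
  first by rewrite !merge_sum1 subrr.
by rewrite !merge_sum_cons /= mulrA subrr.
Qed.

(** The products are sorted by their position relative to the letter n; the last
summand still contains the product of n with the letter following it. *)
Lemma merge_sum_cat F s1 n s2 :
  merge_sum F (s1 ++ n :: s2) =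
    merge_sum (fun u => F (u ++ n :: s2)) s1
    + (if s1 is t :: s then
         (-1) ^+ size s *: F (belast t s ++ last t s * n :: s2) else 0)
    + (-1) ^+ size s1 *: merge_sum (fun w => F (s1 ++ w)) (n :: s2).
Proof.
elim: s1 F => [|t s IHs] F; first by rewrite merge_sum_nil expr0 scale1r !add0r.
case: s IHs => [_|u s IHs];
  first by rewrite /= merge_sum_cons merge_sum1 expr0 expr1 scaleN1r scale1r
  add0r.
rewrite [LHS]merge_sum_cons merge_sum_cons -!addrA; congr (_ + _).
rewrite (IHs (fun w => F (t :: w))) /= !opprD -!addrA; congr (_ + (_ + _)).
  by rewrite [(-1) ^+ (size s).+1]exprS mulN1r scaleNr.
by rewrite [(-1) ^+ (size s).+2]exprS mulN1r scaleNr.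
Qed.

Lemma multilinear_merge_sum F : multilinear F -> multilinear (merge_sum F).
Proof.
move=> mF s1 s2 c u v; elim: s1 F mF => [|t s IHs] F mF /=.
  case: s2 => [|w s2]; first by rewrite !merge_sum1 scaler0 addr0.
  rewrite !(merge_sum_cons F) mulrDl -scalerAl (mF [::]) scalerBr /=.
  have -> : merge_sum (fun w0 => F (c *: u + v :: w0)) (w :: s2) =
      merge_sum (fun w0 => c *: F (u :: w0) + F (v :: w0)) (w :: s2).
    by apply: eq_merge_sum => ? ?; rewrite (mF [::]).
  by rewrite merge_sumL opprD addrACA.
have IH := IHs _ (multilinear_cons t mF).
case: s {IHs} IH => [|w s] /= IH; rewrite !(merge_sum_cons F) IH /=.
  by rewrite mulrDr -scalerAr (mF [::]) scalerBr opprD addrACA.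
by rewrite (mF (t * w :: s)) scalerBr opprD addrACA.
Qed.

(** The condition for a map on words to factor through the tensor product over a
ring containing r. *)
Definition balanced_at (r : A) F := forall s1 t u s2,
  F (s1 ++ t * r :: u :: s2) = F (s1 ++ t :: r * u :: s2).

Lemma balanced_merge_sum r F : balanced_at r F -> balanced_at r (merge_sum F).
Proof.
move=> bF s1 t u s2; elim: s1 F bF => [|w s IHs] F bF /=.
  rewrite !merge_sum_cons mulrA; congr (_ - _).
  case: s2 => [|v s2]; first by rewrite !merge_sum1.
  rewrite !merge_sum_cons (bF [::]) /= mulrA; congr (_ - _).
  by apply: eq_merge_sum => ? ?; apply: (bF [::]) .
have IH := IHs (fun v => F (w :: v)) (fun s1 => bF (w :: s1)).
case: s {IHs} IH => [|v s] /= IH; rewrite !(merge_sum_cons F) IH; congr (_ - _).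
  by rewrite mulrA (bF [::]).
by rewrite (bF (w * v :: s)).
Qed.

Lemma merge_sum_size l F : (forall s, size s <> l -> F s = 0) ->
  forall s, size s <> l.+1 -> merge_sum F s = 0.
Proof.
move=> F0 s; elim: s l F F0 => [|t [|u s] IHs] l F F0;
  rewrite ?merge_sum_nil ?merge_sum1 //.
move=> /= nl; rewrite merge_sum_cons F0 /=; last by congruence.
case: l F0 nl => [|l] F0 nl; last first.
  by rewrite (IHs l) ?subrr // => [v nv|]; [apply: F0|]; move=> /=; congruence.
rewrite sub0r; apply/eqP; rewrite oppr_eq0; apply/eqP.
by apply: big1 => i _; rewrite F0 ?scaler0.
Qed.

End BarDifferential.

Lemma merge_sum_map (k : fieldType) (B A : algType k) (W : lmodType k)
  (j : corner_map B A) (F : seq A -> W) s :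
  merge_sum F (map j s) = merge_sum (fun w => F (map j w)) s.
Proof.
elim: s F => [|t [|u s] IHs] F; rewrite ?merge_sum_nil ?merge_sum1 //.
by rewrite [in LHS]/= !merge_sum_cons /= cornerM (IHs (fun w => F (j t :: w))).
Qed.

Lemma merge_sum_comp (k : fieldType) (A : algType k) (V W : lmodType k)
  (f : V -> W)
  (F : seq A -> V) s : linear f -> f (merge_sum F s) = merge_sum
    (fun w => f (F w)) s.
Proof.
move=> lf; elim: s F => [|t [|u s] IHs] F;
  rewrite ?merge_sum_nil ?merge_sum1 ?linear0f //.
by rewrite !merge_sum_cons (linearDf _ _ lf) -scaleN1r linearZf // IHs scaleN1r.
Qed.

(** * The two-sided extension of a Hochschild cochain *)

Section LeftRightExtension.
Context {k : fieldType} {B A : algType k} {Y : bimod B A}.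

(** Hom_k(V, Y) = Hom_B(B \otimes V, Y) on words: the first letter acts on the
value. *)
Definition lext (f : seq B -> Y) : seq B -> Y := fun s =>
  if s is t :: s' then t *> f s' else 0.

(** Hom_k(V, Y) = Hom_A(V \otimes A, Y) on words: the last letter acts on the
value. *)
Definition rext (f : seq A -> Y) : seq A -> Y := fun s =>
  if s is t :: s' then f (belast t s') <* last t s' else 0.

Lemma rext_rcons f s t : rext f (rcons s t) = f s <* t.
Proof. by case: s => //= u s; rewrite belast_rcons last_rcons. Qed.

Lemma multilinear_lext f : multilinear f -> multilinear (lext f).
Proof.
move=> mf [|t s1] s2 c u v /=; first exact: (lact_linearl (f s2)).
by rewrite mf lact_linearr.
Qed.

Lemma multilinear_rext f : multilinear f -> multilinear (rext f).
Proof.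
move=> mf s1 s2 c u v; case: (lastP s2) => [|s t].
  by rewrite !cats1 !rext_rcons; apply: ract_linearr.
by rewrite -!rcons_cons -!rcons_cat !rext_rcons mf ract_linearl.
Qed.

End LeftRightExtension.

Section TwoSidedBar.
Context {k : fieldType} {A : algType k} {Y : bimod A A}.
Implicit Type f : seq A -> Y.

(** Hom_k(V, Y) = Hom_(A-A)(A \otimes V \otimes A, Y) for V a tensor power of A.
*)
Definition two_sided f : seq A -> Y := rext (lext f).
Arguments two_sided : simpl never.

Lemma two_sidedE f t s u : two_sided f (t :: rcons s u) = t *> f s <* u.
Proof. by rewrite /two_sided -rcons_cons rext_rcons. Qed.

Lemma two_sided_unit f s : two_sided f (1 :: rcons s 1) = f s.
Proof. by rewrite two_sidedE lact1 ract1. Qed.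

Lemma two_sided_inj f g : two_sided f = two_sided g -> f = g.
Proof.
by move=> e; apply/funext => s; rewrite -two_sided_unit e two_sided_unit.
Qed.

Lemma two_sided_0 : two_sided (fun=> 0) = fun=> 0.
Proof.
apply/funext; case/lastP => [|[|t s] u] //=;
  first by rewrite /two_sided /= ract0l.
by rewrite two_sidedE lact0r ract0l.
Qed.

Lemma hoch_diffE f t s :
  hoch_diff f (t :: s) = t *> f s - merge_sum f (t :: s)
    + (-1) ^+ (size s).+1 *: (f (belast t s) <* last t s).
Proof.
rewrite /=; congr (_ + _ + _); rewrite /merge_sum /= big_add1 -sumrN.
by apply: eq_bigr => i _; rewrite exprS mulN1r scaleNr.
Qed.

(** The terms in which the first or the last letter acts on the value of f turn
into products of letters, so that all terms have the same form. *)
Lemma two_sided_hoch f : two_sided (hoch_diff f) = merge_sum (two_sided f).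
Proof.
apply/funext; case/lastP => [|[|t s] u] /=;
  rewrite ?merge_sum_nil ?merge_sum1 //.
  by rewrite /two_sided /= ract0l.
rewrite two_sidedE; case: s => [|v s].
  by rewrite merge_sum_cons merge_sum1 subr0 lact0r ract0l /two_sided /= ract0l.
rewrite hoch_diffE rcons_cons merge_sum_cons -rcons_cons two_sidedE.
have -> : rcons (v :: s) u = (v :: s) ++ [:: u] by rewrite cats1.
rewrite merge_sum_cat merge_sum1 scaler0 addr0.
have -> : (fun w => two_sided f (t :: w ++ [:: u])) = (fun w => t *> f w <* u).
  by apply/funext => w; rewrite cats1 two_sidedE.
have lin_tu : linear (fun y : Y => t *> y <* u).
  by move=> c x y; rewrite lact_linearr ract_linearl.
rewrite -(merge_sum_comp _ _ lin_tu) cats1 two_sidedE lactM ractM /=.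
rewrite !lactDr !ractDl opprD addrA exprS mulN1r; congr (_ + _ + _).
  by rewrite -[- merge_sum _ _]scaleN1r lactZr ractZl scaleN1r.
by rewrite lactZr ractZl scaleNr !lractA.
Qed.

Lemma hoch_diff_diff f : hoch_diff (hoch_diff f) = fun=> 0.
Proof.
by apply: two_sided_inj;
  rewrite !two_sided_hoch merge_sum_merge_sum two_sided_0.
Qed.

Lemma multilinear_hoch f : multilinear f -> multilinear (hoch_diff f).
Proof.
move=> mf s1 s2 c u v.
have E w : hoch_diff f (s1 ++ w :: s2) = merge_sum (two_sided f)
  ((1 :: s1) ++ w :: rcons s2 1).
  by rewrite -two_sided_hoch -rcons_cons -rcons_cat two_sided_unit.
by rewrite !E; apply: multilinear_merge_sum; apply: multilinear_rext;
  apply: multilinear_lext.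
Qed.

Lemma hoch_cochain_diff l f : hoch_cochain Y l f -> hoch_cochain Y l.+1
  (hoch_diff f).
Proof.
move=> [mf sf]; split; first exact: multilinear_hoch.
move=> s ns; rewrite -two_sided_unit two_sided_hoch;
  apply: (@merge_sum_size _ _ _ l.+2).
  move=> {ns}s ns; case/lastP: s ns => [|[|t s] u] //= ns.
    by rewrite /two_sided /= ract0l.
  rewrite two_sidedE sf ?lact0r ?ract0l //.
  by move: ns; rewrite size_rcons; congruence.
by rewrite /= size_rcons; congruence.
Qed.

(** The outer letters absorb the two equivariance conditions into the
balancedness of a longer word; in degree 0 this is the centrality of the value.
*)
Lemma balanced_two_sided (R : A -> Prop) r f : R_bilinear R f -> R r ->
  balanced_at r (two_sided f).
Proof.
move=> [f0 fl fr fm] Rr s1 t u s2.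
have E w s v : two_sided f (w :: s ++ [:: v]) = w *> f s <* v by rewrite cats1
  two_sidedE.
case/lastP: s2 => [|s2 v]; last rewrite -!cats1; case: s1 => [|w s1] /=.
- by rewrite (E _ [::]) (E _ [::]) lactM f0 // -lractA -ractM.
- rewrite -[_ :: [:: u]]cat1s -[_ :: [:: r * u]]cat1s !catA !E !cats1.
  by rewrite fr // -lractA -ractM.
- by rewrite (E _ (u :: s2)) (E _ (r * u :: s2)) lactM fl.
- by rewrite -!cat_cons !catA !E fm.
Qed.

Lemma R_bilinear_balanced (R : A -> Prop) f :
  (forall r, R r -> r *> f [::] = f [::] <* r) ->
  (forall r, R r -> balanced_at r (two_sided f)) -> R_bilinear R f.
Proof.
move=> f0 bf; split=> // [r t s Rr|r s t Rr|r s1 t u s2 Rr].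
- have := bf r Rr [::] 1 t (rcons s 1); rewrite /= mul1r.
  rewrite -[t :: _]rcons_cons -[r * t :: _]rcons_cons !two_sidedE.
  by rewrite !ract1 lact1.
- have := bf r Rr (1 :: s) t 1 [::]; rewrite /= mulr1.
  rewrite -[[:: t * r; 1]]cat1s -[[:: t; r]]cat1s !catA !cats1 !two_sidedE.
  by rewrite !lact1 ract1.
- have := bf r Rr (1 :: s1) t u (rcons s2 1).
  by rewrite -!rcons_cons -!rcons_cat !cat_cons !rcons_cons !two_sided_unit.
Qed.

Lemma rel_cochain_diff (R : A -> Prop) l f :
  rel_cochain Y R l f -> rel_cochain Y R l.+1 (hoch_diff f).
Proof.
move=> [hf bf]; split; first exact: hoch_cochain_diff.
apply: R_bilinear_balanced => [r _|r Rr]; first by rewrite lact0r ract0l.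
by rewrite two_sided_hoch; apply: balanced_merge_sum;
  apply: balanced_two_sided bf Rr.
Qed.

End TwoSidedBar.

Arguments two_sided {k A Y} f _ : simpl never.

(* Simplification must not unfold the actions of a corner bimodule. *)
Arguments lact {k B A b} _ _ : rename, simpl never.
Arguments ract {k B A b} _ _ : rename, simpl never.

(** * Components of a coboundary in weights 0 and 1 *)

Section CornerProjection.
Context {k : fieldType} {T B A : algType k} (X : bimod T T).
Variables (jB : corner_map B T) (jA : corner_map A T).
Local Notation pr := (corner_proj X jB jA).

Lemma corner_proj_linear : linear pr.
Proof.
move=> c x y; apply: corner_eq; rewrite corner_valL /=.
by rewrite lact_linearr ract_linearl.
Qed.

Lemma corner_proj_lact b x : pr (jB b *> x) = (b *> (pr x : corner X jB jA)).
Proof.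
apply: corner_eq; rewrite corner_lactE /= -lactM corner_map_idl.
by rewrite !lractA -lactM corner_map_idr.
Qed.

Lemma corner_proj_ract x a : pr (x <* jA a) = ((pr x : corner X jB jA) <* a).
Proof.
apply: corner_eq; rewrite corner_ractE /= !lractA -!ractM.
by rewrite corner_map_idr corner_map_idl.
Qed.

End CornerProjection.

Arguments corner_proj_linear {k T B A} X jB jA.

Section CornerProduct.
Context {k : fieldType} {T B S A : algType k} (X : bimod T T).
Variables (jB : corner_map B T) (jS : corner_map S T) (jA : corner_map A T).

(** The idempotents of the inner corner are absorbed, one by t and the other by
the outer projection. *)
Lemma corner_proj_mull t x : t * jS 1 = t ->
  corner_proj X jB jA (t *> corner_val (corner_proj X jS jA x)) =
  corner_proj X jB jA (t *> x).
Proof.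
by move=> te; rewrite /= -lractA -lactM te corner_proj_ract ract1.
Qed.

Lemma corner_proj_mulr t x : jS 1 * t = t ->
  corner_proj X jB jA (corner_val (corner_proj X jB jS x) <* t) =
  corner_proj X jB jA (x <* t).
Proof.
by move=> et; rewrite /= -ractM et lractA corner_proj_lact lact1.
Qed.

End CornerProduct.

Section BarExtension.
Context {k : fieldType} {B A : algType k} {N Y : bimod B A}.
Implicit Type f : seq B * N * seq A -> Y.

Lemma bimod_extE f b n a :
  bimod_ext f (b, n, a) = rext (fun a => lext (fun b => f (b, n, a)) b) a.
Proof. by case: b => [|b0 b]; case: a => [|a0 a] //=; rewrite ract0l. Qed.

Lemma bimod_ext_cons f b0 b n a a0 :
  bimod_ext f (b0 :: b, n, rcons a a0) = b0 *> f (b, n, a) <* a0.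
Proof. by rewrite bimod_extE rext_rcons. Qed.

Lemma bimod_ext_nil f b n : bimod_ext f (b, n, [::]) = 0.
Proof. by rewrite bimod_extE. Qed.

Lemma bimod_ext_linear : linear (@bimod_ext k B A N Y).
Proof.
move=> c f g; apply/funext => -[[b n] a].
rewrite -[RHS]/(c *: bimod_ext f (b, n, a) + bimod_ext g (b, n, a)).
case: b => [|b0 b]; first by rewrite /= scaler0 addr0.
case/lastP: a => [|a a0]; first by rewrite !bimod_ext_nil scaler0 addr0.
by rewrite !bimod_ext_cons -[(_ + _) _]/(c *: _ + _) lact_linearr ract_linearl.
Qed.

(** A bimodule map on a free bimodule is recovered by putting 1 on both sides.
*)
Lemma bimod_ext_inj f g : bimod_ext f = bimod_ext g -> f = g.
Proof.
move=> e; apply/funext => -[[b n] a].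
have := congr1 (fun h => h (1 :: b, n, rcons a 1)) e.
by rewrite !bimod_ext_cons !lact1 !ract1.
Qed.

Lemma bar_diffE f b n a : bar_diff f (b, n, a) =
  merge_sum (fun b => f (b, n, a)) b
  + (-1) ^+ (size b).-1 *: f (take (size b).-1 b, last 0 b *> n, a)
  + (-1) ^+ size b *: f (b, n <* head 0 a, behead a)
  + (-1) ^+ (size b).+1 *: merge_sum (fun a => f (b, n, a)) a.
Proof.
rewrite /bar_diff; congr (_ + _); rewrite /merge_sum scaler_sumr.
by apply: eq_bigr => i _; rewrite exprD scalerA.
Qed.

Lemma bar_diff_nil f b n a : ~~ ((0 < size b) && (0 < size a))%N ->
  bar_diff (bimod_ext f) (b, n, a) = 0.
Proof.
case: b => [|b0 b].
  by move=> _; rewrite bar_diffE merge_sum_nil /= merge_sum0 !scaler0 !addr0.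
case: a => // _; rewrite bar_diffE merge_sum_nil !bimod_ext_nil !scaler0 !addr0.
rewrite -(merge_sum0 (W := Y) (b0 :: b)); apply: eq_merge_sum => t w;
  exact: bimod_ext_nil.
Qed.

End BarExtension.

Arguments bimod_ext {k B A N Y} f _ : simpl never.

Lemma take_belast (T : Type) (t : T) s : take (size s) (t :: s) = belast t s.
Proof. by elim: s t => //= u s IHs t; rewrite IHs. Qed.

Section Components.
Context {k : fieldType} {D : triangular k} {X : bimod (tri D) (tri D)}.
Local Notation T := (tri D).
Implicit Type f : seq T -> X.

Lemma res0_hoch (A : algType k) (j : corner_map A T) f :
  res0 j (hoch_diff f) = hoch_diff (res0 j f : seq A -> corner X j j).
Proof.
have prl := corner_proj_linear X j j.
have E h s : two_sided (res0 j h : seq A -> corner X j j) s =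
    corner_proj X j j (two_sided h (map j s)).
  case: s => [|t s]; first by rewrite /two_sided /= (linear0f prl).
  case: (lastP s) => [|{}s u].
    by rewrite /two_sided /= !ract0l (linear0f prl).
  by rewrite /= map_rcons !two_sidedE corner_proj_ract corner_proj_lact.
apply: two_sided_inj; apply/funext => s;
  rewrite two_sided_hoch E two_sided_hoch merge_sum_map.
rewrite (merge_sum_comp _ _ prl); congr merge_sum.
by apply/funext => w; rewrite E.
Qed.

Section WeightOne.
Context {B A : algType k} (jB : corner_map B T) (jA : corner_map A T).
Context (N : bimod B A) (jN : N -> T).
Hypothesis jN_lact : forall b n, jN (b *> n) = jB b * jN n.
Hypothesis jN_ract : forall n a, jN (n <* a) = jN n * jA a.
Local Notation Y := (corner X jB jA).
Local Notation pr := (corner_proj X jB jA).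

(** The component of weight 1, extended to a bimodule map on the bar resolution,
is read off the two-sided extension on words with nonempty sides. *)
Lemma bimod_ext_res1 f b0 b n a a0 :
  bimod_ext (res1 jB jA jN f : _ -> Y) (b0 :: b, n, rcons a a0) =
  pr (two_sided f (map jB (b0 :: b) ++ jN n :: map jA (rcons a a0))).
Proof.
rewrite bimod_ext_cons map_rcons /= -rcons_cons -rcons_cat two_sidedE.
by rewrite corner_proj_ract corner_proj_lact.
Qed.

(** If b is empty, the product of b0 and n starts the word with a letter of N:
the bar complex has no such term, and it appears as the left cup product. *)
Lemma res1_left f b0 b n a a0 :
  pr (two_sided f (belast (jB b0) (map jB b)
              ++ last (jB b0) (map jB b) * jN n :: map jA (rcons a a0))) =
  bimod_ext (res1 jB jA jN f : _ -> Y) (belast b0 b, last b0 b *> n, rcons a a0)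
  + bimod_ext (cupl_HH jN (res0 jA f) : _ -> Y) (b0 :: b, n, rcons a a0).
Proof.
rewrite belast_map last_map -jN_lact.
case: b => [|b1 b]; last by rewrite bimod_ext_res1 bimod_ext_cons lact0r ract0l
  addr0.
rewrite add0r bimod_ext_cons /= corner_proj_mull -?jN_ract ?ract1 // map_rcons
  two_sidedE.
by rewrite corner_proj_ract jN_lact lactM corner_proj_lact.
Qed.

(** Mirror image of the previous statement, together with the products to the
right of n: here it is the word a that may become empty. *)
Lemma res1_right f b0 b n a a0 :
  pr (merge_sum (fun w => two_sided f (map jB (b0 :: b) ++ w))
    (jN n :: map jA (rcons a a0))) =
  bimod_ext (res1 jB jA jN f : _ -> Y)
    (b0 :: b, n <* head 0 (rcons a a0), behead (rcons a a0))
  - merge_sum (fun a => bimod_ext (res1 jB jA jN f : _ -> Y) (b0 :: b, n, a))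
      (rcons a a0)
  + bimod_ext (cupr_HH jN (res0 jB f) : _ -> Y) (b0 :: b, n, rcons a a0).
Proof.
have prl := corner_proj_linear X jB jA.
case: a => [|a1 a]; rewrite [rcons _ _]/= /= merge_sum_cons -jN_ract.
  rewrite !merge_sum1 !subr0 bimod_ext_nil add0r (bimod_ext_cons _ _ _ _ [::])
    cats1 two_sidedE /=.
  rewrite corner_proj_mulr -?jN_lact ?lact1 // jN_ract ractM.
  by rewrite corner_proj_ract lractA corner_proj_lact.
rewrite (linearDf _ _ prl) -scaleN1r (linearZf _ _ prl) scaleN1r.
rewrite -[X in bimod_ext (cupr_HH _ _) X]/(b0 :: b, n, rcons (a1 :: a) a0).
rewrite [bimod_ext (cupr_HH _ _) _]bimod_ext_cons lact0r ract0l addr0.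
rewrite bimod_ext_res1; congr (_ - _).
rewrite -[jA a1 :: _]/(map jA (a1 :: _)) merge_sum_map (merge_sum_comp _ _ prl).
apply: eq_merge_sum => t w; case/lastP: w => [|w u].
  by rewrite (bimod_ext_res1 _ _ _ _ [::]).
by rewrite -rcons_cons bimod_ext_res1.
Qed.

(** The components of weight 1 of a coboundary.  The degree l of f only fixes
the sign of the right cup product. *)
Lemma bimod_ext_res1_hoch l f : is_hoch_cochain l f ->
  bimod_ext (res1 jB jA jN (hoch_diff f) : _ -> Y) =
  bar_diff (bimod_ext (res1 jB jA jN f : _ -> Y))
  + bimod_ext (cupl_HH jN (res0 jA f) + (-1) ^+ l.+1 *: cupr_HH jN (res0 jB f)
      : _ -> Y).
Proof.
move=> [_ f0]; apply/funext => -[[b n] a];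
  rewrite -[RHS]/(bar_diff _ _ + bimod_ext _ _).
case: b => [|b0 b]; first by rewrite bar_diff_nil // addr0.
case/lastP: a => [|a a0]; first by rewrite bar_diff_nil ?bimod_ext_nil // addr0.
have prl := corner_proj_linear X jB jA.
rewrite bimod_ext_res1 two_sided_hoch merge_sum_cat !(linearDf _ _ prl)
  (linearZf _ _ prl).
rewrite bar_diffE.
have -> : pr (merge_sum
  (fun u => two_sided f (u ++ jN n :: map jA (rcons a a0)))
       (map jB (b0 :: b))) =
     merge_sum (fun b => bimod_ext (res1 jB jA jN f : _ -> Y)
       (b, n, rcons a a0)) (b0 :: b).
  by rewrite merge_sum_map (merge_sum_comp _ _ prl);
    apply: eq_merge_sum => t w; rewrite bimod_ext_res1.
rewrite -[map jB (b0 :: b)]/(jB b0 :: map jB b) size_map res1_left.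
rewrite (linearZf _ _ prl) res1_right /= size_map take_belast.
(* The left cup product lives on the words with empty b, where the sign is 1. *)
have cupl_sign : (-1) ^+ size b *:
    bimod_ext (cupl_HH jN (res0 jA f) : _ -> Y) (b0 :: b, n, rcons a a0) =
    bimod_ext (cupl_HH jN (res0 jA f) : _ -> Y) (b0 :: b, n, rcons a a0).
  rewrite bimod_ext_cons; case: b => [|? ?]; first by rewrite scale1r.
  by rewrite lact0r ract0l scaler0.
(* In the right cup product f takes b alone, so b has length l. *)
have cupr_sign : (-1) ^+ (size b).+1 *:
    bimod_ext (cupr_HH jN (res0 jB f) : _ -> Y) (b0 :: b, n, rcons a a0) =
    (-1) ^+ l.+1 *:
    bimod_ext (cupr_HH jN (res0 jB f) : _ -> Y) (b0 :: b, n, rcons a a0).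
  rewrite bimod_ext_cons; case: (size b =P l) => [->//|nl].
  case: {cupl_sign} a => [|? ?]; last by rewrite lact0r ract0l !scaler0.
  rewrite /= /res0 f0 ?size_map //.
  by rewrite !(lact0r, ract0l) (linear0f prl) !(lact0r, ract0l) !scaler0.
rewrite [cupl_HH _ _ + _]addrC bimod_ext_linear.
rewrite -[X in _ = _ + X]/(_ *: bimod_ext _ _ + bimod_ext _ _) -cupr_sign
  -cupl_sign.
rewrite !scalerDr [LHS](AC ((1*2)*3) ((1*2*4*5)*(6*3))) /=; congr (_ + _ + _).
  by rewrite scalerN [in RHS]exprS mulN1r scaleNr.
by rewrite !cupl_sign.
Qed.

End WeightOne.
End Components.

Arguments corner_fun {k A T} c _ : simpl never.
Arguments corner_val {k T B A X jB jA} c : simpl never.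

(** * Components of a coboundary in weight 2 *)

Section MatrixUnits.
Context {k : fieldType} {D : triangular k}.
Local Notation tri_simp :=
  (mulr0, mul0r, @ract0l, @ract0r, @lact0r, @lact0l, @mu0l, @mu0r, @addr0,
  @add0r).

Lemma in3_in32 a y : in32 (a *> y) = in3 a * in32 y :> tri D.
Proof.
by rewrite -[RHS]/(tri_mul (in3 a) (in32 y)) /in32 /Tri /= !tri_simp.
Qed.

Lemma in32_in2 y b : in32 (y <* b) = in32 y * in2 b :> tri D.
Proof.
by rewrite -[RHS]/(tri_mul (in32 y) (in2 b)) /in32 /Tri /= !tri_simp.
Qed.

Lemma in2_in21 b x : in21 (b *> x) = in2 b * in21 x :> tri D.
Proof.
by rewrite -[RHS]/(tri_mul (in2 b) (in21 x)) /in21 /Tri /= !tri_simp.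
Qed.

Lemma in21_in1 x c : in21 (x <* c) = in21 x * in1 c :> tri D.
Proof.
by rewrite -[RHS]/(tri_mul (in21 x) (in1 c)) /in21 /Tri /= !tri_simp.
Qed.

Lemma in3_in31 a z : in31 (a *> z) = in3 a * in31 z :> tri D.
Proof.
by rewrite -[RHS]/(tri_mul (in3 a) (in31 z)) /in31 /Tri /= !tri_simp.
Qed.

Lemma in31_in1 z c : in31 (z <* c) = in31 z * in1 c :> tri D.
Proof.
by rewrite -[RHS]/(tri_mul (in31 z) (in1 c)) /in31 /Tri /= !tri_simp.
Qed.

Lemma in32_in21 y x : in31 (mu y x) = in32 y * in21 x :> tri D.
Proof.
by rewrite -[RHS]/(tri_mul (in32 y) (in21 x)) /in31 /Tri /= !tri_simp.
Qed.

Lemma in21_linear : linear (@in21 k D).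
Proof.
by move=> c u v; rewrite -[RHS]/(Tri _ _ _ _ _ _) /= !scaler0 !addr0.
Qed.

Lemma in32_linear : linear (@in32 k D).
Proof.
by move=> c u v; rewrite -[RHS]/(Tri _ _ _ _ _ _) /= !scaler0 !addr0.
Qed.

Lemma in31_linear : linear (@in31 k D).
Proof.
by move=> c u v; rewrite -[RHS]/(Tri _ _ _ _ _ _) /= !scaler0 !addr0.
Qed.

End MatrixUnits.

Section HyperExtension.
Context {k : fieldType} {B S A : algType k}.
Context {P : bimod B S} {Q : bimod S A} {Y : bimod B A}.
Implicit Type f : seq B * P * seq S * Q * seq A -> Y.

Lemma hyper_bimod_extE f a y b x c : hyper_bimod_ext f (a, y, b, x, c) =
  rext (fun c => lext (fun a => f (a, y, b, x, c)) a) c.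
Proof. by case: a => [|a0 a]; case: c => [|c0 c] //=; rewrite ract0l. Qed.

Lemma hyper_bimod_ext_cons f a0 a y b x c c0 :
  hyper_bimod_ext f (a0 :: a, y, b, x, rcons c c0) =
  a0 *> f (a, y, b, x, c) <* c0.
Proof. by rewrite hyper_bimod_extE rext_rcons. Qed.

Lemma hyper_bimod_ext_nil f a y b x : hyper_bimod_ext f (a, y, b, x, [::]) = 0.
Proof. by rewrite hyper_bimod_extE. Qed.

Lemma hyper_bimod_ext_linear : linear (@hyper_bimod_ext k B S A P Q Y).
Proof.
move=> u f g; apply/funext => -[[[[a y] b] x] c]; set t := (a, y, b, x, c).
rewrite -[RHS]/(u *: hyper_bimod_ext f t + hyper_bimod_ext g t) {}/t.
case: a => [|a0 a]; first by rewrite /= scaler0 addr0.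
case/lastP: c => [|c c0]; first by rewrite !hyper_bimod_ext_nil scaler0 addr0.
by rewrite !hyper_bimod_ext_cons -[(_ + _) _]/(u *: _ + _) lact_linearr
  ract_linearl.
Qed.

Lemma hyper_bimod_ext_inj f g : hyper_bimod_ext f = hyper_bimod_ext g -> f = g.
Proof.
move=> e; apply/funext => -[[[[a y] b] x] c].
have := congr1 (fun h => h (1 :: a, y, b, x, rcons c 1)) e.
by rewrite !hyper_bimod_ext_cons !lact1 !ract1.
Qed.

Lemma comp_d_cons (g : P -> seq S -> Q -> Y) y b1 b x :
  comp_d g y (b1 :: b) x = - g (y <* b1) b x + merge_sum (fun w => g y w x)
    (b1 :: b)
    + (-1) ^+ size b *: g y (belast b1 b) (last b1 b *> x).
Proof.
rewrite /comp_d; congr (_ + _ + _); rewrite /merge_sum /= ?big_add1 /=.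
  by apply: eq_bigr => i _; rewrite !exprS !mulN1r opprK.
by rewrite !exprS !mulN1r opprK.
Qed.

Lemma hyper_diffE f a y b x c : hyper_diff f (a, y, b, x, c) =
  merge_sum (fun a => f (a, y, b, x, c)) a
  + (-1) ^+ (size a).-1 *: f (take (size a).-1 a, last 0 a *> y, b, x, c)
  + (-1) ^+ (size a).-1 *: comp_d (fun y b x => f (a, y, b, x, c)) y b x
  + (-1) ^+ ((size a).-1 + size b) *: (f (a, y, b, x <* head 0 c, behead c)
      - merge_sum (fun c => f (a, y, b, x, c)) c).
Proof.
rewrite /hyper_diff; congr (_ + _ *: (_ + _)); rewrite /merge_sum -sumrN.
by apply: eq_bigr => i _; rewrite exprS mulN1r scaleNr.
Qed.

Lemma hyper_diff_nil f a y b x c : ~~ ((0 < size a) && (0 < size c))%N ->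
  hyper_diff (hyper_bimod_ext f) (a, y, b, x, c) = 0.
Proof.
have cd0 (g : P -> seq S -> Q -> Y) : (forall y b x, g y b x = 0) -> comp_d g y
  b x = 0.
  move=> g0; case: b => // b1 b;
    rewrite comp_d_cons !g0 oppr0 scaler0 add0r addr0.
  by rewrite -(merge_sum0 (W := Y) (b1 :: b)); apply: eq_merge_sum.
case: a => [|a0 a].
  by move=> _; rewrite hyper_diffE merge_sum_nil cd0 //= merge_sum0 subr0
    !scaler0 !addr0.
case: c => // _; rewrite hyper_diffE merge_sum_nil cd0 => [|*];
  last exact: hyper_bimod_ext_nil.
rewrite !hyper_bimod_ext_nil subr0 !scaler0 !addr0.
by rewrite -(merge_sum0 (W := Y) (a0 :: a)); apply: eq_merge_sum => t w;
  apply: hyper_bimod_ext_nil.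
Qed.

End HyperExtension.

Arguments hyper_bimod_ext {k B S A P Q Y} f _ : simpl never.
Arguments comp_d : simpl never.

Section WeightTwo.
Context {k : fieldType} {D : triangular k} {X : bimod (tri D) (tri D)}.
Local Notation T := (tri D).
Local Notation Y := (corner X in3 in1).
Local Notation pr := (corner_proj X in3 in1).
Local Notation space :=
  (seq (A3 D) * M32 D * seq (A2 D) * M21 D * seq (A1 D) -> Y)%type.
Implicit Type f : seq T -> X.

Local Notation full_word a y b x c :=
  (map in3 a ++ in32 y :: map in2 b ++ in21 x :: map in1 c).

Lemma hyper_bimod_ext_res2 f a0 a y b x c c0 :
  hyper_bimod_ext (res2 f : space) (a0 :: a, y, b, x, rcons c c0) =
  pr (two_sided f (full_word (a0 :: a) y b x (rcons c c0))).
Proof.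
rewrite hyper_bimod_ext_cons map_rcons -rcons_cons -rcons_cat -rcons_cons
  -rcons_cat.
by rewrite /= two_sidedE corner_proj_ract corner_proj_lact.
Qed.

Lemma res2_left f a0 a y b x c c0 :
  pr (two_sided f (belast (in3 a0) (map in3 a) ++ last (in3 a0) (map in3 a)
    * in32 y
              :: map in2 b ++ in21 x :: map in1 (rcons c c0))) =
  hyper_bimod_ext (res2 f : space)
    (belast a0 a, last a0 a *> y, b, x, rcons c c0)
  + hyper_bimod_ext (cupl_Ext in32 (res1 in2 in1 in21 f) : space)
      (a0 :: a, y, b, x, rcons c c0).
Proof.
rewrite belast_map last_map -in3_in32.
case: a => [|a1 a].
  rewrite add0r hyper_bimod_ext_cons /= corner_proj_mull -?in32_in2 ?ract1 //.
  rewrite map_rcons -rcons_cons -rcons_cat two_sidedE.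
  by rewrite corner_proj_ract in3_in32 lactM corner_proj_lact.
by rewrite hyper_bimod_ext_res2 hyper_bimod_ext_cons lact0r ract0l addr0.
Qed.

Lemma res2_right f a0 a y b x c c0 :
  pr (merge_sum (fun w => two_sided f
    (map in3 (a0 :: a) ++ (in32 y :: map in2 b) ++ w))
         (in21 x :: map in1 (rcons c c0))) =
  hyper_bimod_ext (res2 f : space)
    (a0 :: a, y, b, x <* head 0 (rcons c c0), behead (rcons c c0))
  - merge_sum (fun c => hyper_bimod_ext (res2 f : space) (a0 :: a, y, b, x, c))
      (rcons c c0)
  + hyper_bimod_ext (cupr_Ext in21 (res1 in3 in2 in32 f) : space)
      (a0 :: a, y, b, x, rcons c c0).
Proof.
have prl := corner_proj_linear X in3 in1.
case: c => [|c1 c]; rewrite [rcons _ _]/= /= merge_sum_cons -in21_in1.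
  rewrite !merge_sum1 !subr0 hyper_bimod_ext_nil add0r.
  rewrite (hyper_bimod_ext_cons _ _ _ _ _ _ [::]) -[in32 y :: _ ++ _]cat_cons
    catA cats1 two_sidedE /=.
  rewrite corner_proj_mulr -?in2_in21 ?lact1 // in21_in1 ractM.
  by rewrite corner_proj_ract lractA corner_proj_lact.
rewrite (linearDf _ _ prl) -scaleN1r (linearZf _ _ prl) scaleN1r.
rewrite -[X in hyper_bimod_ext (cupr_Ext _ _) X]/(a0 :: a, y, b, x, rcons
  (c1 :: c) c0).
rewrite [hyper_bimod_ext (cupr_Ext _ _) _]hyper_bimod_ext_cons lact0r ract0l
  addr0.
rewrite hyper_bimod_ext_res2; congr (_ - _).
rewrite -[in1 c1 :: _]/(map in1 (c1 :: _)) merge_sum_map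
  (merge_sum_comp _ _ prl).
apply: eq_merge_sum => t w; case/lastP: w => [|w u].
  by rewrite (hyper_bimod_ext_res2 _ _ _ _ _ _ [::]).
by rewrite -rcons_cons hyper_bimod_ext_res2.
Qed.

(** The products between y and x make up the differential of the complex C,
except that for empty b the two bimodule letters themselves are multiplied,
which gives the term with mu. *)
Lemma res2_middle f a0 a y b x c c0 :
  pr (merge_sum (fun w => two_sided f
    (map in3 (a0 :: a) ++ w ++ in21 x :: map in1 (rcons c c0)))
         (in32 y :: map in2 b))
  + (-1) ^+ size b *: pr
      (two_sided f (map in3 (a0 :: a) ++ belast (in32 y) (map in2 b)
       ++ last (in32 y) (map in2 b) * in21 x :: map in1 (rcons c c0))) =
  - comp_d (fun y b x =>
      hyper_bimod_ext (res2 f : space) (a0 :: a, y, b, x, rcons c c0)) y b x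
  + (-1) ^+ (size a).+1 *: hyper_bimod_ext
      (delta_mu (res1 in3 in1 in31 f) : space)
      (a0 :: a, y, b, x, rcons c c0).
Proof.
have prl := corner_proj_linear X in3 in1.
case: b => [|b1 b] /=.
  rewrite merge_sum1 (linear0f prl) oppr0 !add0r scale1r hyper_bimod_ext_cons.
  rewrite -in32_in21 -cat_cons map_rcons -rcons_cons -rcons_cat /= two_sidedE.
  rewrite corner_proj_ract corner_proj_lact lactZr ractZl.
  by rewrite signrZK.
rewrite comp_d_cons [hyper_bimod_ext (delta_mu _) _]hyper_bimod_ext_cons lact0r
  ract0l.
rewrite scaler0 addr0 merge_sum_cons -in32_in2 /= belast_map last_map -in2_in21.
rewrite (linearDf _ _ prl) -scaleN1r (linearZf _ _ prl) scaleN1r.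
rewrite !hyper_bimod_ext_res2 !opprD opprK; congr (_ + _ + _).
  rewrite -[in2 b1 :: _]/(map in2 (b1 :: _)) merge_sum_map
    (merge_sum_comp _ _ prl); congr (- _).
  by apply: eq_merge_sum => t w; rewrite hyper_bimod_ext_res2.
by rewrite exprS mulN1r scaleNr.
Qed.

(** The components of weight 2 of a coboundary.  As in weight 1, the cup
products come from the words whose outermost letter is multiplied into y or x;
the remaining correction, by mu, comes from the product of y and x. *)
Lemma hyper_bimod_ext_res2_hoch l f : is_hoch_cochain l f ->
  hyper_bimod_ext (res2 (hoch_diff f) : space) =
  hyper_diff (hyper_bimod_ext (res2 f : space))
  + hyper_bimod_ext (cupl_Ext in32 (res1 in2 in1 in21 f)
      + (-1) ^+ l.+1 *: cupr_Ext in21 (res1 in3 in2 in32 f)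
      + delta_mu (res1 in3 in1 in31 f) : space).
Proof.
move=> [_ f0]; apply/funext => -[[[[a y] b] x] c].
rewrite -[RHS]/(hyper_diff _ _ + hyper_bimod_ext _ _).
case: a => [|a0 a]; first by rewrite hyper_diff_nil // addr0.
case/lastP: c => [|c c0];
  first by rewrite hyper_diff_nil ?hyper_bimod_ext_nil // addr0.
have prl := corner_proj_linear X in3 in1.
rewrite hyper_bimod_ext_res2 two_sided_hoch merge_sum_cat
  -[in32 y :: _ ++ _]cat_cons.
rewrite (merge_sum_cat (fun w => two_sided f (map in3 (a0 :: a) ++ w))).
rewrite !(linearDf _ _ prl) !(linearZf _ _ prl) !(linearDf _ _ prl)
  !(linearZf _ _ prl).
rewrite -[map in3 (a0 :: a)]/(in3 a0 :: map in3 a)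
  -[size (in32 y :: _)]/(size _).+1.
rewrite -[size (in3 a0 :: _)]/(size _).+1 !size_map res2_left res2_middle
  res2_right.
have -> : pr (merge_sum (fun u => two_sided f (u ++ (in32 y :: map in2 b)
       ++ in21 x :: map in1 (rcons c c0))) (in3 a0 :: map in3 a)) =
     merge_sum (fun a => hyper_bimod_ext (res2 f : space)
       (a, y, b, x, rcons c c0)) (a0 :: a).
  rewrite -[in3 a0 :: _]/(map in3 (a0 :: a)) merge_sum_map
    (merge_sum_comp _ _ prl).
  by apply: eq_merge_sum => t w; rewrite hyper_bimod_ext_res2.
rewrite hyper_diffE /= take_belast.
(* The left cup product lives on the words with empty a, where the sign is 1. *)
have cupl_sign : (-1) ^+ size a *:
    hyper_bimod_ext (cupl_Ext in32 (res1 in2 in1 in21 f) : space)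
      (a0 :: a, y, b, x, rcons c c0) =
    hyper_bimod_ext (cupl_Ext in32 (res1 in2 in1 in21 f) : space)
      (a0 :: a, y, b, x, rcons c c0).
  rewrite hyper_bimod_ext_cons; case: a => [|? ?]; first by rewrite scale1r.
  by rewrite lact0r ract0l scaler0.
(* In the right cup product f takes a, y and b, so its degree gives the sign. *)
have cupr_sign : (-1) ^+ (size a + size b) *:
    hyper_bimod_ext (cupr_Ext in21 (res1 in3 in2 in32 f) : space)
      (a0 :: a, y, b, x, rcons c c0) =
    (-1) ^+ l.+1 *:
    hyper_bimod_ext (cupr_Ext in21 (res1 in3 in2 in32 f) : space)
      (a0 :: a, y, b, x, rcons c c0).
  rewrite hyper_bimod_ext_cons; case: ((size a + size b).+1 =P l) => [<-|nl].
    by rewrite !exprS mulrA mulrNN mul1r mul1r.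
  case: {cupl_sign} c => [|? ?]; last by rewrite lact0r ract0l !scaler0.
  rewrite /= f0; last by rewrite size_cat /= !size_map addnS.
  rewrite (linear0f (corner_proj_linear _ _ _)) -[corner_val 0]/(0 : X).
  by rewrite ract0l (linear0f prl) lact0r ract0l !scaler0.
have -> : hyper_bimod_ext (cupl_Ext in32 (res1 in2 in1 in21 f)
      + (-1) ^+ l.+1 *: cupr_Ext in21 (res1 in3 in2 in32 f)
      + delta_mu (res1 in3 in1 in31 f) : space) (a0 :: a, y, b, x, rcons c c0) =
    (-1) ^+ (size a + size b) *:
      hyper_bimod_ext (cupr_Ext in21 (res1 in3 in2 in32 f) : space)
        (a0 :: a, y, b, x, rcons c c0)
    + ((-1) ^+ size a *: hyper_bimod_ext
        (cupl_Ext in32 (res1 in2 in1 in21 f) : space)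
        (a0 :: a, y, b, x, rcons c c0)
    + hyper_bimod_ext (delta_mu (res1 in3 in1 in31 f) : space)
        (a0 :: a, y, b, x, rcons c c0)).
  rewrite [cupl_Ext _ _ + _]addrC -addrA hyper_bimod_ext_linear cupr_sign
    cupl_sign.
  by rewrite (linearDf _ _ (@hyper_bimod_ext_linear _ _ _ _ _ _ Y)).
rewrite !scalerDr signrZK scalerN.
have sgn2 : (-1) ^+ ((size a).+1 + (size b).+1) = (-1) ^+ (size a + size b) :>
  k.
  by rewrite addSn addnS !exprS !mulN1r opprK.
rewrite !scalerA -!exprD sgn2 exprS mulN1r scaleNr opprK.
by rewrite [LHS](AC ((1*2)*(2*3)) ((1*2*4*(6*7))*(8*(3*5)))).
Qed.

End WeightTwo.

(** * The filtration in terms of components *)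

Section Idempotents.
Context {k : fieldType} {D : triangular k}.
Local Notation T := (tri D).

Definition vtx1 : 'I_3 := Ordinal (isT : (0 < 3)%N).
Definition vtx2 : 'I_3 := Ordinal (isT : (1 < 3)%N).
Definition vtx3 : 'I_3 := Ordinal (isT : (2 < 3)%N).

Lemma vtx_ind (P : 'I_3 -> Prop) : P vtx1 -> P vtx2 -> P vtx3 -> forall i, P i.
Proof.
move=> P1 P2 P3 [[|[|[|i]]] lt_i3] //.
- by rewrite (_ : Ordinal _ = vtx1) //; apply: val_inj.
- by rewrite (_ : Ordinal _ = vtx2) //; apply: val_inj.
- by rewrite (_ : Ordinal _ = vtx3) //; apply: val_inj.
Qed.

Lemma span_idem_idem i : span_idem (idem D i).
Proof.
exists (fun j => (i == j)%:R);
  rewrite (bigD1 i) //= eqxx scale1r big1 ?addr0 //.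
by move=> j ji; rewrite eq_sym (negPf ji) scale0r.
Qed.

Definition entry1 (t : T) : A1 D := t.1.1.1.
Definition entry2 (t : T) : A2 D := t.1.1.2.
Definition entry3 (t : T) : A3 D := t.1.2.
Definition entry21 (t : T) : M21 D := t.2.1.1.
Definition entry32 (t : T) : M32 D := t.2.1.2.
Definition entry31 (t : T) : M31 D := t.2.2.

Local Notation tri_simp := (mulr0, mul0r, mul1r, mulr1, @lact1, @ract1, @ract0l,
  @ract0r, @lact0r, @lact0l, @mu0l, @mu0r, @addr0, @add0r).

Lemma idemE v :
  idem D v = Tri (val v == 0)%N%:R (val v == 1)%N%:R (val v == 2)%N%:R 0 0 0.
Proof. by elim/vtx_ind: v. Qed.

(** The Peirce decomposition of a lower triangular matrix. *)
Lemma idem_sandwich i j (t : T) : idem D i * t * idem D j =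
  match val i, val j with
  | 0%N, 0%N => in1 (entry1 t)
  | 1%N, 0%N => in21 (entry21 t)
  | 1%N, 1%N => in2 (entry2 t)
  | 2%N, 0%N => in31 (entry31 t)
  | 2%N, 1%N => in32 (entry32 t)
  | 2%N, 2%N => in3 (entry3 t)
  | _, _ => 0
  end.
Proof.
rewrite !idemE; case: t => -[[a1 a2] a3] [[m21 m32] m31].
rewrite -[_ * _ * _]/(tri_mul (tri_mul _ _) _).
by elim/vtx_ind: i; elim/vtx_ind: j; rewrite /tri_mul /Tri /= !tri_simp.
Qed.

Lemma idem_sum : 1 = \sum_i idem D i.
Proof.
rewrite !big_ord_recl big_ord0 addr0 /idem /=.
by rewrite -[RHS]/(Tri _ _ _ _ _ _) /= !tri_simp.
Qed.

End Idempotents.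

Section Words.
Context {k : fieldType} {D : triangular k}.
Local Notation T := (tri D).

Definition word1 {B A : algType k} {N : Type} (jB : corner_map B T)
    (jA : corner_map A T) (jN : N -> T) b n a : seq T :=
  map jB b ++ jN n :: map jA a.

Definition word2 a (y : M32 D) b (x : M21 D) c : seq T :=
  map in3 a ++ in32 y :: map in2 b ++ in21 x :: map in1 c.

(** The words of a trajectory of weight n that starts, on the left, at the
vertex v: a run of letters of the algebra at each vertex visited, separated by
letters of the bimodules along the nontrivial steps. *)
Definition normal_word (v : 'I_3) (n : nat) (s : seq T) : Prop :=
  match val v with
  | 0%N => n = 0%N /\ exists c, s = map in1 c
  | 1%N => n = 0%N /\ (exists b, s = map in2 b)
        \/ n = 1%N /\ (exists b x c, s = word1 in2 in1 in21 b x c)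
  | _ => [\/ n = 0%N /\ exists a, s = map in3 a,
             n = 1%N /\ exists a y b, s = word1 in3 in2 in32 a y b,
             n = 1%N /\ exists a z c, s = word1 in3 in1 in31 a z c
           | n = 2%N /\ exists a y b x c, s = word2 a y b x c]
  end.

Lemma trajectory_normal v vs s : trajectory v vs -> in_component v vs s ->
  normal_word v (weight v vs) s.
Proof.
elim: vs v s => [|w vs IHvs] v [|t s] //.
  move=> _ _; elim/vtx_ind: v; rewrite /normal_word /=.
  - by split=> //; exists [::].
  - by left; split=> //; exists [::].
  - by constructor 1; split=> //; exists [::].
rewrite /trajectory /in_component /weight /= => /andP[le_wv tr]
  /andP[/eqP et cs].
have := IHvs w s tr cs;
  rewrite -/(weight w vs) -et idem_sandwich {IHvs tr cs et}.
move: (weight w vs) => n; elim/vtx_ind: v le_wv; elim/vtx_ind: w => //= _.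
- by move=> [-> [c ->]]; split=> //; exists (entry1 t :: c).
- by move=> [-> [c ->]]; right; split=> //; exists [::], (entry21 t), c.
- move=> [[-> [b ->]]|[-> [b [x [c ->]]]]].
    by left; split=> //; exists (entry2 t :: b).
  by right; split=> //; exists (entry2 t :: b), x, c.
- by move=> [-> [c ->]]; constructor 3; split=> //; exists [::], (entry31 t), c.
- move=> [[-> [b ->]]|[-> [b [x [c ->]]]]].
    by constructor 2; split=> //; exists [::], (entry32 t), b.
  by constructor 4; split=> //; exists [::], (entry32 t), b, x, c.
- move=> [[-> [a ->]]|[-> [a [y [b ->]]]]|[-> [a [z [c ->]]]]|[->
    [a [y [b [x [c ->]]]]]]].
  + by constructor 1; split=> //; exists (entry3 t :: a).
  + by constructor 2; split=> //; exists (entry3 t :: a), y, b.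
  + by constructor 3; split=> //; exists (entry3 t :: a), z, c.
  + by constructor 4; split=> //; exists (entry3 t :: a), y, b, x, c.
Qed.

Definition is_trajectory_of (v : 'I_3) (n : nat) (s : seq T) (vs : seq 'I_3) :=
  [/\ trajectory v vs, size vs = size s, weight v vs = n & in_component v vs s].

Lemma trajectory_of_cons (v w : 'I_3) n s vs t : (w <= v)%N -> idem D v * t
  * idem D w = t ->
  is_trajectory_of w n s vs ->
  is_trajectory_of v ((v != w) + n) (t :: s) (w :: vs).
Proof.
move=> le_wv et [tr sz <- cs]; split=> //=; first exact/andP.
- by rewrite sz.
- by apply/andP; rewrite et.
Qed.

Lemma trajectory_of_map (A : algType k) (j : corner_map A T) v a n s vs :
  idem D v = j 1 -> is_trajectory_of v n s vs ->
  is_trajectory_of v n (map j a ++ s) (nseq (size a) v ++ vs).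
Proof.
move=> ev H; elim: a => //= t a IHa.
have et : idem D v * j t * idem D v = j t by rewrite ev -!cornerM mul1r mulr1.
by have := trajectory_of_cons (leqnn v) et IHa; rewrite eqxx.
Qed.

Lemma normal_trajectory v n s : normal_word v n s ->
  exists vs, is_trajectory_of v n s vs.
Proof.
have tr0 w : is_trajectory_of w 0 [::] [::] by [].
have tr1 c : exists vs, is_trajectory_of vtx1 0 (map in1 c) vs.
  by rewrite -[map _ _]cats0; exists (nseq (size c) vtx1 ++ [::]);
    apply: trajectory_of_map.
have tr2 b : exists vs, is_trajectory_of vtx2 0 (map in2 b) vs.
  by rewrite -[map _ _]cats0; exists (nseq (size b) vtx2 ++ [::]);
    apply: trajectory_of_map.
have tr21 b x c : exists vs, is_trajectory_of vtx2 1 (word1 in2 in1 in21 b x c)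
  vs.
  have [vs H] := tr1 c; exists (nseq (size b) vtx2 ++ vtx1 :: vs).
  apply: trajectory_of_map => //; apply: (trajectory_of_cons _ _ H) => //.
  by rewrite idem_sandwich.
elim/vtx_ind: v; rewrite /normal_word /=.
- by move=> [-> [c ->]].
- by move=> [[-> [b ->]]|[-> [b [x [c ->]]]]].
- move=> [[-> [a ->]]|[-> [a [y [b ->]]]]|[-> [a [z [c ->]]]]|[->
    [a [y [b [x [c ->]]]]]]].
  + by rewrite -[map _ _]cats0; exists (nseq (size a) vtx3 ++ [::]);
      apply: trajectory_of_map.
  + have [vs H] := tr2 b; exists (nseq (size a) vtx3 ++ vtx2 :: vs).
    apply: trajectory_of_map => //; apply: (trajectory_of_cons _ _ H) => //.
    by rewrite idem_sandwich.
  + have [vs H] := tr1 c; exists (nseq (size a) vtx3 ++ vtx1 :: vs).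
    apply: trajectory_of_map => //; apply: (trajectory_of_cons _ _ H) => //.
    by rewrite idem_sandwich.
  + have [vs H] := tr21 b x c; exists (nseq (size a) vtx3 ++ vtx2 :: vs).
    apply: trajectory_of_map => //; apply: (trajectory_of_cons _ _ H) => //.
    by rewrite idem_sandwich.
Qed.

End Words.

Section Filtration.
Context {k : fieldType} {D : triangular k} {X : bimod (tri D) (tri D)}.
Local Notation T := (tri D).
Implicit Type f : seq T -> X.

(** Trajectories are replaced by the explicit words they allow. *)
Lemma filtrationP t l f : filtration X t l f <->
  rel_cochain X (span_idem (D := D)) l f /\
  forall v n s, normal_word v n s -> (n < t)%N -> idem D v *> f s = 0.
Proof.
split=> -[rf H]; split=> //.
  move=> v n s /normal_trajectory[vs [tr sz wt cs]] lt_nt.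
  have [sl|/eqP nsl] := eqVneq (size s) l;
    last by rewrite (rf.1.2 _ nsl) lact0r.
  by apply: (H v vs) => //; [rewrite sz|rewrite wt].
move=> v vs s tr sz lt_wt cs.
exact: (H v _ _ (trajectory_normal tr cs)).
Qed.

Lemma filtration_le t u l f : (t <= u)%N -> filtration X u l f -> filtration X
  t l f.
Proof.
move=> le_tu /filtrationP[rf H]; apply/filtrationP; split=> // v n s nw lt_nt.
by apply: (H v n s nw); apply: leq_trans le_tu.
Qed.

Section Vanishing.
Variables (l : nat) (f : seq T -> X).
Hypothesis rf : rel_cochain X (span_idem (D := D)) l f.

Lemma corner_proj_eq0 (B A : algType k) (jB : corner_map B T)
  (jA : corner_map A T) x :
  x <* jA 1 = x -> (corner_proj X jB jA x = 0) <-> (jB 1 *> x = 0).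
Proof.
move=> xe; have E : corner_val (corner_proj X jB jA x) = jB 1 *> x.
  by rewrite -[corner_val _]/(jB 1 *> x <* jA 1) lractA xe.
by split=> [/(congr1 corner_val)|e]; [|apply: corner_eq]; rewrite E.
Qed.

Lemma rel_cochain_ract (A : algType k) (j : corner_map A T) s t a :
  span_idem (j 1) -> t * j 1 = t ->
  f (s ++ t :: map j a) <* j 1 = f (s ++ t :: map j a).
Proof.
move=> je te; have fr := rf.2; case: fr => _ _ fr _.
case/lastP: a => [|a a0]; first by rewrite cats1 -fr // te.
by rewrite map_rcons -rcons_cons -rcons_cat -fr // -cornerM mulr1.
Qed.

(** The value of a relative cochain on a nonempty word already lies in the right
corner; on the empty word its centrality is used instead. *)
Lemma res0_eq0 (A : algType k) (j : corner_map A T) : span_idem (j 1) ->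
  res0 j f = 0 <-> forall a, j 1 *> f (map j a) = 0.
Proof.
move=> je; have E a : res0 j f a = 0 <-> j 1 *> f (map j a) = 0.
  case: a => [|a0 a]; last first.
    by apply: corner_proj_eq0; apply: (rel_cochain_ract [::]);
      rewrite // -cornerM mulr1.
  have [f0 _ _ _] := rf.2; rewrite /res0 /=.
  have <- : corner_proj X j j (j 1 *> f [::]) = corner_proj X j j (f [::]).
    by rewrite corner_proj_lact lact1.
  rewrite corner_proj_eq0; first by rewrite -lactM -cornerM mul1r.
  by rewrite lractA -f0 // -lactM -cornerM mul1r.
split=> [e a|e]; first by apply/E; rewrite e.
by apply/funext => a; apply/E.
Qed.

Lemma res1_eq0 (B A : algType k) (N : Type) (jB : corner_map B T)
    (jA : corner_map A T) (jN : N -> T) :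
  span_idem (jA 1) -> (forall n, jN n * jA 1 = jN n) ->
  res1 jB jA jN f = 0 <-> forall b n a, jB 1 *> f (word1 jB jA jN b n a) = 0.
Proof.
move=> je ne; have E b n a : res1 jB jA jN f (b, n, a) = 0 <->
    jB 1 *> f (word1 jB jA jN b n a) = 0.
  by apply: corner_proj_eq0; apply: rel_cochain_ract.
split=> [e b n a|e]; first by apply/E; rewrite e.
by apply/funext => -[[b n] a]; apply/E.
Qed.

Lemma res2_eq0 : res2 f = 0 <-> forall a y b x c, in3 1 *> f (word2 a y b x c)
  = 0.
Proof.
have E a y b x c : res2 f (a, y, b, x, c) = 0 <-> in3 1 *> f (word2 a y b x c)
  = 0.
  apply: corner_proj_eq0; rewrite -cat_cons catA; apply: rel_cochain_ract.
    exact: (span_idem_idem vtx1).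
  by rewrite -in21_in1 ract1.
split=> [e a y b x c|e]; first by apply/E; rewrite e.
by apply/funext => -[[[[a y] b] x] c]; apply/E.
Qed.

End Vanishing.

Lemma filtration1P l f : filtration X 1 l f <->
  rel_cochain X (span_idem (D := D)) l f /\
    [/\ res0 in1 f = 0, res0 in2 f = 0 & res0 in3 f = 0].
Proof.
split=> [/filtrationP[rf H]|[rf]].
  split=> //; split; apply/(res0_eq0 rf) => [|a].
  - exact: (span_idem_idem vtx1).
  - by apply: (H vtx1 0%N) => //; split=> //; exists a.
  - exact: (span_idem_idem vtx2).
  - by apply: (H vtx2 0%N) => //; left; split=> //; exists a.
  - exact: (span_idem_idem vtx3).
  - by apply: (H vtx3 0%N) => //; constructor 1; split=> //; exists a.
move=> [/(res0_eq0 rf (span_idem_idem vtx1)) r1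
  /(res0_eq0 rf (span_idem_idem vtx2)) r2
  /(res0_eq0 rf (span_idem_idem vtx3)) r3].
apply/filtrationP; split=> // v n s; elim/vtx_ind: v; rewrite /normal_word /=.
- by move=> [_ [c ->]] _; apply: r1.
- by move=> [[_ [b ->]] _|[-> _]]; first apply: r2.
- by move=> [[_ [b ->]] _|[-> _]|[-> _]|[-> _]]; first apply: r3.
Qed.

Lemma filtration2P l f : filtration X 2 l f <->
  filtration X 1 l f /\ [/\ res1 in2 in1 in21 f = 0, res1 in3 in2 in32 f = 0
                          & res1 in3 in1 in31 f = 0].
Proof.
have R1 rf := res1_eq0 (l := l) (f := f) rf.
have e21 n : in21 n * in1 1 = in21 n :> T by rewrite -in21_in1 ract1.
have e32 n : in32 n * in2 1 = in32 n :> T by rewrite -in32_in2 ract1.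
have e31 n : in31 n * in1 1 = in31 n :> T by rewrite -in31_in1 ract1.
have s1 : span_idem (in1 1 : T) by exact: (span_idem_idem vtx1).
have s2 : span_idem (in2 1 : T) by exact: (span_idem_idem vtx2).
split=> [F2|[]].
  split; first exact: filtration_le F2.
  have /filtrationP[rf H] := F2; split; apply/R1 => // b n a.
  - by apply: (H vtx2 1%N) => //; right; split=> //; exists b, n, a.
  - by apply: (H vtx3 1%N) => //; constructor 2; split=> //; exists b, n, a.
  - by apply: (H vtx3 1%N) => //; constructor 3; split=> //; exists b, n, a.
move=> /filtrationP[rf H] [/(R1 rf _ _ _ _ _ _ s1 e21) r21].
move=> /(R1 rf _ _ _ _ _ _ s2 e32) r32 /(R1 rf _ _ _ _ _ _ s1 e31) r31.
apply/filtrationP; split=> // v n s nw; case: n nw => [|n] nw.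
  by move=> _; apply: (H _ _ _ nw).
move: nw; elim/vtx_ind: v; rewrite /normal_word /=.
- by case.
- by case=> [[]//|[_ [b [x [c ->]]]] _]; apply: r21.
- case=> [[]//|[_ [a [y [b ->]]]] _|[_ [a [z [c ->]]]] _|[[->]]//].
    exact: r32.
  exact: r31.
Qed.

Lemma filtration3P l f : filtration X 3 l f <-> filtration X 2 l f /\ res2 f =
  0.
Proof.
split=> [F3|[/filtrationP[rf H] /(res2_eq0 rf) r2]].
  split; first exact: filtration_le F3.
  have /filtrationP[rf H] := F3; apply/(res2_eq0 rf) => a y b x c.
  apply: (H vtx3 2%N) => //; constructor 4; split=> //.
  by exists a, y, b, x, c.
apply/filtrationP; split=> // v n s nw; case: n nw => [|[|n]] nw.
- by move=> _; apply: (H _ _ _ nw).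
- by move=> _; apply: (H _ _ _ nw).
move: nw; elim/vtx_ind: v; rewrite /normal_word /=.
- by case.
- by case=> [[]//|[]//].
- by case=> [[]//|[]//|[]//|[_ [a [y [b [x [c ->]]]]]] _]; apply: r2.
Qed.

(** A 0-trajectory has weight 0; the value at the unit is the sum of its
components at the three idempotents. *)
Lemma filtration1_degree0 f : filtration X 1 0 f -> f = 0.
Proof.
move=> [rf H]; apply/funext => s.
have [/size0nil ->|/eqP ns] := eqVneq (size s) 0%N; last exact: (rf.1.2 _ ns).
rewrite -[f _]lact1 idem_sum.
have lact_sum (r : seq 'I_3) : (\sum_(i <- r) idem D i) *> f [::] = 0.
  elim: r => [|i r IHr]; rewrite ?big_nil ?lact0l // big_cons lactDl IHr addr0.
  exact: (H i [::] [::]).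
exact: lact_sum.
Qed.

(** A 1-trajectory has weight at most 1, and one letter is the sum of its
entries. *)
Lemma filtration2_degree1 f : filtration X 2 1 f -> f = 0.
Proof.
move=> [rf H]; have [mf sf] := rf.1; have [_ fl _ _] := rf.2.
apply/funext => -[|t [|u s]]; [exact: sf| |exact: sf].
have lf : linear (fun t => f [:: t]) by move=> c u v; apply: (mf [::] [::]).
rewrite -[t]mul1r -[_ * t]mulr1 idem_sum mulr_suml mulr_suml.
have f_sum (F : 'I_3 -> T) : f [:: \sum_i F i] = \sum_i f [:: F i].
  exact: (big_morph (fun t => f [:: t]) (fun u v => linearDf u v lf)
    (linear0f lf)).
rewrite f_sum big1 // => i _; rewrite mulr_sumr f_sum big1 // => j _.
(* Each summand is an entry of t: zero above the diagonal, and a letter along a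
   trajectory of weight at most 1 otherwise. *)
have [le_ji|lt_ij] := leqP j i; last first.
  rewrite idem_sandwich.
  by move: lt_ij; elim/vtx_ind: i; elim/vtx_ind: j => //= _; exact: linear0f lf.
have ii : idem D i * idem D i = idem D i.
  by elim/vtx_ind: i {le_ji}; rewrite /idem /= -cornerM mulr1.
have jj : idem D j * idem D j = idem D j.
  by elim/vtx_ind: j {le_ji}; rewrite /idem /= -cornerM mulr1.
rewrite -[in LHS]ii -!mulrA fl; last exact: span_idem_idem.
apply: (H i [:: j]) => //=; rewrite ?andbT ?le_ji // /weight /=.
  by case: (_ != _).
by rewrite /in_component /= andbT !mulrA ii -mulrA jj.
Qed.

End Filtration.

(** * Extension of components to relative cochains *)

Section SplitSum.
Context {k : fieldType} {T : algType k} {B N A W : lmodType k}.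
Variables (pB : T -> B) (pN : T -> N) (pA : T -> A).
Hypotheses (pB_lin : linear pB) (pN_lin : linear pN) (pA_lin : linear pA).
Implicit Type f : seq B -> N -> seq A -> W.

(** The sum over all positions of a letter of N in a word, the letters before it
being read in B and those after it in A: the form taken by the extension of a
component of weight 1 to all words. *)
Fixpoint split_sum f (s : seq T) : W :=
  if s is t :: s' then
    f [::] (pN t) (map pA s') + split_sum (fun b => f (pB t :: b)) s'
  else 0.

Lemma eq_split_sum f g s : (forall b n a, f b n a = g b n a) ->
  split_sum f s = split_sum g s.
Proof.
elim: s f g => //= t s IHs f g e; rewrite e; congr (_ + _).
by apply: IHs => b n a; apply: e.
Qed.

Lemma split_sumL c f g s :
  split_sum (fun b n a => c *: f b n a + g b n a) s =
  c *: split_sum f s + split_sum g s.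
Proof.
elim: s f g => [|t s IHs] f g /=; first by rewrite scaler0 addr0.
by rewrite (IHs (fun b => f (pB t :: b))) scalerDr addrACA.
Qed.

Lemma split_sumZ_head c u f s : (forall n a, multilinear (fun b => f b n a)) ->
  split_sum (fun b => f (c *: u :: b)) s = c *: split_sum (fun b => f (u :: b))
    s.
Proof.
move=> fb; have Z0 : split_sum (fun _ _ _ => 0) s = 0 by elim: s => //= t s ->;
  rewrite addr0.
rewrite -[RHS]addr0 -Z0 -split_sumL; apply: eq_split_sum => b n a.
by rewrite addr0 (multilinearZ [::] _ _ _ (fb n a)).
Qed.

Lemma split_sum_eq0 f s :
  (forall b n a, (size b + size a).+1 = size s -> f b n a = 0) ->
  split_sum f s = 0.
Proof.
elim: s f => //= t s IHs f f0; rewrite f0 ?size_map // add0r.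
by apply: IHs => b n a e; apply: f0; rewrite /= addSn e.
Qed.

Lemma split_sum_pN0 f s : (forall b a, linear (fun n => f b n a)) ->
  all (fun t => pN t == 0) s -> split_sum f s = 0.
Proof.
elim: s f => //= t s IHs f fn /andP[/eqP-> /IHs->]; last by move=> b a;
  apply: fn.
by rewrite addr0; apply: (linear0f (fn _ _)).
Qed.

(** Only the position of t contributes, since every other letter has no entry in
N. *)
Lemma split_sum_cat f s1 t s2 : (forall b a, linear (fun n => f b n a)) ->
  all (fun t => pN t == 0) s1 -> all (fun t => pN t == 0) s2 ->
  split_sum f (s1 ++ t :: s2) = f (map pB s1) (pN t) (map pA s2).
Proof.
move=> fn; elim: s1 f fn => [|u s1 IHs] f fn /=.
  by move=> _ s20; rewrite split_sum_pN0 ?addr0 // => b a; apply: fn.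
move=> /andP[/eqP-> s10] s20; rewrite (linear0f (fn _ _)) add0r.
by rewrite IHs // => b a; apply: fn.
Qed.

Lemma multilinear_split_sum f :
  (forall n a, multilinear (fun b => f b n a)) ->
  (forall b a, linear (fun n => f b n a)) ->
  (forall b n, multilinear (fun a => f b n a)) -> multilinear (split_sum f).
Proof.
move=> fb fn fa s1 s2 c u v; elim: s1 f fb fn fa => [|t s1 IHs] f fb fn fa /=.
  rewrite pN_lin fn scalerDr addrACA -split_sumL; congr (_ + _).
  by apply: eq_split_sum => b n a; rewrite pB_lin (fb n a [::]).
rewrite IHs; first last.
- by move=> b n; apply: fa.
- by move=> b a; apply: fn.
- by move=> n a; apply: (multilinear_cons (pB t) (fb n a)).
by rewrite !map_cat /= pA_lin fa scalerDr addrACA.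
Qed.

End SplitSum.

Section Graded.
Context {k : fieldType} {T : algType k}.
Variable r : T.

(** Equivariance with respect to one diagonal matrix r, which acts by the scalar
x on the left and by the scalar y on the right. *)
Definition graded (W : lmodType k) (x y : k) (g : seq T -> W) : Prop :=
  [/\ x *: g [::] = y *: g [::],
      forall t s, g (r * t :: s) = x *: g (t :: s),
      forall s t, g (rcons s (t * r)) = y *: g (rcons s t)
    & balanced_at r g].

Lemma graded_map (W B : lmodType k) (x : k) (pB : T -> B) (f : seq B -> W) :
  multilinear f -> (forall t, pB (r * t) = x *: pB t) ->
  (forall t, pB (t * r) = x *: pB t) -> graded x x (fun s => f (map pB s)).
Proof.
move=> mf pl pr; split=> // [t s|s t|s1 t u s2] /=.
- by rewrite pl (multilinearZ [::]).
- by rewrite !map_rcons pr -!cats1 (multilinearZ _ _ _ _ mf).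
- rewrite !map_cat /= pr pl (multilinearZ _ _ _ _ mf) -[in RHS]cat_rcons.
  by rewrite (multilinearZ _ _ _ _ mf) cat_rcons.
Qed.

(** At each position of the letter of N the diagonal matrix can be moved across
it: it acts by the scalar y both on the right of N and on the left of A. *)
Lemma graded_split_sum (W B N A : lmodType k) (x y z : k) (pB : T -> B)
  (pN : T -> N) (pA : T -> A) (f : seq B -> N -> seq A -> W) :
  (forall n a, multilinear (fun b => f b n a)) ->
  (forall b a, linear (fun n => f b n a)) ->
  (forall b n, graded y z (fun s => f b n (map pA s))) ->
  (forall t, pB (r * t) = x *: pB t) -> (forall t, pB (t * r) = x *: pB t) ->
  (forall t, pN (r * t) = x *: pN t) -> (forall t, pN (t * r) = y *: pN t) ->
  graded x z (split_sum pB pN pA f).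
Proof.
move=> fb fn fa pBl pBr pNl pNr.
have scale c t s := split_sumZ_head pB pN pA c (pB t) s fb.
split=> [|t s|s t|s1 t u s2]; first by rewrite !scaler0.
- by rewrite /= pNl pBl (linearZf _ _ (fn _ _)) scale scalerDr.
- elim: s f fb fn fa {scale} => [|v s IHs] f fb fn fa /=.
    rewrite !addr0 pNr (linearZf _ _ (fn _ _)).
    by case: (fa [::] (pN t)).
  have [_ _ fr _] := fa [::] (pN v); rewrite scalerDr fr IHs //.
  by move=> n a; apply: (multilinear_cons (pB v) (fb n a)).
- elim: s1 f fb fn fa scale => [|v s IHs] f fb fn fa scale /=.
    have [_ fl _ _] := fa [::] (pN t).
    rewrite pNr (linearZf _ _ (fn _ _)) -fl; congr (_ + _).
    rewrite pBr pNl (linearZf _ _ (fn _ _)) pBl.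
    rewrite (multilinearZ [::] _ _ _ (fb _ _)).
    congr (_ + _); apply: eq_split_sum => b n a.
    by rewrite (multilinearZ [::] _ _ _ (fb n a))
      (multilinearZ [:: pB t] _ _ _ (fb n a)).
  have [_ _ _ bf] := fa [::] (pN v); rewrite (bf s); congr (_ + _).
  have fb' n a : multilinear (fun b => f (pB v :: b) n a).
    exact: (multilinear_cons (pB v) (fb n a)).
  by apply: IHs => // c w s'; apply: (split_sumZ_head pB pN pA c (pB w) s' fb').
Qed.

End Graded.

Section Extensions.
Context {k : fieldType} {D : triangular k} {X : bimod (tri D) (tri D)}.
Local Notation T := (tri D).

Definition diag_idem (c : 'I_3 -> k) : T := \sum_i c i *: idem D i.

Lemma diag_idemE c :
  diag_idem c = Tri (c vtx1)%:A (c vtx2)%:A (c vtx3)%:A 0 0 0.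
Proof.
rewrite /diag_idem !big_ord_recl big_ord0 addr0.
have -> : lift ord0 (lift ord0 ord0) = vtx3 by apply: val_inj.
have -> : lift ord0 ord0 = vtx2 by apply: val_inj.
have -> : ord0 = vtx1 by apply: val_inj.
by rewrite -[LHS]/(Tri _ _ _ _ _ _) /= !scaler0 !addr0 !add0r.
Qed.

Local Notation tri_simp := (mulr0, mul0r, mul1r, mulr1, @lact1, @ract1, @ract0l,
  @ract0r, @lact0r, @lact0l, @mu0l, @mu0r, @addr0, @add0r).

Lemma idem_mul i j : idem D i * idem D j = (i == j)%:R *: idem D i.
Proof.
rewrite !idemE -[LHS]/(tri_mul _ _) -[RHS]/(Tri _ _ _ _ _ _) /tri_mul /Tri /=.
elim/vtx_ind: i; elim/vtx_ind: j;
  by rewrite /= !tri_simp ?scale1r ?scale0r ?scaler0.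
Qed.

Lemma diag_idem_mull c i : diag_idem c * idem D i = c i *: idem D i.
Proof.
rewrite /diag_idem mulr_suml (bigD1 i) //= -scalerAl idem_mul eqxx scale1r.
rewrite big1 ?addr0 // => j /negPf ji.
by rewrite -scalerAl idem_mul ji scale0r scaler0.
Qed.

Lemma diag_idem_mulr c i : idem D i * diag_idem c = c i *: idem D i.
Proof.
rewrite /diag_idem mulr_sumr (bigD1 i) //= -scalerAr idem_mul eqxx scale1r.
rewrite big1 ?addr0 // => j /negPf ji.
by rewrite -scalerAr idem_mul eq_sym ji scale0r scaler0.
Qed.

Section Projections.
Variable c : 'I_3 -> k.

Lemma entry1_mull t : entry1 (diag_idem c * t) = c vtx1 *: entry1 t.
Proof.
rewrite diag_idemE; case: t => -[[a1 a2] a3] [[m21 m32] m31].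
by rewrite -[_ * _]/(tri_mul _ _) /entry1 /= mulr_algl.
Qed.

Lemma entry1_mulr t : entry1 (t * diag_idem c) = c vtx1 *: entry1 t.
Proof.
rewrite diag_idemE; case: t => -[[a1 a2] a3] [[m21 m32] m31].
by rewrite -[_ * _]/(tri_mul _ _) /entry1 /= mulr_algr.
Qed.

Lemma entry2_mull t : entry2 (diag_idem c * t) = c vtx2 *: entry2 t.
Proof.
rewrite diag_idemE; case: t => -[[a1 a2] a3] [[m21 m32] m31].
by rewrite -[_ * _]/(tri_mul _ _) /entry2 /= mulr_algl.
Qed.

Lemma entry2_mulr t : entry2 (t * diag_idem c) = c vtx2 *: entry2 t.
Proof.
rewrite diag_idemE; case: t => -[[a1 a2] a3] [[m21 m32] m31].
by rewrite -[_ * _]/(tri_mul _ _) /entry2 /= mulr_algr.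
Qed.

Lemma entry3_mull t : entry3 (diag_idem c * t) = c vtx3 *: entry3 t.
Proof.
rewrite diag_idemE; case: t => -[[a1 a2] a3] [[m21 m32] m31].
by rewrite -[_ * _]/(tri_mul _ _) /entry3 /= mulr_algl.
Qed.

Lemma entry3_mulr t : entry3 (t * diag_idem c) = c vtx3 *: entry3 t.
Proof.
rewrite diag_idemE; case: t => -[[a1 a2] a3] [[m21 m32] m31].
by rewrite -[_ * _]/(tri_mul _ _) /entry3 /= mulr_algr.
Qed.

Lemma entry21_mull t : entry21 (diag_idem c * t) = c vtx2 *: entry21 t.
Proof.
rewrite diag_idemE; case: t => -[[a1 a2] a3] [[m21 m32] m31].
by rewrite -[_ * _]/(tri_mul _ _) /entry21 /= ract0l add0r lactZl lact1.
Qed.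

Lemma entry21_mulr t : entry21 (t * diag_idem c) = c vtx1 *: entry21 t.
Proof.
rewrite diag_idemE; case: t => -[[a1 a2] a3] [[m21 m32] m31].
by rewrite -[_ * _]/(tri_mul _ _) /entry21 /= lact0r addr0 ractZr ract1.
Qed.

Lemma entry32_mull t : entry32 (diag_idem c * t) = c vtx3 *: entry32 t.
Proof.
rewrite diag_idemE; case: t => -[[a1 a2] a3] [[m21 m32] m31].
by rewrite -[_ * _]/(tri_mul _ _) /entry32 /= ract0l add0r lactZl lact1.
Qed.

Lemma entry32_mulr t : entry32 (t * diag_idem c) = c vtx2 *: entry32 t.
Proof.
rewrite diag_idemE; case: t => -[[a1 a2] a3] [[m21 m32] m31].
by rewrite -[_ * _]/(tri_mul _ _) /entry32 /= lact0r addr0 ractZr ract1.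
Qed.

Lemma entry31_mull t : entry31 (diag_idem c * t) = c vtx3 *: entry31 t.
Proof.
rewrite diag_idemE; case: t => -[[a1 a2] a3] [[m21 m32] m31].
by rewrite -[_ * _]/(tri_mul _ _) /entry31 /= ract0l mu0l !add0r lactZl lact1.
Qed.

Lemma entry31_mulr t : entry31 (t * diag_idem c) = c vtx1 *: entry31 t.
Proof.
rewrite diag_idemE; case: t => -[[a1 a2] a3] [[m21 m32] m31].
by rewrite -[_ * _]/(tri_mul _ _) /entry31 /= mu0r lact0r !addr0 ractZr ract1.
Qed.

End Projections.

Section CornerCochains.
Context {B A : algType k} (jB : corner_map B T) (jA : corner_map A T).
Variables (i j : 'I_3).
Hypotheses (jB1 : jB 1 = idem D i) (jA1 : jA 1 = idem D j).
Local Notation Y := (corner X jB jA).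

Lemma corner_diag_lact c (y : Y) : diag_idem c *> corner_val y = c i
  *: corner_val y.
Proof.
by rewrite -[in LHS](corner_idl y) -lactM jB1 diag_idem_mull lactZl -jB1
  corner_idl.
Qed.

Lemma corner_diag_ract c (y : Y) : corner_val y <* diag_idem c = c j
  *: corner_val y.
Proof.
by rewrite -[in LHS](corner_idr y) -ractM jA1 diag_idem_mulr ractZr -jA1
  corner_idr.
Qed.

Lemma corner_valZ c (y : Y) : corner_val (c *: y) = c *: corner_val y.
Proof. by rewrite -[c *: y]addr0 corner_valL addr0. Qed.

(** On a corner, a diagonal matrix acts by its entries at the two vertices, so
bilinearity over the span of the idempotents amounts to equivariance up to these
scalars. *)
Lemma graded_rel_cochain l (g : seq T -> Y) : multilinear g ->
  (forall s, size s <> l -> g s = 0) ->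
  (forall c, graded (diag_idem c) (c i) (c j) g) ->
  rel_cochain X (span_idem (D := D)) l (fun s => corner_val (g s)).
Proof.
move=> mg sg gg; split; first split.
- by move=> s1 s2 c u v; rewrite mg; apply: corner_valL.
- by move=> s ns; rewrite sg.
split=> [_ [c ->]|_ t s [c ->]|_ s t [c ->]|_ s1 t t' s2 [c ->]];
  rewrite -/(diag_idem c); have [g0 gl gr gb] := gg c.
- by rewrite corner_diag_lact corner_diag_ract -!corner_valZ g0.
- by rewrite corner_diag_lact -corner_valZ gl.
- by rewrite corner_diag_ract -corner_valZ gr.
- by rewrite gb.
Qed.

(** Distinct idempotents are orthogonal; hence a cochain with values in one
corner has no component in another. *)
Lemma corner_proj_orthogonal (B' A' : algType k) (jB' : corner_map B' T)
    (jA' : corner_map A' T) i' j' (y : Y) :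
  jB' 1 = idem D i' -> jA' 1 = idem D j' -> (i', j') != (i, j) ->
  corner_proj X jB' jA' (corner_val y) = 0.
Proof.
move=> jB'1 jA'1; rewrite -pair_eqE negb_and => /orP[] /= /negPf ne.
  apply: corner_eq; rewrite -[LHS]/(jB' 1 *> corner_val y <* jA' 1).
  by rewrite -(corner_idl y) -lactM jB1 jB'1 idem_mul ne scale0r lact0l ract0l.
apply: corner_eq; rewrite -[LHS]/(jB' 1 *> corner_val y <* jA' 1).
rewrite -(corner_idr y) lractA -ractM jA1 jA'1 idem_mul.
by rewrite eq_sym ne scale0r ract0r lact0r.
Qed.

End CornerCochains.

Lemma extension0 (A : algType k) (j : corner_map A T) i (p : T -> A) :
  j 1 = idem D i -> linear p -> cancel j p ->
  (forall c t, p (diag_idem c * t) = c i *: p t) ->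
  (forall c t, p (t * diag_idem c) = c i *: p t) ->
  forall l (f : seq A -> corner X j j), is_hoch_cochain l f ->
  exists g : seq T -> corner X j j,
    rel_cochain X (span_idem (D := D)) l (fun s => corner_val (g s)) /\
    res0 j (fun s => corner_val (g s)) = f.
Proof.
move=> j1 pl pK pml pmr l f [mf sf]; exists (fun s => f (map p s)); split.
  apply: (graded_rel_cochain j1 j1) => [s1 s2 c u v|s ns|c];
    last exact: graded_map.
    by rewrite !map_cat /= pl mf.
  by rewrite sf ?size_map.
by apply/funext => a; rewrite /res0 corner_projK -map_comp (eq_map pK) map_id.
Qed.

Lemma extension1 (B A : algType k) (N : bimod B A) (jB : corner_map B T)
    (jA : corner_map A T) (jN : N -> T) i j pB pN pA :
  jB 1 = idem D i -> jA 1 = idem D j -> linear pB -> linear pN -> linear pA ->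
  cancel jB pB -> cancel jN pN -> cancel jA pA ->
  (forall b, pN (jB b) = 0) -> (forall a, pN (jA a) = 0) ->
  (forall c t, pB (diag_idem c * t) = c i *: pB t) ->
  (forall c t, pB (t * diag_idem c) = c i *: pB t) ->
  (forall c t, pN (diag_idem c * t) = c i *: pN t) ->
  (forall c t, pN (t * diag_idem c) = c j *: pN t) ->
  (forall c t, pA (diag_idem c * t) = c j *: pA t) ->
  (forall c t, pA (t * diag_idem c) = c j *: pA t) ->
  forall l (f : seq B * N * seq A -> corner X jB jA), is_ext_cochain l f ->
  exists g : seq T -> corner X jB jA,
    [/\ rel_cochain X (span_idem (D := D)) l.+1 (fun s => corner_val (g s)),
        res1 jB jA jN (fun s => corner_val (g s)) = f
      & forall s, all (fun t => pN t == 0) s -> g s = 0].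
Proof.
move=> jB1 jA1 pBl pNl pAl pBK pNK pAK pNB pNA Bl Br Nl Nr Al Ar l f
  [fb fn fa f0].
exists (split_sum pB pN pA (fun b n a => f (b, n, a))).
split; last by move=> s; apply: split_sum_pN0.
  apply: (graded_rel_cochain jB1 jA1) => [|s ns|c].
  - exact: multilinear_split_sum.
  - by apply: split_sum_eq0 => b n a e; apply: f0 => el; apply: ns;
      rewrite -e el.
  - apply: (@graded_split_sum _ _ _ _ _ _ _ _ (c j)) => // b n.
    exact: (@graded_map _ _ _ _ _ _ pA (fun a => f (b, n, a))).
apply/funext => -[[b n] a]; rewrite /res1 corner_projK split_sum_cat //.
- by rewrite pNK -!map_comp (eq_map pBK) (eq_map pAK) !map_id.
- by rewrite all_map; apply/allP => u _ /=; rewrite pNB.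
- by rewrite all_map; apply/allP => u _ /=; rewrite pNA.
Qed.

(** Two nested sums over positions: the outer one places the letter of M32 and
hands the rest of the word, still in T, to the inner one, which places the
letter of M21. *)
Lemma extension2 l
    (f : seq (A3 D) * M32 D * seq (A2 D) * M21 D * seq (A1 D) -> corner X in3
      in1) :
  is_hyperext_cochain l f ->
  exists g : seq T -> corner X in3 in1,
    [/\ rel_cochain X (span_idem (D := D)) l.+2 (fun s => corner_val (g s)),
        res1 in3 in1 in31 (fun s => corner_val (g s)) = 0
      & res2 (fun s => corner_val (g s)) = f].
Proof.
move=> [[fa fy fb fx fc] f0].
pose inner a y w := split_sum entry2 entry21 entry1
  (fun b x c => f (a, y, b, x, c)) w.
exists (split_sum entry3 entry32 id inner).
have innerL c a a' a'' y y' y'' w :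
    (forall b x e, f (a, y, b, x, e) = c *: f (a', y', b, x, e) + f
      (a'', y'', b, x, e)) ->
    inner a y w = c *: inner a' y' w + inner a'' y'' w.
  by move=> e; rewrite -split_sumL; apply: eq_split_sum.
have inner_a y w : multilinear (fun a => inner a y w).
  by move=> s1 s2 c u v; apply: innerL => b x e; apply: fa.
have inner_y a w : linear (fun y => inner a y w).
  by move=> c u v; apply: innerL => b x e; apply: fy.
have inner_w a y : multilinear (fun w => inner a y w).
  exact: multilinear_split_sum.
split.
- apply: (@graded_rel_cochain _ _ in3 in1 vtx3 vtx1) => // [|s ns|c].
  + exact: multilinear_split_sum.
  + apply: split_sum_eq0 => a y w e; apply: split_sum_eq0 => b x c e'.
    by apply: f0 => el; apply: ns; rewrite -e -e' -el addnS addnA.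
  apply: (@graded_split_sum _ _ _ _ _ _ _ _ (c vtx2)) => //.
  + move=> a y.
    have -> : (fun s => inner a y (map id s)) = inner a y.
      by apply/funext => s; rewrite map_id.
    apply: (@graded_split_sum _ _ _ _ _ _ _ _ (c vtx1)) => //.
    move=> b x; apply: (@graded_map _ _ _ _ _ _ entry1
      (fun e => f (a, y, b, x, e))).
    * exact: fc.
    * exact: entry1_mull.
    * exact: entry1_mulr.
    * exact: entry2_mull.
    * exact: entry2_mulr.
    * exact: entry21_mull.
    * exact: entry21_mulr.
  + exact: entry3_mull.
  + exact: entry3_mulr.
  + exact: entry32_mull.
  + exact: entry32_mulr.
- apply/funext => -[[a z] c]; rewrite /res1 corner_projK split_sum_pN0 //.
  rewrite all_cat /= eqxx; apply/andP; split.
    by rewrite all_map; apply/allP => u _ /=.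
  by rewrite all_map; apply/allP => u _ /=.
- apply/funext => -[[[[a y] b] x] c];
    rewrite /res2 corner_projK split_sum_cat //.
  + rewrite map_id /inner split_sum_cat //.
    * rewrite -!map_comp (eq_map (g := id)) //
        [map (entry2 \o _) _](eq_map (g := id)) //.
      by rewrite [map (entry1 \o _) _](eq_map (g := id)) // !map_id.
    * by rewrite all_map; apply/allP => u _ /=.
    * by rewrite all_map; apply/allP => u _ /=.
  + by rewrite all_map; apply/allP => u _ /=.
  + rewrite all_cat /= eqxx; apply/andP; split.
      by rewrite all_map; apply/allP => u _ /=.
    by rewrite all_map; apply/allP => u _ /=.
Qed.

Lemma res0_linear (A : algType k) (j : corner_map A T) :
  linear (res0 j : (seq T -> X) -> seq A -> corner X j j).
Proof.
move=> c f g; apply/funext => a.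
by apply: (corner_proj_linear X j j c (f (map j a)) (g (map j a))).
Qed.

Lemma res1_linear (B A : algType k) (N : Type) (jB : corner_map B T)
    (jA : corner_map A T) (jN : N -> T) :
  linear (res1 jB jA jN : (seq T -> X) -> _ -> corner X jB jA).
Proof.
move=> c f g; apply/funext => -[[b n] a].
exact: (corner_proj_linear X jB jA c (f (word1 jB jA jN b n a)) (g _)).
Qed.

Lemma res2_linear : linear (@res2 k D X : _ -> _ -> corner X in3 in1).
Proof.
move=> u f g; apply/funext => -[[[[a y] b] x] c].
exact: (corner_proj_linear X in3 in1 u (f (word2 a y b x c)) (g _)).
Qed.

(** The three extensions take values in different diagonal corners, so they do
not interfere, and they have no component of weight 1. *)
Lemma cochain_lift0 l (f1 : seq (A1 D) -> corner X in1 in1)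
    (f2 : seq (A2 D) -> corner X in2 in2) (f3 : seq (A3 D) -> corner X in3 in3)
      :
  is_hoch_cochain l f1 -> is_hoch_cochain l f2 -> is_hoch_cochain l f3 ->
  exists x, [/\ rel_cochain X (span_idem (D := D)) l x,
    [/\ res0 in1 x = f1, res0 in2 x = f2 & res0 in3 x = f3]
  & [/\ res1 in2 in1 in21 x = 0, res1 in3 in2 in32 x = 0
      & res1 in3 in1 in31 x = 0]].
Proof.
have pK1 : cancel in1 (@entry1 k D) by [].
have pK2 : cancel in2 (@entry2 k D) by [].
have pK3 : cancel in3 (@entry3 k D) by [].
move=> /(@extension0 _ _ vtx1 entry1 erefl _ pK1 entry1_mull entry1_mulr)[//|g1
  [r1 e1]].
move=> /(@extension0 _ _ vtx2 entry2 erefl _ pK2 entry2_mull entry2_mulr)[//|g2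
  [r2 e2]].
move=> /(@extension0 _ _ vtx3 entry3 erefl _ pK3 entry3_mull entry3_mulr)[//|g3
  [r3 e3]].
exists ((fun s => corner_val (g1 s)) + (fun s => corner_val (g2 s))
        + (fun s => corner_val (g3 s))).
split; first by do 2?apply: submodD.
  rewrite !(linearDf _ _ (@res0_linear _ _)) e1 e2 e3.
  have orth (A A' : algType k) (j : corner_map A T) (j' : corner_map A' T) i i'
      (g : seq T -> corner X j j) :
      j 1 = idem D i -> j' 1 = idem D i' -> (i', i') != (i, i) ->
      res0 j' (fun s => corner_val (g s)) = 0.
    by move=> j1 j'1 ne; apply/funext => a; apply: corner_proj_orthogonal ne.
  rewrite (orth _ _ in2 in1 vtx2 vtx1) // (orth _ _ in3 in1 vtx3 vtx1) //.
  rewrite (orth _ _ in1 in2 vtx1 vtx2) // (orth _ _ in3 in2 vtx3 vtx2) //.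
  rewrite (orth _ _ in1 in3 vtx1 vtx3) // (orth _ _ in2 in3 vtx2 vtx3) //.
  by split; rewrite ?add0r ?addr0.
have orth (A B' A' : algType k) (j : corner_map A T) (jB : corner_map B' T)
    (jA : corner_map A' T) (N : Type) (jN : N -> T) i i' j'
      (g : seq T -> corner X j j) :
    j 1 = idem D i -> jB 1 = idem D i' -> jA 1 = idem D j' -> (i', j') !=
      (i, i) ->
    res1 jB jA jN (fun s => corner_val (g s)) = 0.
  by move=> j1 j'1 j'2 ne; apply/funext => -[[b n] a];
    apply: corner_proj_orthogonal ne.
rewrite !(linearDf _ _ (@res1_linear _ _ _ _ _ _)).
split.
- rewrite (orth _ _ _ in1 in2 in1 _ in21 vtx1 vtx2 vtx1) //.
  rewrite (orth _ _ _ in2 in2 in1 _ in21 vtx2 vtx2 vtx1) //.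
  by rewrite (orth _ _ _ in3 in2 in1 _ in21 vtx3 vtx2 vtx1) // !addr0.
- rewrite (orth _ _ _ in1 in3 in2 _ in32 vtx1 vtx3 vtx2) //.
  rewrite (orth _ _ _ in2 in3 in2 _ in32 vtx2 vtx3 vtx2) //.
  by rewrite (orth _ _ _ in3 in3 in2 _ in32 vtx3 vtx3 vtx2) // !addr0.
- rewrite (orth _ _ _ in1 in3 in1 _ in31 vtx1 vtx3 vtx1) //.
  rewrite (orth _ _ _ in2 in3 in1 _ in31 vtx2 vtx3 vtx1) //.
  by rewrite (orth _ _ _ in3 in3 in1 _ in31 vtx3 vtx3 vtx1) // !addr0.
Qed.

(** The corner of the values separates the three extensions from each other and
from weight 0.  In weight 2 only the extension from M31 has values in the right
corner, and it vanishes on words with no letter in M31. *)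
Lemma cochain_lift1 l
  (f21 : seq (A2 D) * M21 D * seq (A1 D) -> corner X in2 in1)
    (f32 : seq (A3 D) * M32 D * seq (A2 D) -> corner X in3 in2)
    (f31 : seq (A3 D) * M31 D * seq (A1 D) -> corner X in3 in1) :
  is_ext_cochain l f21 -> is_ext_cochain l f32 -> is_ext_cochain l f31 ->
  exists x, [/\ filtration X 1 l.+1 x,
    [/\ res1 in2 in1 in21 x = f21, res1 in3 in2 in32 x = f32
      & res1 in3 in1 in31 x = f31]
  & res2 x = 0].
Proof.
have p1l : linear (@entry1 k D) by [].
have p2l : linear (@entry2 k D) by [].
have p3l : linear (@entry3 k D) by [].
have p21l : linear (@entry21 k D) by [].
have p32l : linear (@entry32 k D) by [].
have p31l : linear (@entry31 k D) by [].
have pK1 : cancel in1 (@entry1 k D) by [].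
have pK2 : cancel in2 (@entry2 k D) by [].
have pK3 : cancel in3 (@entry3 k D) by [].
have pK21 : cancel in21 (@entry21 k D) by [].
have pK32 : cancel in32 (@entry32 k D) by [].
have pK31 : cancel in31 (@entry31 k D) by [].
move=> c21 c32 c31.
have [g1 [r1 e1 _]] :=
  @extension1 _ _ _ in2 in1 in21 vtx2 vtx1 _ _ _ erefl erefl p2l p21l p1l
  pK2 pK21 pK1 (fun=> erefl) (fun=> erefl) entry2_mull entry2_mulr entry21_mull
    entry21_mulr entry1_mull entry1_mulr
  _ _ c21.
have [g2 [r2 e2 _]] :=
  @extension1 _ _ _ in3 in2 in32 vtx3 vtx2 _ _ _ erefl erefl p3l p32l p2l
  pK3 pK32 pK2 (fun=> erefl) (fun=> erefl) entry3_mull entry3_mulr entry32_mull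
    entry32_mulr entry2_mull entry2_mulr
  _ _ c32.
have [g3 [r3 e3 z3]] :=
  @extension1 _ _ _ in3 in1 in31 vtx3 vtx1 _ _ _ erefl erefl p3l p31l p1l
  pK3 pK31 pK1 (fun=> erefl) (fun=> erefl) entry3_mull entry3_mulr entry31_mull
    entry31_mulr entry1_mull entry1_mulr
  _ _ c31.
exists ((fun s => corner_val (g1 s)) + (fun s => corner_val (g2 s))
        + (fun s => corner_val (g3 s))).
have orth0 (A' B A : algType k) (j' : corner_map A' T) (jB : corner_map B T)
    (jA : corner_map A T) i' i j (g : seq T -> corner X jB jA) :
    jB 1 = idem D i -> jA 1 = idem D j -> j' 1 = idem D i' -> (i', i') !=
      (i, j) ->
    res0 j' (fun s => corner_val (g s)) = 0.
  by move=> j1 j2 j'1 ne; apply/funext => a; apply: corner_proj_orthogonal ne.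
have orth1 (B' A' B A : algType k) (jB' : corner_map B' T)
  (jA' : corner_map A' T)
    (N : Type) (jN : N -> T) (jB : corner_map B T)
    (jA : corner_map A T) i' j' i j (g : seq T -> corner X jB jA) :
    jB 1 = idem D i -> jA 1 = idem D j -> jB' 1 = idem D i' -> jA' 1 = idem D
      j' ->
    (i', j') != (i, j) -> res1 jB' jA' jN (fun s => corner_val (g s)) = 0.
  move=> j1 j2 j'1 j'2 ne; apply/funext => -[[b n] a].
  exact: corner_proj_orthogonal ne.
split.
  apply/filtration1P; split; first by do 2?apply: submodD.
  rewrite !(linearDf _ _ (@res0_linear _ _)); split.
  - rewrite (orth0 _ _ _ in1 in2 in1 vtx1 vtx2 vtx1) //
      (orth0 _ _ _ in1 in3 in2 vtx1 vtx3 vtx2) //.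
    by rewrite (orth0 _ _ _ in1 in3 in1 vtx1 vtx3 vtx1) // !addr0.
  - rewrite (orth0 _ _ _ in2 in2 in1 vtx2 vtx2 vtx1) //
      (orth0 _ _ _ in2 in3 in2 vtx2 vtx3 vtx2) //.
    by rewrite (orth0 _ _ _ in2 in3 in1 vtx2 vtx3 vtx1) // !addr0.
  - rewrite (orth0 _ _ _ in3 in2 in1 vtx3 vtx2 vtx1) //
      (orth0 _ _ _ in3 in3 in2 vtx3 vtx3 vtx2) //.
    by rewrite (orth0 _ _ _ in3 in3 in1 vtx3 vtx3 vtx1) // !addr0.
  rewrite !(linearDf _ _ (@res1_linear _ _ _ _ _ _)) e1 e2 e3; split.
- rewrite (orth1 _ _ _ _ in2 in1 _ in21 in3 in2 vtx2 vtx1 vtx3 vtx2) //.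
  by rewrite (orth1 _ _ _ _ in2 in1 _ in21 in3 in1 vtx2 vtx1 vtx3 vtx1) //
    !addr0.
- rewrite (orth1 _ _ _ _ in3 in2 _ in32 in2 in1 vtx3 vtx2 vtx2 vtx1) //.
  by rewrite (orth1 _ _ _ _ in3 in2 _ in32 in3 in1 vtx3 vtx2 vtx3 vtx1) //
    add0r addr0.
- rewrite (orth1 _ _ _ _ in3 in1 _ in31 in2 in1 vtx3 vtx1 vtx2 vtx1) //.
  by rewrite (orth1 _ _ _ _ in3 in1 _ in31 in3 in2 vtx3 vtx1 vtx3 vtx2) //
    !add0r.
have z1 : res2 (fun s => corner_val (g1 s)) = 0.
  apply/funext => -[[[[a y] b] x] c].
  exact: (@corner_proj_orthogonal _ _ in2 in1 vtx2 vtx1 _ _ _ _ in3 in1 vtx3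
    vtx1).
have z2 : res2 (fun s => corner_val (g2 s)) = 0.
  apply/funext => -[[[[a y] b] x] c].
  exact: (@corner_proj_orthogonal _ _ in3 in2 vtx3 vtx2 _ _ _ _ in3 in1 vtx3
    vtx1).
rewrite !(linearDf _ _ res2_linear) z1 z2 !add0r.
apply/funext => -[[[[a y] b] x] c].
rewrite /res2 corner_projK z3 // !all_cat /= all_cat /= !all_map.
by do !(apply/andP; split=> //); apply/allP => u _ /=.
Qed.

Lemma cochain_lift2 l
    (f : seq (A3 D) * M32 D * seq (A2 D) * M21 D * seq (A1 D) -> corner X in3
      in1) :
  is_hyperext_cochain l f -> exists x, filtration X 2 l.+2 x /\ res2 x = f.
Proof.
move=> /extension2[g [rg e31 e2]]; exists (fun s => corner_val (g s));
  split=> //.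
apply/filtration2P; split; last first.
  split=> //; apply/funext => -[[b n] a].
    exact: (@corner_proj_orthogonal _ _ in3 in1 vtx3 vtx1 _ _ _ _ in2 in1 vtx2
      vtx1).
  exact: (@corner_proj_orthogonal _ _ in3 in1 vtx3 vtx1 _ _ _ _ in3 in2 vtx3
    vtx2).
apply/filtration1P; split=> //; split; apply/funext => a.
- exact: (@corner_proj_orthogonal _ _ in3 in1 vtx3 vtx1 _ _ _ _ in1 in1 vtx1
    vtx1).
- exact: (@corner_proj_orthogonal _ _ in3 in1 vtx3 vtx1 _ _ _ _ in2 in2 vtx2
    vtx2).
- exact: (@corner_proj_orthogonal _ _ in3 in1 vtx3 vtx1 _ _ _ _ in3 in3 vtx3
    vtx3).
Qed.

End Extensions.

(** * Subquotients and the first page of a filtered complex *)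

Section SubquotientMaps.
Context {k : pzRingType} {V U : lmodType k}.
Variables (Z B : submod V) (q : V -> U).
Hypothesis q_lin : forall c u v, Z u -> Z v -> q (c *: u + v) = c *: q u + q v.
Hypothesis q_ker : forall u, Z u -> q u = 0 <-> B u.
Hypothesis q_surj : forall w, exists2 u, Z u & q u = w.

(** A map which is linear on Z with kernel B induces an isomorphism; on a coset
it is evaluated at the chosen representative. *)
Lemma subquot_iso : exists Phi : {linear subquot Z B -> U},
  bijective Phi /\ forall u, Z u -> Phi (cls Z B u) = q u.
Proof.
have qB u v : Z u -> Z v -> q u = q v <-> B (u - v).
  move=> Zu Zv; rewrite -q_ker; last exact: submodB.
  rewrite -[u - v]addrC -scaleN1r q_lin // scaleN1r addrC.
  by split=> [->|/eqP]; rewrite ?subrr // subr_eq0 => /eqP.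
pose Phi (p : subquot Z B) := q (rep p).
have PhiE u : Z u -> Phi (cls Z B u) = q u.
  by move=> Zu; apply/qB => //; [apply: repP|apply: rep_cls].
have Phi_lin : linear Phi.
  move=> c p r; rewrite -[p]repK -[r]repK.
  move: (rep p) (repP p) (rep r) (repP r) => u Zu v Zv.
  rewrite -[c *: cls Z B u + _]/(sq_add (sq_scale c (cls Z B u)) (cls Z B v)).
  rewrite cls_scale // cls_add //; last exact: submodZ.
  by rewrite !PhiE ?q_lin //; apply: submodL.
exists (HB.pack_for {linear subquot Z B -> U} Phi
  (GRing.isLinear.Build _ _ _ _ _ Phi_lin)); split=> //=.
exists (fun w => cls Z B (s2val (cid2 (q_surj w)))) => [p|w].
  rewrite -[RHS]repK; case: cid2 => u Zu /= qu; apply/eq_cls => //;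
    first exact: repP.
  by apply/qB => //; exact: repP.
by case: cid2 => u Zu /= qu; rewrite PhiE.
Qed.

End SubquotientMaps.

Section CohomologyClasses.
Context {k : pzRingType} {V : lmodType k}.
Variables (d : {linear V -> V}) (C : nat -> submod V) (l : nat).

Lemma coh_class_linear c u v : cocycles d C l u -> cocycles d C l v ->
  coh_class d C l (c *: u + v) = c *: coh_class d C l u + coh_class d C l v.
Proof.
move=> Zu Zv; rewrite -[RHS]/(sq_add (sq_scale c (cls _ _ u)) (cls _ _ v)).
by rewrite cls_scale // cls_add //; apply: submodZ.
Qed.

Lemma coh_class_eq0 u : cocycles d C l u ->
  coh_class d C l u = 0 <-> coboundaries d C l u.
Proof.
move=> Zu; rewrite -[0]/(cls _ _ 0) /coh_class.
by rewrite eq_cls // ?subr0 //; apply: submod0.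
Qed.

Lemma coh_class_surj (w : cohomology d C l) :
  exists2 z, cocycles d C l z & coh_class d C l z = w.
Proof. by exists (rep w); [apply: repP|apply: repK]. Qed.

End CohomologyClasses.

Section FirstPage.
Context {k : pzRingType} {V : lmodType k}.
Variables (d : {linear V -> V}) (F : nat -> nat -> submod V).
Hypothesis dd : forall x, d (d x) = 0.

(** On the first page the boundaries are those of the graded pieces. *)
Lemma ssB1_succ t n x : ssZ d F 1 t n.+1 x -> ssB d F 1 t n.+1 x <->
  exists w, [/\ F t n w, F t n.+1 (d w) & F t.+1 n.+1 (x - d w)].
Proof.
move=> [Fx Fdx]; split=> [[y [z [Fy Fdy Dz ->]]]|[w [Fw Fdw Fxw]]].
  move: Dz => [w []]; rewrite subn1 /= => Fw Fdw ->.
  by exists w; rewrite addrK.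
exists (x - d w), (d w); split=> //; last by rewrite subrK.
  by rewrite linearB dd subr0.
by exists w; rewrite subn1.
Qed.

Lemma ssB1_0 t x : ssZ d F 1 t 0 x -> ssB d F 1 t 0 x <-> F t.+1 0 x.
Proof.
move=> [Fx Fdx]; split=> [[y [z [Fy Fdy -> ->]]]|Fx']; first by rewrite addr0.
by exists x, 0; rewrite addr0.
Qed.

(** Changing the representative by a boundary y + d w changes d x by d y, with y
one step further in the filtration, which is a boundary on the next column. *)
Lemma ss_d_class t n x : ssZ d F 1 t n x ->
  ss_d (ss_class d F 1 t n x) = ss_class d F 1 (t + 1) n.+1 (d x).
Proof.
have Zd u : ssZ d F 1 t n u -> ssZ d F 1 (t + 1) n.+1 (d u).
  by move=> [_ Fdu]; split=> //; rewrite dd; apply: submod0.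
move=> Zx; have Zr := repP (ss_class d F 1 t n x).
apply/eq_cls; [exact: Zd|exact: Zd|].
have [y [z [Fy Fdy Dz e]]] := rep_cls (ssB d F 1 t n) Zx.
have dz : d z = 0.
  by case: n Dz {Zd x Zx Zr y Fy Fdy e} => [->|n [w [_ _ ->]]];
    rewrite ?linear0 ?dd.
exists 0, (d y); rewrite linear0; split; [exact: submod0|exact: submod0| |].
  by exists y; split=> //; rewrite addn1 subn1.
by rewrite -linearB e linearD dz addr0 add0r.
Qed.

End FirstPage.

(** * Cochains of the bar complexes *)

Section CochainComponents.
Context {k : fieldType} {D : triangular k} {X : bimod (tri D) (tri D)}.
Local Notation T := (tri D).
Implicit Type x : seq T -> X.

Lemma map_multilinear (A W : lmodType k) (V : lmodType k) (j : A -> V)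
  (f : seq V -> W)
  s0 s3 : linear j -> multilinear f ->
  multilinear (fun a => f (s0 ++ map j a ++ s3)).
Proof.
move=> jl mf s1 s2 c u v; rewrite !map_cat /= jl.
by rewrite -!catA !(catA s0) !cat_cons; apply: mf.
Qed.

Lemma linear_comp_proj (B A : algType k) (jB : corner_map B T)
  (jA : corner_map A T)
  (V : lmodType k) (f : V -> X) :
  linear f -> linear (fun v => corner_proj X jB jA (f v) : corner X jB jA).
Proof. by move=> lf c u v; rewrite lf; apply: corner_proj_linear. Qed.

Lemma multilinear_comp_proj (B A : algType k) (jB : corner_map B T)
  (jA : corner_map A T)
  (V : lmodType k) (f : seq V -> X) :
  multilinear f -> multilinear
    (fun v => corner_proj X jB jA (f v) : corner X jB jA).
Proof. by move=> mf s1 s2 c u v; rewrite mf; apply: corner_proj_linear. Qed.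

Lemma res0_cochain l x (A : algType k) (j : corner_map A T) :
  is_hoch_cochain l x -> is_hoch_cochain l (res0 j x : _ -> corner X j j).
Proof.
move=> [mx sx]; split.
  apply: multilinear_comp_proj => s1 s2 c u v.
  by rewrite !map_cat /= corner_linear; apply: mx.
move=> s ns; rewrite /res0 sx ?size_map //.
exact: (linear0f (corner_proj_linear _ _ _)).
Qed.

Lemma res1_cochain l x (B A : algType k) (N : bimod B A) (jB : corner_map B T)
    (jA : corner_map A T) (jN : N -> T) : linear jN ->
  is_hoch_cochain l.+1 x -> is_ext_cochain l
    (res1 jB jA jN x : _ -> corner X jB jA).
Proof.
move=> jNl [mx sx]; split.
- move=> n a; apply: multilinear_comp_proj.
  exact: (map_multilinear [::] (jN n :: map jA a) (@corner_linear _ _ _ jB) mx).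
- move=> b a; apply: linear_comp_proj => c u v; rewrite jNl; apply: mx.
- move=> b n; apply: multilinear_comp_proj => s1 s2 c u v.
  rewrite map_cat /= corner_linear -cat_cons catA mx -!catA /=.
  by rewrite !map_cat.
- move=> b n a ne; rewrite /res1 sx ?(linear0f (corner_proj_linear _ _ _)) //.
  by rewrite size_cat /= !size_map addnS; congruence.
Qed.

Lemma res2_cochain l x : is_hoch_cochain l.+2 x ->
  is_hyperext_cochain l (res2 x : _ -> corner X in3 in1).
Proof.
move=> [mx sx]; split; first split.
- move=> y b x' c; apply: multilinear_comp_proj.
  exact: (map_multilinear [::] (in32 y :: _) (@corner_linear _ _ _ in3) mx).
- move=> a b x' c; apply: linear_comp_proj => e u v; rewrite in32_linear;
    apply: mx.
- move=> a y x' c; apply: multilinear_comp_proj => s1 s2 e u v.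
  have := map_multilinear (rcons (map in3 a) (in32 y)) (in21 x' :: map in1 c)
    (@corner_linear _ _ _ in2) mx s1 s2 e u v.
  by rewrite !cat_rcons.
- move=> a y b c; apply: linear_comp_proj => e u v.
  by rewrite in21_linear -!cat_cons !catA; apply: mx.
- move=> a y b x'; apply: multilinear_comp_proj => s1 s2 e u v.
  have := map_multilinear (rcons (map in3 a ++ in32 y :: map in2 b) (in21 x'))
    [::]
    (@corner_linear _ _ _ in1) mx s1 s2 e u v.
  by rewrite !cats0 !cat_rcons -!catA.
move=> a y b x' c ne;
  rewrite /res2 sx ?(linear0f (corner_proj_linear _ _ _)) //.
by rewrite !size_cat /= size_cat /= !size_map !addnS addnA; congruence.
Qed.

End CochainComponents.

Section BarCochains.
Context {k : fieldType} {B A : algType k} {N Y : bimod B A}.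

Lemma bimod_ext_cochain l (f : seq B * N * seq A -> Y) :
  is_ext_cochain l f -> bar_cochain N Y l (bimod_ext f).
Proof.
move=> [fb fn fa f0]; split; first split.
- move=> n a s1 s2 c u v; rewrite !bimod_extE.
  case/lastP: a => [|a a0]; first by rewrite /= scaler0 addr0.
  by rewrite !rext_rcons (multilinear_lext (fb n a)) ract_linearl.
- move=> b a c u v; rewrite !bimod_extE; case: b => [|b0 b].
    by case: a => [|a0 a]; rewrite /= ?ract0l ?scaler0 ?addr0.
  case/lastP: a => [|a a0]; first by rewrite /= scaler0 addr0.
  by rewrite !rext_rcons /= fn lact_linearr ract_linearl.
- move=> b n s1 s2 c u v; rewrite !bimod_extE;
    apply: multilinear_rext => {}s1 {}s2 {}c {}u {}v.
  by case: b => [|b0 b] /=; rewrite ?scaler0 ?addr0 // fa lact_linearr.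
- move=> [|b0 b] n a //; case/lastP: a => [|a a0] /=; rewrite ?bimod_ext_nil //.
  rewrite bimod_ext_cons => ne; rewrite f0 ?lact0r ?ract0l //.
  by move=> e; move: ne; rewrite size_rcons /= addSn addnS e eqxx.
- move=> b0 b1 b n a; case/lastP: a => [|a a0];
    first by rewrite !bimod_ext_nil lact0r.
  by rewrite !bimod_ext_cons lactM !lractA.
- move=> [|b0 b] n a a1 a0; first by rewrite /bimod_ext ract0l.
  by rewrite !bimod_ext_cons ractM.
Qed.

(** Free bimodules: a bimodule map out of the bar resolution is determined by
its values on the words with outer letters 1. *)
Lemma bar_cochain_ext l z : bar_cochain N Y l z ->
  exists2 f : seq B * N * seq A -> Y, is_ext_cochain l f & z = bimod_ext f.
Proof.
move=> [[zb zn za] z0 zl zr].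
exists (fun t => let '(b, n, a) := t in z (1 :: b, n, rcons a 1)).
  split.
  - by move=> n a s1 s2 c u v; apply: (zb n _ (1 :: s1)).
  - by move=> b a c u v; apply: zn.
  - by move=> b n s1 s2 c u v; rewrite !rcons_cat !rcons_cons; apply: za.
  - move=> b n a ne; apply: z0; rewrite size_rcons /= addSn addnS.
    by apply/negP => /eqP[].
apply/funext => -[[[|b0 b] n] a]; first by rewrite z0.
case/lastP: a => [|a a0]; first by rewrite bimod_ext_nil z0 // andbF.
by rewrite bimod_ext_cons -zl -zr !mulr1 mul1r.
Qed.

End BarCochains.

Section HyperBarCochains.
Context {k : fieldType} {B S A : algType k}.
Context {P : bimod B S} {Q : bimod S A} {Y : bimod B A}.

Lemma hyper_bimod_ext_cochain l (f : seq B * P * seq S * Q * seq A -> Y) :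
  is_hyperext_cochain l f -> hyper_cochain P Q Y l (hyper_bimod_ext f).
Proof.
move=> [[fa fy fb fx fc] f0]; split; first split.
- move=> y b x c s1 s2 e u v; rewrite !hyper_bimod_extE.
  case/lastP: c => [|c c0]; first by rewrite /= scaler0 addr0.
  by rewrite !rext_rcons (multilinear_lext (fa y b x c)) ract_linearl.
- move=> [|a0 a] b x c e u v; first by rewrite /hyper_bimod_ext scaler0 addr0.
  case/lastP: c => [|c c0]; first by rewrite !hyper_bimod_ext_nil scaler0 addr0.
  by rewrite !hyper_bimod_ext_cons fy lact_linearr ract_linearl.
- move=> [|a0 a] y x c s1 s2 e u v;
    first by rewrite /hyper_bimod_ext scaler0 addr0.
  case/lastP: c => [|c c0]; first by rewrite !hyper_bimod_ext_nil scaler0 addr0.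
  by rewrite !hyper_bimod_ext_cons fb lact_linearr ract_linearl.
- move=> [|a0 a] y b c e u v; first by rewrite /hyper_bimod_ext scaler0 addr0.
  case/lastP: c => [|c c0]; first by rewrite !hyper_bimod_ext_nil scaler0 addr0.
  by rewrite !hyper_bimod_ext_cons fx lact_linearr ract_linearl.
- move=> a y b x s1 s2 e u v; rewrite !hyper_bimod_extE.
  apply: multilinear_rext => {}s1 {}s2 {}e {}u {}v.
  by case: a => [|a0 a] /=; rewrite ?scaler0 ?addr0 // fc lact_linearr.
- move=> [|a0 a] y b x c //; case/lastP: c => [|c c0] /=;
    rewrite ?hyper_bimod_ext_nil //.
  rewrite hyper_bimod_ext_cons => ne; rewrite f0 ?lact0r ?ract0l //.
  by move=> e; move: ne; rewrite size_rcons /= !addSn addnS e eqxx.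
- move=> a0 a1 a y b x c; case/lastP: c => [|c c0];
    first by rewrite !hyper_bimod_ext_nil lact0r.
  by rewrite !hyper_bimod_ext_cons lactM !lractA.
- move=> [|a0 a] y b x c c1 c0; first by rewrite /hyper_bimod_ext ract0l.
  by rewrite !hyper_bimod_ext_cons ractM.
Qed.

Lemma hyper_cochain_ext l z : hyper_cochain P Q Y l z ->
  exists2 f : seq B * P * seq S * Q * seq A -> Y,
    is_hyperext_cochain l f & z = hyper_bimod_ext f.
Proof.
move=> [[za zy zb zx zc] z0 zl zr].
exists (fun t => let '(a, y, b, x, c) := t in z (1 :: a, y, b, x, rcons c 1)).
  split; first split.
  - by move=> y b x c s1 s2 e u v; apply: (za y b x _ (1 :: s1)).
  - by move=> a b x c e u v; apply: zy.
  - by move=> a y x c s1 s2 e u v; apply: zb.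
  - by move=> a y b c e u v; apply: zx.
  - by move=> a y b x s1 s2 e u v; rewrite !rcons_cat !rcons_cons; apply: zc.
  - move=> a y b x c ne; apply: z0; rewrite size_rcons /= !addSn addnS.
    by apply/negP => /eqP[].
apply/funext => -[[[[[|a0 a] y] b] x] c]; first by rewrite z0.
case/lastP: c => [|c c0]; first by rewrite hyper_bimod_ext_nil z0 // andbF.
by rewrite hyper_bimod_ext_cons -zl -zr !mulr1 mul1r.
Qed.

End HyperBarCochains.

(** * The identifications of the first page *)

Section FilteredDifferential.
Context {k : fieldType} {D : triangular k} {X : bimod (tri D) (tri D)}.
Local Notation T := (tri D).
Local Notation d := (@hoch_diff k T X).
Implicit Type x : seq T -> X.

Lemma cupl_HH0 (B A : algType k) (jB : corner_map B T) (jA : corner_map A T)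
  (N : Type) (jN : N -> T) :
  cupl_HH jN (0 : seq A -> corner X jA jA) = 0 :> (_ -> corner X jB jA).
Proof.
apply/funext => -[[[|b0 b] n] a] //;
  rewrite /cupl_HH -[corner_val _]/(0 : X) lact0r.
exact: (linear0f (corner_proj_linear _ _ _)).
Qed.

Lemma cupr_HH0 (B A : algType k) (jB : corner_map B T) (jA : corner_map A T)
  (N : Type) (jN : N -> T) :
  cupr_HH jN (0 : seq B -> corner X jB jB) = 0 :> (_ -> corner X jB jA).
Proof.
apply/funext => -[[b n] [|a0 a]] //;
  rewrite /cupr_HH -[corner_val _]/(0 : X) ract0l.
exact: (linear0f (corner_proj_linear _ _ _)).
Qed.

Lemma cupl_Ext0 : cupl_Ext in32 (0 : _ -> corner X in2 in1) = 0
  :> (seq (A3 D) * M32 D * seq (A2 D) * M21 D * seq (A1 D) -> corner X in3 in1).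
Proof.
apply/funext => -[[[[[|a0 a] y] b] x] c] //;
  rewrite /cupl_Ext -[corner_val _]/(0 : X) lact0r.
exact: (linear0f (corner_proj_linear _ _ _)).
Qed.

Lemma cupr_Ext0 : cupr_Ext in21 (0 : _ -> corner X in3 in2) = 0
  :> (seq (A3 D) * M32 D * seq (A2 D) * M21 D * seq (A1 D) -> corner X in3 in1).
Proof.
apply/funext => -[[[[a y] b] x] [|c0 c]] //;
  rewrite /cupr_Ext -[corner_val _]/(0 : X) ract0l.
exact: (linear0f (corner_proj_linear _ _ _)).
Qed.

Lemma delta_mu0 : delta_mu (0 : _ -> corner X in3 in1) = 0.
Proof.
by apply/funext => -[[[[a y] [|b0 b]] x] c] //; rewrite /delta_mu scaler0.
Qed.

Lemma hoch_diff0 (A : algType k) (Y : bimod A A) : hoch_diff (0 : seq A -> Y) =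
  0.
Proof. exact: linear0. Qed.

Lemma filtration1_res1 l x (B A : algType k) (N : bimod B A)
  (jB : corner_map B T)
    (jA : corner_map A T) (jN : N -> T) :
  (forall b n, jN (b *> n) = jB b * jN n) ->
    (forall n a, jN (n <* a) = jN n * jA a) ->
  res0 jB x = 0 -> res0 jA x = 0 -> is_hoch_cochain l x ->
  bimod_ext (res1 jB jA jN (d x) : _ -> corner X jB jA) =
  bar_diff (bimod_ext (res1 jB jA jN x : _ -> corner X jB jA)).
Proof.
move=> jNl jNr e1 e2 hx; rewrite (bimod_ext_res1_hoch jNl jNr hx) e1 e2.
rewrite cupl_HH0 cupr_HH0 scaler0 addr0.
by rewrite (linear0f (@bimod_ext_linear _ _ _ _ _)) addr0.
Qed.

Lemma filtration2_res2 l x : filtration X 2 l x ->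
  hyper_bimod_ext (res2 (d x) : _ -> corner X in3 in1) =
  hyper_diff (hyper_bimod_ext (res2 x : _ -> corner X in3 in1)).
Proof.
move=> Fx; have [[hx _] _] := Fx; have [_ [e1 e2 e3]] :=
  (filtration2P _ _).1 Fx.
rewrite (hyper_bimod_ext_res2_hoch hx) e1 e2 e3 cupl_Ext0 cupr_Ext0 delta_mu0.
rewrite scaler0 !addr0.
by rewrite (linear0f (@hyper_bimod_ext_linear _ _ _ _ _ _ _)) addr0.
Qed.

Lemma filtration1_diff l x : filtration X 1 l x -> filtration X 1 l.+1 (d x).
Proof.
move=> /filtration1P[rx [e1 e2 e3]]; apply/filtration1P; split.
  exact: rel_cochain_diff.
by rewrite !res0_hoch e1 e2 e3 !hoch_diff0.
Qed.

Lemma filtration2_diff l x : filtration X 2 l x -> filtration X 2 l.+1 (d x).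
Proof.
move=> Fx; have [F1 [r1 r2 r3]] := (filtration2P _ _).1 Fx.
have [[hx _] [e1 e2 e3]] := (filtration1P _ _).1 F1.
apply/filtration2P; split; first exact: filtration1_diff.
split; apply: bimod_ext_inj.
- rewrite (filtration1_res1 in2_in21 in21_in1 e2 e1 hx) r1.
  by rewrite (linear0f (@bimod_ext_linear _ _ _ _ _)) linear0.
- rewrite (filtration1_res1 in3_in32 in32_in2 e3 e2 hx) r2.
  by rewrite (linear0f (@bimod_ext_linear _ _ _ _ _)) linear0.
- rewrite (filtration1_res1 in3_in31 in31_in1 e3 e1 hx) r3.
  by rewrite (linear0f (@bimod_ext_linear _ _ _ _ _)) linear0.
Qed.

Lemma d_ss_class t n x : E_cocycle 1 t n x ->
  d_ss (E_class 1 t n x) = E_class 1 (t + 1) n.+1 (d x).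
Proof. by apply: ss_d_class => f; apply: hoch_diff_diff. Qed.

Lemma E_cocycle_diff t n x : E_cocycle 1 t n x -> E_cocycle 1 (t + 1) n.+1
  (d x).
Proof.
move=> [_ Fdx]; split=> //; have := submod0 (filtration X (t + 1 + 1) n.+2).
by rewrite -(hoch_diff_diff x : _ = 0).
Qed.

Local Notation HH_sum l := (HH (corner X in1 in1) l * HH (corner X in2 in2) l
  * HH (corner X in3 in3) l)%type.
Local Notation Ext_sum l := (Ext (M21 D) (corner X in2 in1) l
  * Ext (M32 D) (corner X in3 in2) l * Ext (M31 D) (corner X in3 in1) l)%type.

Lemma E_cocycle_res0 l x : E_cocycle 1 0 l x ->
  [/\ HH_cocycle l (res0 in1 x), HH_cocycle l (res0 in2 x)
    & HH_cocycle l (res0 in3 x)].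
Proof.
move=> [[[hx _] _] /filtration1P[_ [e1 e2 e3]]]; rewrite !res0_hoch in e1 e2 e3.
by split; split=> //; apply: res0_cochain.
Qed.

(** Injectivity: if the components are coboundaries, the cochain extending their
primitives has a coboundary which differs from x by an element of F^1. *)
Lemma identification0 l : exists Phi : {linear E X 1 0 l -> HH_sum l},
  bijective Phi /\ forall x, E_cocycle 1 0 l x ->
    Phi (E_class 1 0 l x) =
    (HH_class l (res0 in1 x), HH_class l (res0 in2 x), HH_class l (res0 in3 x)).
Proof.
pose q x : HH_sum l :=
  (HH_class l (res0 in1 x), HH_class l (res0 in2 x), HH_class l (res0 in3 x)).
apply: (@subquot_iso _ _ _ _ _ q).
- move=> c u v /E_cocycle_res0[u1 u2 u3] /E_cocycle_res0[v1 v2 v3].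
  rewrite /q !res0_linear /HH_class !coh_class_linear //.
- move=> x Zx; have [c1 c2 c3] := E_cocycle_res0 Zx.
  have [/filtrationP[rx _] _] := Zx.
  have qE : q x = 0 <->
    [/\ coboundaries (@hoch_diff k _ (corner X in1 in1)) (hoch_cochain _) l
      (res0 in1 x),
        coboundaries (@hoch_diff k _ (corner X in2 in2)) (hoch_cochain _) l
          (res0 in2 x)
      & coboundaries (@hoch_diff k _ (corner X in3 in3)) (hoch_cochain _) l
        (res0 in3 x)].
    have [[k1 k2] k3] := (coh_class_eq0 c1, coh_class_eq0 c2, coh_class_eq0 c3).
    split=> [e|[/k1 e1 /k2 e2 /k3 e3]].
      split; first by apply/k1; apply: (congr1 (fun p => p.1.1) e).
        by apply/k2; apply: (congr1 (fun p => p.1.2) e).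
      by apply/k3; apply: (congr1 snd e).
    by rewrite /q /HH_class e1 e2 e3.
  apply: (iff_trans qE); case: l q Zx c1 c2 c3 rx {qE} => [|l] q Zx c1 c2 c3 rx.
    apply: (iff_trans _ (iff_sym (ssB1_0 Zx)));
      split=> [[e1 e2 e3]|/filtration1P[_ //]].
    by apply/filtration1P.
  apply: (iff_trans _ (iff_sym (ssB1_succ (@hoch_diff_diff _ _ _) Zx))); split.
    move=> [[y1 h1 e1] [y2 h2 e2] [y3 h3 e3]].
    have [w [rw [w1 w2 w3] _]] := cochain_lift0 h1 h2 h3.
    have rdw := rel_cochain_diff rw.
    exists w; split; [by apply/filtrationP|by apply/filtrationP|].
    apply/filtration1P; split; first exact: submodB.
    rewrite -scaleN1r addrC !res0_linear !scaleN1r !res0_hoch w1 w2 w3 e1 e2 e3.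
    by rewrite !addNr.
  move=> [w [/filtrationP[rw _] _ /filtration1P[_]]].
  rewrite -scaleN1r addrC !res0_linear !scaleN1r !res0_hoch => -[e1 e2 e3].
  split; [exists (res0 in1 w)|exists (res0 in2 w)|exists (res0 in3 w)];
    by [apply: res0_cochain; have [] := rw|apply/eqP; rewrite -subr_eq0 addrC;
      apply/eqP].
- move=> [[w1 w2] w3]; have [z1 [h1 dz1] <-] := coh_class_surj w1.
  have [z2 [h2 dz2] <-] := coh_class_surj w2.
  have [z3 [h3 dz3] <-] := coh_class_surj w3; have [x [rx [e1 e2 e3] _]] :=
    cochain_lift0 h1 h2 h3.
  exists x; last by rewrite /q e1 e2 e3.
  split; first by apply/filtrationP.
  apply/filtration1P; split; first exact: rel_cochain_diff.
  by rewrite !res0_hoch e1 e2 e3.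
Qed.

End FilteredDifferential.

Section Identification.
Context {k : fieldType} {D : triangular k} {X : bimod (tri D) (tri D)}.
Local Notation T := (tri D).
Local Notation d := (@hoch_diff k T X).
Implicit Type x : seq T -> X.
Local Notation Ext_sum l := (Ext (M21 D) (corner X in2 in1) l
  * Ext (M32 D) (corner X in3 in2) l * Ext (M31 D) (corner X in3 in1) l)%type.

Lemma filtration1_bar l x : filtration X 1 l x ->
  [/\ bimod_ext (res1 in2 in1 in21 (d x) : _ -> corner X in2 in1) =
        bar_diff (bimod_ext (res1 in2 in1 in21 x : _ -> corner X in2 in1)),
      bimod_ext (res1 in3 in2 in32 (d x) : _ -> corner X in3 in2) =
        bar_diff (bimod_ext (res1 in3 in2 in32 x : _ -> corner X in3 in2))
    & bimod_ext (res1 in3 in1 in31 (d x) : _ -> corner X in3 in1) =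
        bar_diff (bimod_ext (res1 in3 in1 in31 x : _ -> corner X in3 in1))].
Proof.
move=> /filtration1P[[hx _] [e1 e2 e3]]; split.
- exact: filtration1_res1 in2_in21 in21_in1 e2 e1 hx.
- exact: filtration1_res1 in3_in32 in32_in2 e3 e2 hx.
- exact: filtration1_res1 in3_in31 in31_in1 e3 e1 hx.
Qed.

Lemma bimod_ext0 (B A : algType k) (N Y : bimod B A) :
  bimod_ext (0 : seq B * N * seq A -> Y) = 0.
Proof. exact: (linear0f (@bimod_ext_linear _ _ _ _ _)). Qed.

Lemma hyper_bimod_ext0 (B S A : algType k) (P : bimod B S) (Q : bimod S A)
  (Y : bimod B A) :
  hyper_bimod_ext (0 : seq B * P * seq S * Q * seq A -> Y) = 0.
Proof. exact: (linear0f (@hyper_bimod_ext_linear _ _ _ _ _ _ _)). Qed.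

Lemma bimod_extB (B A : algType k) (N Y : bimod B A)
  (f g : seq B * N * seq A -> Y) :
  bimod_ext (f - g) = bimod_ext f - bimod_ext g.
Proof.
by rewrite -scaleN1r addrC bimod_ext_linear scaleN1r addrC.
Qed.

Lemma res1B (B A : algType k) (N : Type) (jB : corner_map B T)
    (jA : corner_map A T) (jN : N -> T) x y :
  res1 jB jA jN (x - y) = res1 jB jA jN x - res1 jB jA jN y :>
    (_ -> corner X jB jA).
Proof. by rewrite -scaleN1r addrC res1_linear scaleN1r addrC. Qed.

Lemma E_cocycle_res1 l x : E_cocycle 1 1 l.+1 x ->
  [/\ Ext_cocycle l (res1 in2 in1 in21 x), Ext_cocycle l (res1 in3 in2 in32 x)
    & Ext_cocycle l (res1 in3 in1 in31 x)].
Proof.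
move=> [Fx Fdx]; have [[hx _] _] := Fx.
have [b1 b2 b3] := filtration1_bar Fx.
have [_ [e1 e2 e3]] := (filtration2P _ _).1 Fdx.
split; (split; first apply: res1_cochain => //).
- exact: in21_linear.
- by rewrite -b1 e1 bimod_ext0.
- exact: in32_linear.
- by rewrite -b2 e2 bimod_ext0.
- exact: in31_linear.
- by rewrite -b3 e3 bimod_ext0.
Qed.

Lemma Ext_cocycle_bar (B A : algType k) (N Y : bimod B A) l
  (f : seq B * N * seq A -> Y) :
  Ext_cocycle l f -> cocycles (@bar_diff k B A N Y) (bar_cochain N Y) l
    (bimod_ext f).
Proof. by move=> [cf df]; split=> //; apply: bimod_ext_cochain. Qed.

Lemma HyperExt_cocycle_bar (B S A : algType k) (P : bimod B S) (Q : bimod S A)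
    (Y : bimod B A) l (f : seq B * P * seq S * Q * seq A -> Y) :
  HyperExt_cocycle l f ->
  cocycles (@hyper_diff k B S A P Q Y) (hyper_cochain P Q Y) l
    (hyper_bimod_ext f).
Proof. by move=> [cf df]; split=> //; apply: hyper_bimod_ext_cochain. Qed.

(** The same argument as in weight 0, for the components of weight 1; for l = 0
there are no cochains of weight 1 one degree lower, matching the absence of
coboundaries. *)
Lemma identification1 l : exists Phi : {linear E X 1 1 l.+1 -> Ext_sum l},
  bijective Phi /\ forall x, E_cocycle 1 1 l.+1 x ->
    Phi (E_class 1 1 l.+1 x) =
    (Ext_class l (res1 in2 in1 in21 x), Ext_class l (res1 in3 in2 in32 x),
     Ext_class l (res1 in3 in1 in31 x)).
Proof.
pose q x : Ext_sum l :=
  (Ext_class l (res1 in2 in1 in21 x), Ext_class l (res1 in3 in2 in32 x),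
   Ext_class l (res1 in3 in1 in31 x)).
apply: (@subquot_iso _ _ _ _ _ q).
- move=> c u v /E_cocycle_res1[u1 u2 u3] /E_cocycle_res1[v1 v2 v3].
  rewrite /q !res1_linear /Ext_class !bimod_ext_linear.
  by rewrite !coh_class_linear //; apply: Ext_cocycle_bar.
- move=> x Zx; have [c1 c2 c3] := E_cocycle_res1 Zx; have [Fx Fdx] := Zx.
  have qE : q x = 0 <->
    [/\ coboundaries (@bar_diff k _ _ (M21 D) (corner X in2 in1))
      (bar_cochain _ _) l
          (bimod_ext (res1 in2 in1 in21 x)),
        coboundaries (@bar_diff k _ _ (M32 D) (corner X in3 in2))
          (bar_cochain _ _) l
          (bimod_ext (res1 in3 in2 in32 x))
      & coboundaries (@bar_diff k _ _ (M31 D) (corner X in3 in1))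
        (bar_cochain _ _) l
          (bimod_ext (res1 in3 in1 in31 x))].
    have [[k1 k2] k3] := (coh_class_eq0 (Ext_cocycle_bar c1),
      coh_class_eq0 (Ext_cocycle_bar c2), coh_class_eq0 (Ext_cocycle_bar c3)).
    split=> [e|[/k1 e1 /k2 e2 /k3 e3]].
      split; first by apply/k1; apply: (congr1 (fun p => p.1.1) e).
        by apply/k2; apply: (congr1 (fun p => p.1.2) e).
      by apply/k3; apply: (congr1 snd e).
    by rewrite /q /Ext_class e1 e2 e3.
  apply: (iff_trans qE (iff_trans _
    (iff_sym (ssB1_succ (@hoch_diff_diff _ _ _) Zx)))).
  case: l q Zx c1 c2 c3 {qE} Fx Fdx => [|l] q Zx c1 c2 c3 Fx Fdx.
    split=> [[e1 e2 e3]|[w [Fw _ Fxw]]].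
      exists 0; rewrite linear0 subr0; split; try exact: submod0.
      by apply/filtration2P; split=> //; split; apply: bimod_ext_inj;
        rewrite bimod_ext0.
    move: Fxw; rewrite (filtration1_degree0 Fw) linear0 subr0 =>
      /filtration2P[_ [e1 e2 e3]].
    by rewrite e1 e2 e3; split; exact: bimod_ext0.
  split.
    move=> [[y1 /bar_cochain_ext[g1 h1 ->] e1]
      [y2 /bar_cochain_ext[g2 h2 ->] e2]].
    move=> [y3 /bar_cochain_ext[g3 h3 ->] e3].
    have [w [Fw [w1 w2 w3] _]] := cochain_lift1 h1 h2 h3.
    have [b1 b2 b3] := filtration1_bar Fw.
    exists w; split=> //; first exact: filtration1_diff.
    apply/filtration2P; split; first by apply: submodB => //;
      apply: filtration1_diff.
    split; apply: bimod_ext_inj; rewrite res1B bimod_extB bimod_ext0.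
    - by rewrite b1 w1 e1 subrr.
    - by rewrite b2 w2 e2 subrr.
    - by rewrite b3 w3 e3 subrr.
  move=> [w [Fw Fdw /filtration2P[_]]]; have [b1 b2 b3] := filtration1_bar Fw.
  have [[hw _] _] := Fw.
  rewrite !res1B => -[e1 e2 e3]; split.
  - exists (bimod_ext (res1 in2 in1 in21 w)).
      by apply: bimod_ext_cochain; apply: res1_cochain;
        first exact: in21_linear.
    by apply: (etrans _ b1); congr bimod_ext; apply/eqP; rewrite -subr_eq0;
      apply/eqP.
  - exists (bimod_ext (res1 in3 in2 in32 w)).
      by apply: bimod_ext_cochain; apply: res1_cochain;
        first exact: in32_linear.
    by apply: (etrans _ b2); congr bimod_ext; apply/eqP; rewrite -subr_eq0;
      apply/eqP.
  - exists (bimod_ext (res1 in3 in1 in31 w)).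
      by apply: bimod_ext_cochain; apply: res1_cochain;
        first exact: in31_linear.
    by apply: (etrans _ b3); congr bimod_ext; apply/eqP; rewrite -subr_eq0;
      apply/eqP.
- move=> [[w1 w2] w3]; have [_ [/bar_cochain_ext[g1 h1 ->] d1] <-] :=
    coh_class_surj w1.
  have [_ [/bar_cochain_ext[g2 h2 ->] d2] <-] := coh_class_surj w2.
  have [_ [/bar_cochain_ext[g3 h3 ->] d3] <-] := coh_class_surj w3.
  have [x [Fx [e1 e2 e3] _]] := cochain_lift1 h1 h2 h3.
  have [b1 b2 b3] := filtration1_bar Fx.
  exists x; last by rewrite /q e1 e2 e3.
  split=> //; apply/filtration2P; split; first exact: filtration1_diff.
  split; apply: bimod_ext_inj; rewrite bimod_ext0.
  - by rewrite b1 e1.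
  - by rewrite b2 e2.
  - by rewrite b3 e3.
Qed.

Lemma E_cocycle_res2 l x : E_cocycle 1 2 l.+2 x -> HyperExt_cocycle l (res2 x).
Proof.
move=> [Fx Fdx]; have [[hx _] _] := Fx.
split; first exact: res2_cochain.
have [_ e] := (filtration3P _ _).1 Fdx.
by rewrite -(filtration2_res2 Fx) e hyper_bimod_ext0.
Qed.

Lemma identification2 l : exists Phi : {linear E X 1 2 l.+2 ->
    HyperExt (M32 D) (M21 D) (corner X in3 in1) l},
  bijective Phi /\ forall x, E_cocycle 1 2 l.+2 x ->
    Phi (E_class 1 2 l.+2 x) = HyperExt_class l (res2 x).
Proof.
apply: (@subquot_iso _ _ _ _ _ (fun x => HyperExt_class l (res2 x))).
- move=> c u v /E_cocycle_res2 cu /E_cocycle_res2 cv.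
  rewrite res2_linear /HyperExt_class hyper_bimod_ext_linear.
  by rewrite coh_class_linear //; apply: HyperExt_cocycle_bar.
- move=> x Zx; have cx := E_cocycle_res2 Zx; have [Fx Fdx] := Zx.
  apply: (iff_trans (coh_class_eq0 (HyperExt_cocycle_bar cx))).
  apply: (iff_trans _ (iff_sym (ssB1_succ (@hoch_diff_diff _ _ _) Zx))).
  have res2B u v : res2 (u - v) = res2 u - res2 v :> (_ -> corner X in3 in1).
    by rewrite -scaleN1r addrC res2_linear scaleN1r addrC.
  case: l Zx cx Fx Fdx => [|l] Zx cx Fx Fdx.
    split=> [e|[w [Fw _ Fxw]]].
      exists 0; rewrite linear0 subr0; split; try exact: submod0.
      apply/filtration3P; split=> //; apply: hyper_bimod_ext_inj.
      by rewrite hyper_bimod_ext0.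
    move: Fxw; rewrite (filtration2_degree1 Fw) linear0 subr0 =>
      /filtration3P[_ e].
    by rewrite e; exact: hyper_bimod_ext0.
  split.
    move=> [y /hyper_cochain_ext[g hg ->] e].
    have [w [Fw w2]] := cochain_lift2 hg.
    exists w; split=> //; first exact: filtration2_diff.
    apply/filtration3P; split; first by apply: submodB => //;
      apply: filtration2_diff.
    rewrite res2B; apply/eqP; rewrite subr_eq0; apply/eqP.
    by apply: hyper_bimod_ext_inj; rewrite (filtration2_res2 Fw) w2.
  move=> [w [Fw Fdw /filtration3P[_]]]; have [[hw _] _] := Fw.
  rewrite res2B => e; exists (hyper_bimod_ext (res2 w)).
    by apply: hyper_bimod_ext_cochain; apply: res2_cochain.
  apply: (etrans _ (filtration2_res2 Fw)); congr hyper_bimod_ext.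
  by apply/eqP; rewrite -subr_eq0; apply/eqP.
- move=> w; have [_ [/hyper_cochain_ext[g hg ->] dg] <-] := coh_class_surj w.
  have [x [Fx e]] := cochain_lift2 hg.
  exists x; last by rewrite e.
  split=> //; apply/filtration3P; split; first exact: filtration2_diff.
  by apply: hyper_bimod_ext_inj;
    rewrite (filtration2_res2 Fx) e hyper_bimod_ext0.
Qed.

End Identification.

Lemma dependent_choice (I : Type) (V : I -> Type) (P : forall i, V i -> Prop) :
  (forall i, exists v, P i v) -> exists f : forall i, V i, forall i, P i (f i).
Proof.
by move=> exP; exists (fun i => sval (cid (exP i))) => i; apply: svalP.
Qed.

Theorem proposition4p6 (k : fieldType) (D : triangular k)
    (X : bimod (tri D) (tri D)) :
  exists (Phi0 : forall l, {linear E X 1 0 l ->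
             (HH (corner X in1 in1) l * HH (corner X in2 in2) l
              * HH (corner X in3 in3) l)%type})
         (Phi1 : forall l, {linear E X 1 1 l.+1 ->
             (Ext (M21 D) (corner X in2 in1) l
              * Ext (M32 D) (corner X in3 in2) l
              * Ext (M31 D) (corner X in3 in1) l)%type})
         (Phi2 : forall l, {linear E X 1 2 l.+2 ->
             HyperExt (M32 D) (M21 D) (corner X in3 in1) l}),
  [/\ forall l,
        [/\ bijective (Phi0 l), bijective (Phi1 l) & bijective (Phi2 l)],
      [/\ forall l x, E_cocycle 1 0 l x ->
            [/\ HH_cocycle l (res0 in1 x), HH_cocycle l (res0 in2 x),
                HH_cocycle l (res0 in3 x)
              & Phi0 l (E_class 1 0 l x) =
                  (HH_class l (res0 in1 x), HH_class l (res0 in2 x),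
                   HH_class l (res0 in3 x))],
          forall l x, E_cocycle 1 1 l.+1 x ->
            [/\ Ext_cocycle l (res1 in2 in1 in21 x),
                Ext_cocycle l (res1 in3 in2 in32 x),
                Ext_cocycle l (res1 in3 in1 in31 x)
              & Phi1 l (E_class 1 1 l.+1 x) =
                  (Ext_class l (res1 in2 in1 in21 x),
                   Ext_class l (res1 in3 in2 in32 x),
                   Ext_class l (res1 in3 in1 in31 x))]
        & forall l x, E_cocycle 1 2 l.+2 x ->
            HyperExt_cocycle l (res2 x) /\
            Phi2 l (E_class 1 2 l.+2 x) = HyperExt_class l (res2 x)],
      forall l (f : seq (A1 D) -> corner X in1 in1)
               (g : seq (A2 D) -> corner X in2 in2)
               (h : seq (A3 D) -> corner X in3 in3),
        HH_cocycle l f -> HH_cocycle l g -> HH_cocycle l h ->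
        let u21 : seq (A2 D) * M21 D * seq (A1 D) -> corner X in2 in1 :=
          cupl_HH in21 f + (-1) ^+ l.+1 *: cupr_HH in21 g in
        let u32 : seq (A3 D) * M32 D * seq (A2 D) -> corner X in3 in2 :=
          cupl_HH in32 g + (-1) ^+ l.+1 *: cupr_HH in32 h in
        let u31 : seq (A3 D) * M31 D * seq (A1 D) -> corner X in3 in1 :=
          cupl_HH in31 f + (-1) ^+ l.+1 *: cupr_HH in31 h in
        [/\ Ext_cocycle l u21, Ext_cocycle l u32, Ext_cocycle l u31
          & forall xi : E X 1 0 l,
              Phi0 l xi = (HH_class l f, HH_class l g, HH_class l h) ->
              Phi1 l (d_ss xi) =
                (Ext_class l u21, Ext_class l u32, Ext_class l u31)]
    & forall l (f : seq (A2 D) * M21 D * seq (A1 D) -> corner X in2 in1)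
               (g : seq (A3 D) * M32 D * seq (A2 D) -> corner X in3 in2)
               (h : seq (A3 D) * M31 D * seq (A1 D) -> corner X in3 in1),
        Ext_cocycle l f -> Ext_cocycle l g -> Ext_cocycle l h ->
        let u : seq (A3 D) * M32 D * seq (A2 D) * M21 D * seq (A1 D) ->
                corner X in3 in1 :=
          cupl_Ext in32 f + (-1) ^+ l.+2 *: cupr_Ext in21 g + delta_mu h in
        HyperExt_cocycle l u /\
        forall xi : E X 1 1 l.+1,
          Phi1 l xi = (Ext_class l f, Ext_class l g, Ext_class l h) ->
          Phi2 l (d_ss xi) = HyperExt_class l u].
Proof.
have [Phi0 Phi0P] := dependent_choice (@identification0 k D X).
have [Phi1 Phi1P] := dependent_choice (@identification1 k D X).
have [Phi2 Phi2P] := dependent_choice (@identification2 k D X).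
exists Phi0, Phi1, Phi2; split.
- by move=> l; split; [case: (Phi0P l)|case: (Phi1P l)|case: (Phi2P l)].
- split=> l x Zx.
  + have [c1 c2 c3] := E_cocycle_res0 Zx; split=> //; exact: (Phi0P l).2.
  + have [c1 c2 c3] := E_cocycle_res1 Zx; split=> //; exact: (Phi1P l).2.
  + by split; [exact: E_cocycle_res2|exact: (Phi2P l).2].
- move=> l f g h [hf df] [hg dg] [hh dh] u21 u32 u31.
  have [x [rx [e1 e2 e3] [z21 z32 z31]]] := cochain_lift0 hf hg hh.
  have [hx _] := rx.
  have Zx : E_cocycle 1 0 l x.
    split; first by apply/filtrationP.
    apply/filtration1P; split; first exact: rel_cochain_diff.
    by rewrite !res0_hoch e1 e2 e3.
  (* The weight 1 components of x vanish; those of d x are the cup products. *)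
  have r21 : res1 in2 in1 in21 (hoch_diff x) = u21.
    apply: bimod_ext_inj; rewrite (bimod_ext_res1_hoch in2_in21 in21_in1 hx).
    by rewrite z21 e1 e2 bimod_ext0 linear0 add0r.
  have r32 : res1 in3 in2 in32 (hoch_diff x) = u32.
    apply: bimod_ext_inj; rewrite (bimod_ext_res1_hoch in3_in32 in32_in2 hx).
    by rewrite z32 e2 e3 bimod_ext0 linear0 add0r.
  have r31 : res1 in3 in1 in31 (hoch_diff x) = u31.
    apply: bimod_ext_inj; rewrite (bimod_ext_res1_hoch in3_in31 in31_in1 hx).
    by rewrite z31 e1 e3 bimod_ext0 linear0 add0r.
  have Zdx := E_cocycle_diff Zx.
  have := E_cocycle_res1 Zdx; rewrite r21 r32 r31 => -[c1 c2 c3].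
  split=> // xi; rewrite -e1 -e2 -e3 -((Phi0P l).2 _ Zx).
  move=> /(bij_inj (Phi0P l).1) ->; rewrite (d_ss_class Zx).
  by rewrite -r21 -r32 -r31; apply: (Phi1P l).2.
- move=> l f g h [hf df] [hg dg] [hh dh] u.
  have [x [Fx [e1 e2 e3] z2]] := cochain_lift1 hf hg hh.
  have [[hx _] _] := Fx.
  have [b1 b2 b3] := filtration1_bar Fx.
  have Zx : E_cocycle 1 1 l.+1 x.
    split=> //; apply/filtration2P; split; first exact: filtration1_diff.
    split; apply: bimod_ext_inj; rewrite bimod_ext0.
    - by rewrite b1 e1.
    - by rewrite b2 e2.
    - by rewrite b3 e3.
  have r2 : res2 (hoch_diff x) = u.
    apply: hyper_bimod_ext_inj; rewrite (hyper_bimod_ext_res2_hoch hx).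
    by rewrite z2 e1 e2 e3 hyper_bimod_ext0 linear0 add0r.
  have Zdx := E_cocycle_diff Zx.
  split; first by rewrite -r2; apply: E_cocycle_res2.
  move=> xi; rewrite -e1 -e2 -e3 -((Phi1P l).2 _ Zx).
  move=> /(bij_inj (Phi1P l).1) ->; rewrite (d_ss_class Zx) -r2.
  exact: (Phi2P l).2.
Qed.
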